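(* For each virtual knot diagram $K$ and each real crossing point $c$ of $K$, let $\widetilde{K}_c=F(K_c)$ be the unoriented flat virtual knot represented by the shadow of the diagram $K_c$ obtained from $K$ by $0$-smoothing at $c$. Then the assignment $c\mapsto \widetilde{K}_c$ satisfies the chord index axioms, i.e.: (1) the real crossing point involved in an $\Omega_1$ move has a fixed index (an index depending only on the virtual knot represented by the diagram); (2) the two real crossing points involved in an $\Omega_2$ move have the same index; (3) the indices of the three real crossing points involved in an $\Omega_3$ move are respectively preserved under $\Omega_3$; (4) the index of the real crossing point involved in an $\Omega_3^v$ move is preserved under $\Omega_3^v$; (5) the index of any real crossing point not involved in a generalized Reidemeister move is preserved under this move.
   Context: A virtual knot diagram is a generic immersed circle in the plane (finitely many transversal double points), each double point being marked either as a real crossing (with over/under information) or as a virtual crossing. The generalized Reidemeister moves are: the classical Reidemeister moves $\Omega_1,\Omega_2,\Omega_3$ on real crossings; the moves $\Omega_1',\Omega_2',\Omega_3'$, which have the same shapes but with all crossings virtual; and $\Omega_3^v$, a third-Reidemeister-type move in which an arc having only two virtual crossings is moved across one real crossing. A virtual knot is an equivalence class of virtual knot diagrams under these moves (and planar isotopy). A flat virtual knot diagram is defined in the same way, with each real crossing replaced by a flat crossing (no over/under information). The flat generalized Reidemeister moves are obtained from the generalized Reidemeister moves $\Omega_1,\Omega_2,\Omega_3,\Omega_1',\Omega_2',\Omega_3',\Omega_3^v$ by replacing all real crossings with flat crossings. Flat virtual knots are equivalence classes of flat virtual knot diagrams under the flat generalized Reidemeister moves; they are oriented or unoriented according to whether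 the circle is oriented. The shadow $F(K)$ of a virtual knot diagram $K$ is the flat diagram obtained by replacing every real crossing with a flat crossing. A real crossing $c$ of a virtual knot diagram $K$ has two resolutions (replacing a neighbourhood of the crossing by two disjoint arcs). The $0$-smoothing is the one which preserves the number of components (it is the one not compatible with an orientation of $K$). It gives an unoriented virtual knot diagram $K_c$. In (3), crossings before and after the $\Omega_3$ move correspond if they are crossings between the same two of the three strands. ''Index'' means $\widetilde{K}_c$, considered as an unoriented flat virtual knot (equivalence class). *)

(* Defs.v *)
From HB Require Import structures.
From mathcomp Require Import all_boot all_fingroup.
From mathcomp Require Import zify.
From Stdlib Require Import Relation_Operators.

Set Implicit Arguments.
Unset Strict Implicit.
Unset Printing Implicit Defensive.

(* A generic immersed circle in the plane, up to planar isotopy, is encoded by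
   its combinatorial map.  Its nodes are the double points (valency 4), together
   with finitely many marked points on the curve (valency 2); every edge is cut
   into two darts, one at each of its end nodes.  [node] turns each dart to the
   next dart at the same node, counterclockwise, and [edge] exchanges the two
   darts of an edge.  The marked points represent the crossingless circle and
   let arcs without double points be spoken of; planar isotopy may insert and
   delete them, see [flat_isotopy]. *)

Section Curves.

Variables (T : finType) (node edge : {perm T}).
Implicit Types d x y : T.

Definition valency d := #|porbit node d|.

(* The dart through which the curve leaves a node entered along [d]: the curve
   goes straight through its double points. *)
Definition across d := if valency d == 4 then node (node d) else node d.

Definition strand : rel T := [rel x y | (y == edge x) || (y == across x)].

Definition ncomponents := n_comp strand predT.

(* The orbit of [d] is the face on the left of [d], when [d] points away from
   its node. *)
Definition face : {perm T} := (edge * node^-1)%g.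

Record plane_curve : Prop := PlaneCurve {
  valencyE : forall d, (valency d == 2) || (valency d == 4);
  edgeK : involutive edge;
  edge_neq : forall d, edge d != d;
  one_component : ncomponents = 1;
  euler_formula : #|porbits node| + #|porbits face| = #|porbits edge| + 2
}.

(* If [d0, d1, d2, d3] are the darts of a crossing in counterclockwise order,
   then [smoothing d0] splits it into the nodes [(d0 d1)] and [(d2 d3)]; the
   other resolution is [smoothing d1]. *)
Definition smoothing d : {perm T} := (node * tperm d (node (node d)))%g.

End Curves.

(* The resolution preserving the number of components.  If [smoothing d] does not
   preserve it then the other resolution does ([zero_smoothing_curve]).  Each of
   the two new arcs carries a marked point. *)
Definition zero_smoothing (T : finType) (node edge : {perm T}) (d : T) :=
  if ncomponents (smoothing node d) edge == ncomponents node edge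
  then smoothing node d else smoothing node (node d).

Section SmoothingLemmas.

Variable T : finType.
Implicit Types (n e s t u : {perm T}) (d x y : T).

Lemma porbit2P s x :
  reflect (s (s x) = x /\ s x != x) (#|porbit s x| == 2).
Proof.
apply: (iffP eqP) => [c2 | [ssx sx]].
  have := iter_porbit s x; rewrite c2 /= => ssx; split=> //.
  by have := uniq_traject_porbit s x; rewrite c2 /= inE andbT eq_sym.
suff -> : porbit s x = [set x; s x] by rewrite cards2 eq_sym sx.
apply/setP=> y; rewrite !inE; apply/porbitP/orP.
  case=> i ->; rewrite permX; elim: i => [|i [/eqP IH|/eqP IH]] /=; first by left.
    by right; rewrite IH.
  by left; rewrite IH ssx.
by case=> /eqP ->; [exists 0; rewrite expg0 perm1 | exists 1; rewrite expg1].
Qed.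

Lemma porbit4 s x : #|porbit s x| = 4 ->
  [/\ s (s (s (s x))) = x, uniq [:: x; s x; s (s x); s (s (s x))]
    & porbit s x =i [:: x; s x; s (s x); s (s (s x))]].
Proof.
move=> c4; have := iter_porbit s x; have := uniq_traject_porbit s x.
by have := porbit_traject s x; rewrite c4.
Qed.

Lemma porbit_next s x : porbit s (s x) = porbit s x.
Proof. by have := porbit_perm s 1 x; rewrite expg1. Qed.

Lemma smoothing_out n d x : x \notin porbit n d ->
  porbit (smoothing n d) x = porbit n x.
Proof.
move=> xNd; suff E i : (smoothing n d ^+ i)%g x = (n ^+ i)%g x.
  by apply/setP=> y; apply/porbitP/porbitP=> -[i ->]; exists i; rewrite E.
elim: i => [|i IH]; first by rewrite !expg0.
rewrite !expgSr !permM IH tpermD //; apply: contraNneq xNd => E.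
  by rewrite porbit_sym E -permM -expgSr mem_porbit.
rewrite -(porbit_next n d) -(porbit_next n (n d)).
by rewrite porbit_sym E -permM -expgSr mem_porbit.
Qed.

Lemma smoothing_in n d x : #|porbit n d| = 4 -> x \in porbit n d ->
  #|porbit (smoothing n d) x| = 2.
Proof.
move=> c4; have [n4 U ->] := porbit4 c4; move: U; rewrite /= !inE !negb_or.
case/and4P=> /and3P[d01 d02 d03] /andP[d12 d13] d23 _.
have s0 : smoothing n d d = n d by rewrite permM tpermD // eq_sym.
have s1 : smoothing n d (n d) = d by rewrite permM tpermR.
have s2 : smoothing n d (n (n d)) = n (n (n d)) by rewrite permM tpermD.
have s3 : smoothing n d (n (n (n d))) = n (n d) by rewrite permM n4 tpermL.
by case/or4P=> /eqP ->; apply/eqP/porbit2P;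
  rewrite ?s0 ?s1 ?s2 ?s3 ?s0 ?s1 ?s2 ?s3; split; rewrite // eq_sym.
Qed.

(* The genus of a combinatorial map is nonnegative; [smoothing_curve] deduces that
   a resolution with one component is again planar. *)

Definition gen s t : rel T := [rel x y | (y == s x) || (y == t x)].

Lemma gen_l s t x : gen s t x (s x).
Proof. by rewrite /gen /= eqxx. Qed.

Lemma gen_r s t x : gen s t x (t x).
Proof. by rewrite /gen /= eqxx orbT. Qed.

Lemma connect_perm (r : rel T) s x i : (forall y, r y (s y)) ->
  connect r x ((s ^+ i)%g x).
Proof.
move=> rs; elim: i => [|i IH]; first by rewrite expg0 perm1 connect0.
by rewrite expgSr permM; apply: connect_trans IH (connect1 (rs _)).
Qed.

Lemma connect_porbit (r : rel T) s x y : (forall z, r z (s z)) ->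
  y \in porbit s x -> connect r x y.
Proof. by move=> rs /porbitP[i ->]; apply: connect_perm. Qed.

Lemma gen_sym s t : connect_sym (gen s t).
Proof.
suff H x y : connect (gen s t) x y -> connect (gen s t) y x.
  by move=> x y; apply/idP/idP; apply: H.
case/connectP=> p; elim: p x => [|z p IH] x /=; first by move=> _ ->; apply: connect0.
case/andP=> rxz /IH{}IH /IH yz; apply: connect_trans yz _.
case/orP: rxz => /eqP ->.
  apply: (@connect_porbit _ s) => [w|]; first exact: gen_l.
  by rewrite porbit_next porbit_id.
apply: (@connect_porbit _ t) => [w|]; first exact: gen_r.
by rewrite porbit_next porbit_id.
Qed.

Lemma n_compE (e : rel T) : n_comp e predT = #|roots e|.
Proof. by apply: eq_card => x; rewrite !inE andbT. Qed.

Lemma n_comp1P (e : rel T) (x0 : T) : connect_sym e ->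
  reflect (forall x y, connect e x y) (n_comp e predT == 1).
Proof.
move=> se; apply: (iffP idP) => [/eqP c1 x y | H].
  have /card1P[a Ea] : #|roots e| == 1 by rewrite -n_compE c1.
  have R z : root e z = a.
    by have := Ea (root e z); rewrite !inE (roots_root se) => /esym/eqP.
  by rewrite -root_connect // !R.
rewrite (@eq_n_comp_r _ e predT (connect e x0)) ?n_comp_connect //.
by move=> y; rewrite !inE H.
Qed.

Lemma n_comp_le1 (e1 e2 : rel T) a b : connect_sym e1 -> connect_sym e2 ->
  (forall x y, connect e2 x y -> connect e1 x y \/
     (connect e1 x a /\ connect e1 b y) \/ (connect e1 x b /\ connect e1 a y)) ->
  n_comp e1 predT <= (n_comp e2 predT).+1.
Proof.
move=> s1 s2 H.
rewrite !n_compE; set A := roots e1; set B := roots e2.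
rewrite (cardD1 (root e1 b)) -add1n leq_add ?leq_b1 //.
set A' := [predD1 A & root e1 b].
have inj : {in A' &, injective (root e2)}.
  move=> x y; rewrite !inE => /andP[xb /eqP rx] /andP[yb /eqP ry] /rootP-/(_ s2).
  case/H => [c|[[_ c]|[c _]]].
  - by rewrite -rx -ry; apply/rootP.
  - by move: yb; rewrite -ry -(rootP s1 c) eqxx.
  - by move: xb; rewrite -rx (rootP s1 c) eqxx.
rewrite -(card_in_image inj); apply/subset_leq_card/subsetP=> y.
by case/imageP=> x _ ->; rewrite !inE; apply: roots_root.
Qed.

Lemma n_comp_sub (e1 e2 : rel T) : connect_sym e1 -> connect_sym e2 ->
  (forall x y, connect e2 x y -> connect e1 x y) ->
  n_comp e1 predT <= n_comp e2 predT.
Proof.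
move=> s1 s2 H.
rewrite !n_compE; set A := roots e1; set B := roots e2.
have inj : {in A &, injective (root e2)}.
  move=> x y; rewrite !inE => /eqP rx /eqP ry /rootP-/(_ s2) /H c.
  by rewrite -rx -ry; apply/rootP.
rewrite -(card_in_image inj); apply/subset_leq_card/subsetP=> y.
by case/imageP=> x _ ->; rewrite !inE; apply: roots_root.
Qed.

Lemma porbit1 x : porbit (1%g : {perm T}) x = [set x].
Proof.
apply/setP=> y; rewrite inE; apply/porbitP/eqP=> [[i ->]|->].
  by rewrite expg1n perm1.
by exists 0; rewrite expg0 perm1.
Qed.

Lemma card_porbits1 : #|porbits (1%g : {perm T})| = #|T|.
Proof.
rewrite /porbits card_imset // => x y; rewrite !porbit1 => /setP/(_ x).
by rewrite !inE eqxx => /esym/eqP.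
Qed.

Lemma card_porbits_gen s : #|porbits s| <= n_comp (gen s 1%g) predT.
Proof.
rewrite n_compE; set A := roots (gen s 1%g).
rewrite /porbits; apply: leq_trans (leq_imset_card (porbit s) A).
apply/subset_leq_card/subsetP=> _ /imsetP[x _ ->].
have S := @gen_sym s 1%g.
apply/imsetP; exists (root (gen s 1%g) x); first by rewrite !inE; apply: roots_root.
apply/eqP; rewrite eq_porbit_mem porbit_sym.
move: (connect_root (gen s 1%g) x); move: (root _ x) => r /connectP[p].
elim: p x => [|z p IH] x /=; first by move=> _ ->; apply: porbit_id.
case/andP=> + /IH{}IH {}/IH.
by case/orP=> /eqP ->; rewrite ?porbit_next ?perm1.
Qed.

Lemma genus_ge0 s t :
  #|porbits s| + #|porbits t| + #|porbits (t * s)| <= #|T| + (n_comp (gen s t) predT).*2.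
Proof.
have [k] := ubnP (#|T| - #|porbits t|); elim: k t => // k IH t ltk.
have le_t (u : {perm T}) : #|porbits u| <= #|T|.
  by apply: leq_trans (leq_imset_card _ _) _.
have [[x tx]|t1] : (exists x, t x != x) \/ t = 1%g.
- case: (boolP [exists x, t x != x]) => [/existsP|]; first by left.
  rewrite negb_exists => /forallP H; right; apply/permP=> x.
  by rewrite perm1; apply/eqP; move: (H x); rewrite negbK.
- pose u := (tperm x (t x) * t)%g.
  have cu : #|porbits u| = #|porbits t|.+1.
    have := porbits_mul_tperm t x (t x).
    by rewrite porbit_next porbit_id /= addn0 eq_sym tx addn1.
  have tE : t = (tperm x (t x) * u)%g by rewrite /u mulgA tperm2 mul1g.
  have {}IH : #|porbits s| + #|porbits u| + #|porbits (u * s)| <=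
              #|T| + (n_comp (gen s u) predT).*2.
    by apply: IH; have := le_t u; lia.
  have ct : #|porbits (t * s)| + (x \notin porbit (u * s) (t x)).*2
            = #|porbits (u * s)|.+1.
    by rewrite {1}tE -mulgA porbits_mul_tperm eq_sym tx addn1.
  have tz z : t z = u z \/ (connect (gen s u) z x /\ connect (gen s u) (t x) (t z)
                         \/ connect (gen s u) z (t x) /\ connect (gen s u) x (t z)).
    have ruz w : connect (gen s u) w (u w) by apply: connect1; apply: gen_r.
    have [->|zx] := eqVneq z x; first by right; left; split; apply: connect0.
    have [->|ztx] := eqVneq z (t x).
      right; right; split; first exact: connect0.
      by have := ruz x; rewrite [u x]permM tpermL.
    by left; rewrite [u z]permM tpermD // eq_sym.
  case: (boolP (connect (gen s u) x (t x))) => cx.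
    have : n_comp (gen s u) predT <= n_comp (gen s t) predT.
      apply: n_comp_sub; [exact: gen_sym| exact: gen_sym|].
      apply: connect_sub => y z /= /orP[]/eqP ->.
        by apply: connect1; apply: gen_l.
      case: (tz y) => [->|[[c1 c2]|[c1 c2]]].
      + by apply: connect1; apply: gen_r.
      + exact: connect_trans (connect_trans c1 cx) c2.
      + apply: connect_trans (connect_trans c1 _) c2.
        by rewrite gen_sym.
    by lia.
  have : n_comp (gen s u) predT <= (n_comp (gen s t) predT).+1.
    apply: (@n_comp_le1 _ _ x (t x)); [exact: gen_sym| exact: gen_sym|].
    move=> y z /connectP[p]; elim: p y => [|w p IHp] y /=.
      by move=> _ ->; left; apply: connect0.
    case/andP=> yw /IHp{}IHp /IHp{}IHp.
    have {yw} [yw|[[yw1 yw2]|[yw1 yw2]]] : connect (gen s u) y w \/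
        (connect (gen s u) y x /\ connect (gen s u) (t x) w) \/
        (connect (gen s u) y (t x) /\ connect (gen s u) x w).
    + case/orP: yw => /eqP ->; first by left; apply: connect1; apply: gen_l.
      case: (tz y) => [->|]; last by right.
      by left; apply: connect1; apply: gen_r.
    + case: IHp => [c|[[c1 c2]|[c1 c2]]].
      * by left; apply: connect_trans c.
      * by right; left; split=> //; apply: connect_trans c1.
      * by right; right; split=> //; apply: connect_trans c1.
    + case: IHp => [c|[[c1 c2]|[c1 c2]]].
      * by right; left; split=> //; apply: connect_trans c.
      * by right; left.
      * by left; apply: connect_trans c2.
    + case: IHp => [c|[[c1 c2]|[c1 c2]]].
      * by right; right; split=> //; apply: connect_trans c.
      * by left; apply: connect_trans c2.
      * by right; right.
  have xu : x \notin porbit (u * s) (t x); last by move: ct; rewrite xu; lia.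
  apply: contraNN cx; rewrite porbit_sym => /porbitP[i ->].
  elim: i => [|i IHi]; first by rewrite expg0 perm1 connect0.
  rewrite expgSr permM permM; apply: connect_trans IHi _.
  apply: (@connect_trans _ _ (u (((u * s) ^+ i)%g x))); apply: connect1.
    exact: gen_r.
  exact: gen_l.
rewrite t1 mul1g card_porbits1.
have := card_porbits_gen s; rewrite -addnn; lia.
Qed.

End SmoothingLemmas.

Section SmoothingCurve.

Variables (T : finType) (e : {perm T}).
Implicit Types (n : {perm T}) (d x y : T).
Hypothesis eK : involutive e.
Hypothesis e_neq : forall x, e x != x.

Definition valencies n := forall x, (valency n x == 2) || (valency n x == 4).

Lemma acrossP n : valencies n ->
  involutive (across n) /\ forall x, across n x != x.
Proof.
move=> V; suff H x : across n (across n x) = x /\ across n x != x.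
  by split=> x; case: (H x).
case/orP: (V x) => [v2|/eqP v4].
  have [nn nx] := porbit2P _ _ v2; rewrite /across.
  have -> : valency n x == 4 = false by rewrite (eqP v2).
  have -> : valency n (n x) == 4 = false by rewrite /valency porbit_next [#|_|](eqP v2).
  by rewrite nn.
have [n4 U _] := porbit4 v4; rewrite /across v4 eqxx.
have -> : valency n (n (n x)) == 4 by rewrite /valency !porbit_next [#|_|]v4.
rewrite n4; split=> //; move: U; rewrite /= !inE !negb_or.
by case/andP=> /and3P[_ ? _] _; rewrite eq_sym.
Qed.

Lemma strand_sym n : valencies n -> connect_sym (strand n e).
Proof.
move=> V; apply: sym_connect_sym => x y; rewrite /strand /=.
have [oK _] := acrossP V.
by rewrite ![y == _]eq_sym (can2_eq oK oK) (can2_eq eK eK).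
Qed.

Lemma smoothing_valencies n d : valencies n -> valency n d = 4 ->
  valencies (smoothing n d).
Proof.
move=> V v4 x; case: (boolP (x \in porbit n d)) => xd.
  by rewrite /valency smoothing_in.
by rewrite /valency smoothing_out //; apply: V.
Qed.

Lemma smoothing_next n d x : x \notin porbit n d -> smoothing n d x = n x.
Proof.
move=> xd; rewrite permM tpermD //; apply: contraNneq xd => E.
  by rewrite E porbit_next porbit_id.
by rewrite -(porbit_next n d) -(porbit_next n (n d)) E porbit_next porbit_id.
Qed.

Lemma smoothing_across_out n d x : x \notin porbit n d ->
  across (smoothing n d) x = across n x.
Proof.
move=> xd; have nxd : n x \notin porbit n d by rewrite porbit_sym porbit_next porbit_sym.
by rewrite /across /valency smoothing_out // !smoothing_next.
Qed.

Lemma smoothing_across_in n d x : valency n d = 4 -> x \in porbit n d ->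
  across (smoothing n d) x = smoothing n d x.
Proof. by move=> v4 xd; rewrite /across /valency smoothing_in. Qed.

Lemma one_componentP n (x0 : T) : valencies n ->
  reflect (forall x y, connect (strand n e) x y) (ncomponents n e == 1).
Proof. by move=> V; apply: n_comp1P x0 (strand_sym V). Qed.

Lemma palindrome n j x : valencies n -> e (iter j (across n \o e) x) != x.
Proof.
move=> V; have [oK o_neq] := acrossP V.
have [k] := ubnP j; elim: k j x => // k IH [|[|j]] x ltk; first exact: e_neq.
  by rewrite /= (can2_eq eK eK).
rewrite iterS iterSr /= (can2_eq eK eK) (can2_eq oK oK).
by apply: (IH j (across n (e x))); apply: ltnW.
Qed.

Lemma smoothing_connected n d : valencies n -> valency n d = 4 ->
  (forall x y, connect (strand n e) x y) ->
  (forall x y, connect (strand (smoothing n d) e) x y) \/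
  (forall x y, connect (strand (smoothing n (n d)) e) x y).
Proof.
move=> V v4 con; have [oK o_neq] := acrossP V.
have v4' : valency n (n d) = 4 by rewrite /valency porbit_next.
set C := porbit n d.
have C' : porbit n (n d) = C by rewrite porbit_next.
pose r0 : rel T := [rel x y | (y == e x) || (x \notin C) && (y == across n x)].
have r0P d' : porbit n d' = C -> subrel (connect r0) (connect (strand (smoothing n d') e)).
  move=> E; apply: connect_sub => x y /= xy; apply: connect1; rewrite /strand /=.
  case/orP: xy => [->//|/andP[xC /eqP ->]].
  by rewrite smoothing_across_out ?E // eqxx orbT.
have toC x : exists2 c, c \in C & connect r0 x c.
  case/connectP: (con x d) => p; elim: p x => [|z p IH] x /=.
    by move=> _ <-; exists d; rewrite ?porbit_id ?connect0.
  case/andP=> xz pz dz; have [xC|xC] := boolP (x \in C).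
    by exists x; rewrite ?connect0.
  have [c cC zc] := IH z pz dz; exists c => //; apply: connect_trans zc.
  by apply: connect1; rewrite /r0 /= xC.
have [c [cC cd dc]] : exists c, [/\ c \in C, c != d & connect r0 d c].
  pose f := across n \o e.
  have injf : injective f by apply: inj_comp (inv_inj oK) (inv_inj eK).
  have ex : exists j, e (iter j f d) \in C.
    exists (fingraph.order f d).-1; have := iter_order injf d.
    have := fingraph.order_gt0 f d; case: (fingraph.order f d) => // m _ /=.
    move/(canRL oK) => ->; rewrite /across v4 eqxx.
    by rewrite /C porbit_sym !porbit_next porbit_id.
  case: (ex_minnP ex) => j jC minj; exists (e (iter j f d)); split=> //.
    exact: palindrome.
  have H i : i <= j -> connect r0 d (iter i f d).
    elim: i => [|i IH] ij; first exact: connect0.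
    apply: connect_trans (IH (ltnW ij)) _.
    apply: (@connect_trans _ _ (e (iter i f d))); apply: connect1; rewrite /r0 /= ?eqxx //.
    have -> : e (iter i f d) \notin C by apply: contraL ij => /minj; rewrite -leqNgt.
    by rewrite orbT.
  by apply: connect_trans (H j (leqnn j)) (connect1 _); rewrite /r0 /= eqxx.
have finish d' : porbit n d' = C ->
    (forall x, x \in C -> connect (strand (smoothing n d') e) x d) ->
    forall x y, connect (strand (smoothing n d') e) x y.
  move=> E H.
  have S := strand_sym (smoothing_valencies V (_ : valency n d' = 4)).
  have {}S : connect_sym (strand (smoothing n d') e) by apply: S; rewrite /valency E.
  have toD x : connect (strand (smoothing n d') e) x d.
    by have [z zC xz] := toC x; apply: connect_trans (r0P _ E _ _ xz) (H z zC).
  by move=> x y; apply: connect_trans (toD x) _; rewrite S.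
have [n4 U CE] := porbit4 v4.
have sm d' x : porbit n d' = C -> x \in C ->
    connect (strand (smoothing n d') e) x (smoothing n d' x).
  move=> E xC; apply: connect1; rewrite /strand /= smoothing_across_in ?eqxx ?orbT ?E //.
  by rewrite /valency E.
have in0 : d \in C by rewrite CE !inE eqxx.
have in1 : n d \in C by rewrite CE !inE eqxx !orbT.
have in2 : n (n d) \in C by rewrite CE !inE eqxx !orbT.
have in3 : n (n (n d)) \in C by rewrite CE !inE eqxx !orbT.
move: U; rewrite /= !inE !negb_or.
case/and4P=> /and3P[d01 d02 d03] /andP[d12 d13] d23 _.
have a1 : smoothing n d (n d) = d by rewrite permM tpermR.
have a2 : smoothing n d (n (n d)) = n (n (n d)) by rewrite permM tpermD.
have a3 : smoothing n d (n (n (n d))) = n (n d) by rewrite permM n4 tpermL.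
have b0 : smoothing n (n d) d = n (n (n d)) by rewrite permM tpermL.
have b1 : smoothing n (n d) (n d) = n (n d) by rewrite permM tpermD // eq_sym.
have b2 : smoothing n (n d) (n (n d)) = n d by rewrite permM tpermR.
have b3 : smoothing n (n d) (n (n (n d))) = d by rewrite permM n4 tpermD // eq_sym.
have SA := strand_sym (smoothing_valencies V v4).
have SB := strand_sym (smoothing_valencies V v4').
have A1 := sm d _ erefl in1; have A2 := sm d _ erefl in2; have A3 := sm d _ erefl in3.
have B1 := sm (n d) _ C' in1; have B2 := sm (n d) _ C' in2; have B3 := sm (n d) _ C' in3.
rewrite a1 in A1; rewrite a2 in A2; rewrite a3 in A3.
rewrite b1 in B1; rewrite b2 in B2; rewrite b3 in B3.
have CA := r0P d erefl _ _ dc; have CB := r0P (n d) C' _ _ dc; rewrite SA in CA; rewrite SB in CB.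
move: cC; rewrite CE !inE (negPf cd) /=; case/or3P=> /eqP cE; rewrite cE in CA CB.
- right; apply: (finish _ C') => x; rewrite CE !inE => /or4P[]/eqP -> //.
  exact: connect_trans B2 CB.
- left; apply: finish => // x; rewrite CE !inE => /or4P[]/eqP -> //.
  exact: connect_trans A3 CA.
- left; apply: finish => // x; rewrite CE !inE => /or4P[]/eqP -> //.
  exact: connect_trans A2 CA.
Qed.

Lemma card_edges : #|T| = #|porbits e|.*2.
Proof.
have -> : #|T| = \sum_(x : T) 1 by rewrite sum1_card.
rewrite (partition_big (porbit e) (fun A => A \in porbits e)) /=; last first.
  by move=> x _; apply: imset_f.
rewrite -muln2 -sum_nat_const; apply: eq_bigr => _ /imsetP[x _ ->].
have /eqP <- : #|porbit e x| == 2 by apply/porbit2P.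
by rewrite -sum1_card; apply: eq_bigl => y; rewrite eq_porbit_mem.
Qed.

Lemma smoothing_curve n d : plane_curve n e -> valency n d = 4 ->
  ncomponents (smoothing n d) e = 1 -> plane_curve (smoothing n d) e.
Proof.
case=> V _ _ _ euler v4 c1.
have V' := smoothing_valencies V v4.
split=> //.
have [n4 U _] := porbit4 v4; move: U; rewrite /= !inE !negb_or.
case/and4P=> /and3P[d01 d02 d03] _ _ _.
set n' := smoothing n d in c1 V' *.
have N' : #|porbits n'| = #|porbits n|.+1.
  have -> : n' = (tperm (n^-1 d) (n^-1 (n (n d))) * n)%g.
    by rewrite -tpermJ conjgE invgK -!mulgA mulVg mulg1.
  have := porbits_mul_tperm n ((n^-1)%g d) ((n^-1)%g (n (n d))).
  rewrite (inj_eq perm_inj) d02 permK addn1.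
  rewrite porbit_next porbit_sym -[porbit n _]porbit_next permKV porbit_id /= addn0 //.
have F' : #|porbits (face n' e)| = #|porbits (face n e)|.+1 \/
          (#|porbits (face n' e)|).+1 = #|porbits (face n e)|.
  have -> : face n' e = (tperm (e^-1 d) (e^-1 (n (n d))) * face n e)%g.
    by rewrite -tpermJ /face /n' /smoothing invMg tpermV conjgE invgK -!mulgA mulKg.
  have := porbits_mul_tperm (face n e) ((e^-1)%g d) ((e^-1)%g (n (n d))).
  rewrite (inj_eq perm_inj) d02 /=; case: (_ \notin _) => /=; lia.
have := genus_ge0 n'^-1 e; rewrite porbitsV card_edges.
rewrite -/(face n' e).
have -> : n_comp (gen n'^-1%g e) predT = 1; last first.
  move: N' F' euler; move: #|porbits n'| #|porbits (face n' e)| #|porbits n|.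
  by move: #|porbits (face n e)| #|porbits e| => *; lia.
apply/eqP/(n_comp1P d (@gen_sym _ _ _)) => x y.
have /(one_componentP d V')/(_ x y) : ncomponents n' e == 1 by rewrite c1.
apply: connect_sub => z w /=; rewrite /strand /= => /orP[]/eqP ->.
  by apply: connect1; apply: gen_r.
apply: (@connect_porbit _ _ n'^-1%g); first by move=> ?; apply: gen_l.
rewrite porbitV /across; case: ifP => _; rewrite porbit_sym ?porbit_next porbit_id //.
Qed.

Lemma zero_smoothing_curve n d : plane_curve n e -> valency n d = 4 ->
  plane_curve (zero_smoothing n e d) e.
Proof.
move=> P v4; have [V _ _ c1 _] := P; rewrite /zero_smoothing c1.
have v4' : valency n (n d) = 4 by rewrite /valency porbit_next.
case: ifP => [/eqP|] cA; first exact: smoothing_curve.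
apply: smoothing_curve => //; apply/eqP.
have [] := smoothing_connected V v4 (one_componentP d V (introT eqP c1)).
  by move/(one_componentP d (smoothing_valencies V v4)); rewrite cA.
by move/(one_componentP d (smoothing_valencies V v4')).
Qed.

Lemma zero_smoothing_in n d x : valency n d = 4 -> x \in porbit n d ->
  valency (zero_smoothing n e d) x = 2.
Proof.
move=> v4 xd; rewrite /zero_smoothing; case: ifP => _; apply: smoothing_in => //.
  by rewrite porbit_next.
by rewrite porbit_next.
Qed.

Lemma zero_smoothing_out n d x : x \notin porbit n d ->
  porbit (zero_smoothing n e d) x = porbit n x /\ zero_smoothing n e d x = n x.
Proof.
move=> xd; rewrite /zero_smoothing; case: ifP => _.
  by rewrite smoothing_out ?smoothing_next.
by rewrite smoothing_out ?smoothing_next // porbit_next.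
Qed.

End SmoothingCurve.

(* [virt] tells virtual crossings from flat (or real) ones, at double points
   only.  [outer] lies on the unbounded face. *)
Record flat_diagram := FlatDiagram {
  dart : finType;
  node : {perm dart};
  edge : {perm dart};
  virt : pred dart;
  outer : dart;
  curveP : plane_curve node edge;
  virt_node : forall d, valency node d = 4 -> virt (node d) = virt d
}.

Definition double_point (D : flat_diagram) (d : dart D) :=
  valency (node D) d == 4.

Definition marked_point (D : flat_diagram) (d : dart D) :=
  valency (node D) d == 2.

Definition real (D : flat_diagram) (d : dart D) := double_point d && ~~ virt d.

(* At a real crossing, [over d] says that [d] belongs to the overpass. *)
Record virtual_diagram := VirtualDiagram {
  shadow :> flat_diagram;
  over : pred (dart shadow);
  over_node : forall d, real d -> over (node shadow d) = ~~ over d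
}.

(* A real crossing, named by any one of its four darts. *)
Definition real_crossing (K : virtual_diagram) := {d : dart K | real d}.

Definition at_node (D : flat_diagram) (a d : dart D) := d \in porbit (node D) a.

Section ZeroSmoothing.

Variables (K : virtual_diagram) (c : real_crossing K).
Let d := val c.

Fact crossing_valency : valency (node K) d = 4.
Proof. by case/andP: (valP c) => /eqP. Qed.

Let n' := zero_smoothing (node K) (edge K) d.

Fact zero_smoothing_plane : plane_curve n' (edge K).
Proof.
have P := curveP K.
by have := zero_smoothing_curve (edgeK P) (edge_neq P) P crossing_valency.
Qed.

Fact zero_smoothing4 x : valency n' x = 4 ->
  valency (node K) x = 4 /\ n' x = node K x.
Proof.
have [xd|xd] := boolP (x \in porbit (node K) d).
  by rewrite (zero_smoothing_in _ crossing_valency xd).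
by have [E ->] := zero_smoothing_out (edge K) xd; rewrite /valency E.
Qed.

Fact zero_smoothing_virt x : valency n' x = 4 -> virt (n' x) = virt x.
Proof. by case/zero_smoothing4 => v4 ->; apply: virt_node. Qed.

Definition smooth_shadow : flat_diagram :=
  FlatDiagram (outer K) zero_smoothing_plane zero_smoothing_virt.

Fact zero_smoothing_over (x : dart smooth_shadow) : real x ->
  @over K (node smooth_shadow x) = ~~ @over K x.
Proof.
case/andP=> /eqP /zero_smoothing4 [v4 ->] rx; apply: over_node.
by rewrite /real /double_point v4 eqxx.
Qed.

Definition smooth : virtual_diagram := VirtualDiagram zero_smoothing_over.

End ZeroSmoothing.

(* Planar isotopy: isomorphism of plane combinatorial maps, and insertion of a
   marked point, with darts [b] and [node b], on the edge of a dart [a]. *)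

Record flat_iso (D D' : flat_diagram) (h : dart D -> dart D') : Prop := FlatIso {
  iso_bij : bijective h;
  iso_node : forall d, h (node D d) = node D' (h d);
  iso_edge : forall d, h (edge D d) = edge D' (h d);
  iso_virt : forall d, double_point d -> virt (h d) = virt d;
  iso_outer : h (outer D) \in porbit (face (node D') (edge D')) (outer D')
}.

Record flat_subdivision (D D' : flat_diagram) (h : dart D -> dart D')
    (a : dart D) (b : dart D') : Prop := FlatSubdivision {
  sub_inj : injective h;
  sub_point : marked_point b;
  sub_codom : forall x, (x \in codom h) = ~~ at_node b x;
  sub_node : forall d, h (node D d) = node D' (h d);
  sub_edge : forall d, d \notin [:: a; edge D a] -> h (edge D d) = edge D' (h d);
  sub_edge1 : edge D' (h a) = b;
  sub_edge2 : edge D' (h (edge D a)) = node D' b;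
  sub_virt : forall d, double_point d -> virt (h d) = virt d;
  sub_outer : h (outer D) \in porbit (face (node D') (edge D')) (outer D')
}.

Definition flat_isotopy (D D' : flat_diagram) (h : dart D -> dart D') : Prop :=
  flat_iso h \/ exists a b, flat_subdivision h a b.

(* Local moves.  A move replaces the part of [D] inside a disc by another one.
   The inside is the list [ns] of its nodes, each given by one dart, and the
   list [es] of the darts whose edges cross the boundary of the disc, in cyclic
   order.  [h] identifies the outsides; its values inside are irrelevant. *)

Definition inside (D : flat_diagram) (ns : seq (dart D)) (d : dart D) :=
  has (fun a => at_node a d) ns.

Record replaced (D D' : flat_diagram) (h : dart D -> dart D')
    (ns es : seq (dart D)) (ns' es' : seq (dart D')) : Prop := Replaced {
  rep_inj : {in [predC inside ns] &, injective h};
  rep_onto : forall y, ~~ inside ns' y <-> exists2 x, ~~ inside ns x & h x = y;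
  rep_node : forall d, ~~ inside ns d -> h (node D d) = node D' (h d);
  rep_edge : forall d, ~~ inside ns d -> ~~ inside ns (edge D d) ->
    h (edge D d) = edge D' (h d);
  rep_boundary : forall e, e \in es -> ~~ inside ns (edge D e);
  rep_size : size es = size es';
  rep_ends : forall d i, ~~ inside ns d -> i < size es ->
    edge D d = nth d es i -> edge D' (h d) = nth (h d) es' i;
  rep_virt : forall d, ~~ inside ns d -> double_point d -> virt (h d) = virt d;
  (* the point at infinity is outside the disc *)
  rep_outer : exists d, [/\ ~~ inside ns d,
    d \in porbit (face (node D) (edge D)) (outer D) &
    h d \in porbit (face (node D') (edge D')) (outer D')]
}.

(* The crossing [a] is virtual or not according to [v]; its darts [node a] and
   [node (node a)] bound a monogon, which is removed. *)
Record kink_removal (v : bool) (D D' : flat_diagram) (h : dart D -> dart D')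
    (a : dart D) (b : dart D') : Prop := KinkRemoval {
  kink_crossing : double_point a;
  kink_virt : virt a = v;
  kink_loop : edge D (node D a) = node D (node D a);
  kink_arc : marked_point b;
  kink_replaced : let n := node D in let n' := node D' in
    replaced h [:: a] [:: a; n (n (n a))] [:: b] [:: b; n' b]
}.

(* With [a] on the left and [b] on the right of a bigon, the upper side of the
   bigon joins the dart [a] to the dart [b], and the ends of the picture are NW,
   SW, SE, NE.  After the move [p] is on the arc from SW to SE, [q] on the arc
   from NW to NE. *)
Record bigon_removal (v : bool) (D D' : flat_diagram) (h : dart D -> dart D')
    (a b : dart D) (p q : dart D') : Prop := BigonRemoval {
  bigon_crossing1 : double_point a;
  bigon_crossing2 : double_point b;
  bigon_neq : ~~ at_node a b;
  bigon_virt1 : virt a = v;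
  bigon_virt2 : virt b = v;
  bigon_upper : edge D a = b;
  bigon_lower : let n := node D in edge D (n (n (n a))) = n b;
  bigon_arc1 : marked_point p;
  bigon_arc2 : marked_point q;
  bigon_arc_neq : ~~ at_node p q;
  bigon_replaced : let n := node D in let n' := node D' in
    replaced h [:: a; b] [:: n a; n (n a); n (n b); n (n (n b))]
               [:: p; q] [:: q; p; n' p; n' q]
}.

(* Three strands l0, l1, l2, where l_i runs from the end E_i to the end E_(i+3),
   the ends E_0, ..., E_5 being in counterclockwise order on the disc.  The darts
   at the crossing [x] of l0 and l1 point, counterclockwise from [x], towards
   E0, E1, E3, E4; those at the crossing [y] of l1 and l2 towards E1, E2, E4, E5;
   those at the crossing [z] of l2 and l0 towards E2, E3, E5, E0.  Before the
   move l0 passes [z, x], l1 passes [y, x] and l2 passes [y, z], in this order;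
   after the move these orders are reversed. *)
Record triangle_move (vx vy vz : bool) (D D' : flat_diagram)
    (h : dart D -> dart D') (x y z : dart D) (x' y' z' : dart D') : Prop :=
  TriangleMove {
  tri_crossings : [/\ double_point x, double_point y & double_point z];
  tri_neq : [/\ ~~ at_node x y, ~~ at_node y z & ~~ at_node z x];
  tri_virt : [/\ virt x = vx, virt y = vy & virt z = vz];
  tri_sides : let n := node D in
    [/\ edge D (n z) = x, edge D (n (n y)) = n x & edge D (n (n (n y))) = z];
  tri_crossings' : [/\ double_point x', double_point y' & double_point z'];
  tri_neq' : [/\ ~~ at_node x' y', ~~ at_node y' z' & ~~ at_node z' x'];
  tri_virt' : [/\ virt x' = vx, virt y' = vy & virt z' = vz];
  tri_sides' : let n := node D' in
    [/\ edge D' (n (n x')) = n (n (n z')), edge D' (n (n (n x'))) = y'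
      & edge D' (n (n z')) = n y'];
  tri_replaced : let n := node D in let n' := node D' in
    replaced h [:: x; y; z]
               [:: n (n (n z)); y; n y; n (n x); n (n (n x)); n (n z)]
               [:: x'; y'; z']
               [:: x'; n' x'; z'; n' z'; n' (n' y'); n' (n' (n' y'))]
}.

(* The flat generalized Reidemeister moves; the list gives the crossings of [D]
   involved in the move. *)
Inductive flat_move (D D' : flat_diagram) (h : dart D -> dart D') :
    seq (dart D) -> Prop :=
| FlatOmega1 a b of kink_removal false h a b : flat_move h [:: a]
| FlatOmega1' a b of kink_removal true h a b : flat_move h [:: a]
| FlatOmega2 a b p q of bigon_removal false h a b p q : flat_move h [:: a; b]
| FlatOmega2' a b p q of bigon_removal true h a b p q : flat_move h [:: a; b]
| FlatOmega3 x y z x' y' z' of triangle_move false false false h x y z x' y' z' :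
    flat_move h [:: x; y; z]
| FlatOmega3' x y z x' y' z' of triangle_move true true true h x y z x' y' z' :
    flat_move h [:: x; y; z]
| FlatOmega3v x y z x' y' z' of triangle_move false true true h x y z x' y' z' :
    flat_move h [:: x; y; z].

Definition flat_step (D D' : flat_diagram) : Prop :=
  exists h : dart D -> dart D', flat_isotopy h \/ exists ns, flat_move h ns.

(* Equality of the unoriented flat virtual knots represented by two diagrams. *)
Definition flat_equiv : flat_diagram -> flat_diagram -> Prop :=
  clos_refl_sym_trans flat_diagram flat_step.

Section VirtualMoves.

Variables (K K' : virtual_diagram) (h : dart K -> dart K').

Definition over_kept (ns : seq (dart K)) : Prop :=
  forall d, ~~ inside ns d -> real d -> over (h d) = over d.

Definition isotopy : Prop := flat_isotopy h /\ over_kept [::].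

Definition Omega1 (a : dart K) : Prop :=
  (exists b, kink_removal false h a b) /\ over_kept [:: a].

Definition Omega1' (a : dart K) : Prop :=
  (exists b, kink_removal true h a b) /\ over_kept [:: a].

(* The darts [a] and [b] are on the same strand. *)
Definition Omega2 (a b : dart K) : Prop :=
  [/\ exists p q, bigon_removal false h a b p q, over a = over b
    & over_kept [:: a; b]].

Definition Omega2' (a b : dart K) : Prop :=
  (exists p q, bigon_removal true h a b p q) /\ over_kept [:: a; b].

(* [x] is on l0, [y] on l1, [z] on l2, so that [over x], [over y] and [over z]
   say that l0 is over l1, l1 over l2, l2 over l0: they are not all equal, one
   strand being over the other two and one under them. *)
Definition Omega3 (x y z : dart K) (x' y' z' : dart K') : Prop :=
  [/\ triangle_move false false false h x y z x' y' z',
      ~~ ((over x == over y) && (over y == over z)),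
      [/\ over x' = over x, over y' = over y & over z' = over z]
    & over_kept [:: x; y; z]].

Definition Omega3' (x y z : dart K) : Prop :=
  (exists x' y' z', triangle_move true true true h x y z x' y' z')
  /\ over_kept [:: x; y; z].

(* The strand l2 has virtual crossings only. *)
Definition Omega3v (x y z : dart K) (x' : dart K') : Prop :=
  [/\ exists y' z', triangle_move false true true h x y z x' y' z',
      over x' = over x & over_kept [:: x; y; z]].

Inductive generalized_move : seq (dart K) -> Prop :=
| Move1 a of Omega1 a : generalized_move [:: a]
| Move1' a of Omega1' a : generalized_move [:: a]
| Move2 a b of Omega2 a b : generalized_move [:: a; b]
| Move2' a b of Omega2' a b : generalized_move [:: a; b]
| Move3 x y z x' y' z' of Omega3 x y z x' y' z' : generalized_move [:: x; y; z]
| Move3' x y z of Omega3' x y z : generalized_move [:: x; y; z]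
| Move3v x y z x' of Omega3v x y z x' : generalized_move [:: x; y; z].

End VirtualMoves.

Definition virtual_step (K K' : virtual_diagram) : Prop :=
  exists h : dart K -> dart K', isotopy h \/ exists ns, generalized_move h ns.

(* Equality of the virtual knots represented by two diagrams. *)
Definition virtual_equiv : virtual_diagram -> virtual_diagram -> Prop :=
  clos_refl_sym_trans virtual_diagram virtual_step.

(* The chord index axioms for an assignment [ind] with values in [X] up to the
   equivalence [eqX].  [index_isotopy] says that the index does not depend on
   the combinatorial map chosen for a diagram. *)
Record chord_index (X : Type) (eqX : X -> X -> Prop)
    (ind : forall K : virtual_diagram, real_crossing K -> X) : Prop := ChordIndex {
  index_isotopy : forall (K K' : virtual_diagram) (h : dart K -> dart K'),
    isotopy h ->
    forall (c : real_crossing K) (c' : real_crossing K'),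
      at_node (h (val c)) (val c') -> eqX (ind K c) (ind K' c');
  index_Omega1 : exists fixed : virtual_diagram -> X,
    (forall K K', virtual_equiv K K' -> eqX (fixed K) (fixed K')) /\
    forall (K K' : virtual_diagram) (h : dart K -> dart K') (a : dart K),
      Omega1 h a ->
      forall c : real_crossing K, at_node a (val c) -> eqX (ind K c) (fixed K);
  index_Omega2 : forall (K K' : virtual_diagram) (h : dart K -> dart K')
      (a b : dart K), Omega2 h a b ->
    forall c1 c2 : real_crossing K, at_node a (val c1) -> at_node b (val c2) ->
      eqX (ind K c1) (ind K c2);
  index_Omega3 : forall (K K' : virtual_diagram) (h : dart K -> dart K')
      (x y z : dart K) (x' y' z' : dart K'), Omega3 h x y z x' y' z' ->
    forall (c : real_crossing K) (c' : real_crossing K'),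
      [\/ at_node x (val c) /\ at_node x' (val c'),
          at_node y (val c) /\ at_node y' (val c')
        | at_node z (val c) /\ at_node z' (val c')] ->
      eqX (ind K c) (ind K' c');
  index_Omega3v : forall (K K' : virtual_diagram) (h : dart K -> dart K')
      (x y z : dart K) (x' : dart K'), Omega3v h x y z x' ->
    forall (c : real_crossing K) (c' : real_crossing K'),
      at_node x (val c) -> at_node x' (val c') -> eqX (ind K c) (ind K' c');
  index_other : forall (K K' : virtual_diagram) (h : dart K -> dart K')
      (ns : seq (dart K)), generalized_move h ns ->
    forall (c : real_crossing K) (c' : real_crossing K'),
      ~~ inside ns (val c) -> at_node (h (val c)) (val c') ->
      eqX (ind K c) (ind K' c')
}.

Definition flat_index (K : virtual_diagram) (c : real_crossing K) : flat_diagram :=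
  shadow (smooth c).

(* Main.v *)
(* An orientation of the curve is a two-colouring of the darts changing along
   every edge and through every node.  At a crossing it tells the 0-smoothing from
   the other one, and two diagrams related by a move, which pair the ends of the
   disc in the same way, have orientations that agree outside the disc; hence the
   0-smoothings of a crossing outside the disc are again related by the same
   move (5).  By Euler's formula a 0-smoothing merges two faces, so the point at
   infinity stays outside the disc.

   The other axioms are about the curve left inside the disc by the 0-smoothing of
   one of the crossings involved.  A kink disappears (1).  For a bigon, both
   resulting pictures are a single crossing in the same place, or both have one
   kink, removed by Omega_1 (2).  For the triangle, the third strand l either
   crosses two arcs, which the 0-smoothing made disjoint, in the same order before
   and after the move, or forms a bigon with one arc; removing it on both sides by
   Omega_2 gives the same picture (3), (4).

   Pictures are compared up to marked points: a diagram is equivalent to its core,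
   where marked points have been deleted.  The pictures inside the disc are finite
   tables, on which the comparisons are done by computation. *)

Require Import Defs.
From mathcomp Require Import all_boot all_fingroup.
From mathcomp Require Import zify.
From Stdlib Require Import Relation_Operators.

Set Implicit Arguments.
Unset Strict Implicit.
Unset Printing Implicit Defensive.

(** * Orientations, 0-smoothings and faces *)

(** Going along an edge and straight through the next node is a permutation of the darts, with two
    orbits on a curve with one component, one for each direction. A transposition changes the number
    of orbits of a permutation by one, and this count decides which resolution disconnects the
    curve. The main obstacle is that a 0-smoothing leaves marked points on the sides of the monogon
    or bigon to be removed, so that the diagram does not literally match the pattern of a move. The
    moves are therefore applied between cores. A core keeps every dart outside the disc; one of
    these is on the unbounded face, so the curve is never deleted altogether and the point at
    infinity is carried along. The target of such an Omega_1 or Omega_2 must also be exhibited as a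
    plane diagram. It is built on the same darts, by smoothing the crossings of the kink or bigon so
    that the ends of the disc stay paired as before. One component then remains, and planarity
    follows from the nonnegativity of the genus. *)

Section Orientation.

Variables (T : finType) (e : {perm T}).
Implicit Types (n s t : {perm T}) (d x y z : T) (O : pred T).

Definition orientation n O :=
  (forall x, O (e x) = ~~ O x) /\ (forall x, O (across n x) = ~~ O x).

Hypothesis eK : involutive e.
Hypothesis e_neq : forall x, e x != x.

Lemma travel_inj n : valencies n -> injective (across n \o e).
Proof. by case/acrossP=> oK _; apply: inj_comp (inv_inj oK) (inv_inj eK). Qed.

(** An orbit is a tour of a component in one of its two directions. *)
Definition travel n (V : valencies n) : {perm T} := perm (travel_inj V).

Lemma travelE n (V : valencies n) x : travel V x = across n (e x).
Proof. by rewrite permE. Qed.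

Lemma travelX n (V : valencies n) i x :
  (travel V ^+ i)%g x = iter i (across n \o e) x.
Proof. by rewrite permX; apply: eq_iter => y; rewrite travelE. Qed.

Lemma porbit_stable s x y : (s y \in porbit s x) = (y \in porbit s x).
Proof. by rewrite ![_ \in porbit s x]porbit_sym porbit_next. Qed.

Lemma same_porbit s x y : y \in porbit s x -> porbit s y = porbit s x.
Proof. by move=> yx; apply/eqP; rewrite eq_porbit_mem. Qed.

(** A tour using an edge in both directions would be a palindrome, with a fixed point of [e] or
    [across n] in its middle; [palindrome] excludes this. *)
Lemma porbit_edgeN n (V : valencies n) x y :
  y \in porbit (travel V) x -> e y \notin porbit (travel V) x.
Proof.
move=> yx; apply/negP; rewrite porbit_sym => xe.
have /porbitP[i] : e y \in porbit (travel V) y.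
  by rewrite (same_porbit yx) porbit_sym.
rewrite travelX => /(congr1 e); rewrite eK => E.
by have := palindrome eK e_neq i y V; rewrite -E eqxx.
Qed.

Lemma porbit_travel_total n (V : valencies n) x y :
  (forall x y, connect (strand n e) x y) ->
  (y \in porbit (travel V) x) || (e y \in porbit (travel V) x).
Proof.
move=> con; have [oK _] := acrossP V.
have /connectP[p] := con x y; elim/last_ind: p y => [|p z IH] y /=.
  by move=> _ ->; rewrite porbit_id.
rewrite rcons_path last_rcons => /andP[/IH/(_ erefl) + +] ->.
rewrite /strand /=; set w := last x p.
case/orP=> wx /orP[]/eqP ->; rewrite ?eK ?wx ?orbT //.
  by apply/orP; right; rewrite -porbit_stable travelE eK oK.
by rewrite -[w]eK -(travelE V) porbit_stable wx.
Qed.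

(** Orientations exist because the tour of [x0] contains exactly one dart of every edge, by the two
    preceding lemmas. *)
Lemma orientation_class n (V : valencies n) x0 :
  (forall x y, connect (strand n e) x y) ->
  orientation n (mem (porbit (travel V) x0)).
Proof.
move=> con.
have E x : (e x \in porbit (travel V) x0) = (x \notin porbit (travel V) x0).
  apply/idP/idP => [H|H].
    by have := porbit_edgeN H; rewrite eK.
  by have := porbit_travel_total V x0 x con; rewrite (negPf H).
split=> x /=; first exact: E.
by rewrite -[across n x](_ : travel V (e x) = _) ?porbit_stable ?E // travelE eK.
Qed.

Lemma travel_orientation n (V : valencies n) O i x :
  orientation n O -> O ((travel V ^+ i)%g x) = O x.
Proof.
case=> Oe Oa; elim: i => [|i IH]; first by rewrite expg0 perm1.
by rewrite expgSr permM travelE Oa Oe negbK.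
Qed.

Lemma porbit_orientation n (V : valencies n) O x y :
  (forall x y, connect (strand n e) x y) -> orientation n O ->
  (y \in porbit (travel V) x) = (O y == O x).
Proof.
move=> con oO; have H z : z \in porbit (travel V) x -> O z = O x.
  by case/porbitP=> i ->; apply: travel_orientation.
apply/idP/eqP => [/H //|Oyx].
have /orP[//|/H] := porbit_travel_total V x y con.
by case: oO => Oe _; rewrite Oe Oyx; case: (O x).
Qed.

Lemma card_porbits_travel n (V : valencies n) (x0 : T) :
  (forall x y, connect (strand n e) x y) -> #|porbits (travel V)| = 2.
Proof.
move=> con; have [O oO] : exists O, orientation n O.
  by eexists; apply: orientation_class V x0 con.
have -> : porbits (travel V) = [set porbit (travel V) x0; porbit (travel V) (e x0)].
  apply/setP=> P; rewrite !inE; apply/imsetP/orP.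
    case=> x _ ->; rewrite !eq_porbit_mem !(porbit_orientation V _ _ con oO).
    by case: oO => -> _; case: (O x) (O x0) => [] [] /=; [left|right|right|left].
  by case=> /eqP ->; [exists x0 | exists (e x0)].
rewrite cards2 eq_porbit_mem (porbit_orientation V _ _ con oO).
by case: oO => -> _; case: (O x0).
Qed.

Lemma porbits_mulr_tperm s x y : x != y ->
  #|porbits (s * tperm x y)| + (x \notin porbit s y).*2 = #|porbits s|.+1.
Proof.
move=> xy; have -> : (s * tperm x y)%g = (tperm (s^-1 x) (s^-1 y) * s)%g.
  by rewrite -tpermJ conjgE invgK -!mulgA mulVg mulg1.
have := porbits_mul_tperm s (s^-1 x)%g (s^-1 y)%g.
by rewrite (inj_eq perm_inj) xy addn1 -porbit_stable permKV porbit_sym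
  -porbit_stable permKV porbit_sym.
Qed.

Lemma smoothing_at n d : valency n d = 4 ->
  [/\ smoothing n d d = n d, smoothing n d (n d) = d,
    smoothing n d (n (n d)) = n (n (n d)) & smoothing n d (n (n (n d))) = n (n d)].
Proof.
move=> v4; have [n4 U _] := porbit4 v4; move: U; rewrite /= !inE !negb_or.
case/and4P=> /and3P[d01 d02 d03] /andP[d12 d13] d23 _.
by rewrite !permM n4 tpermL tpermR !tpermD // eq_sym.
Qed.

Lemma smoothing_opp n d : valency n d = 4 -> smoothing n (n (n d)) = smoothing n d.
Proof. by move=> v4; rewrite /smoothing tpermC; have [-> _ _] := porbit4 v4. Qed.

Lemma orientation_opp n O d : valency n d = 4 -> orientation n O ->
  O (n (n d)) = ~~ O d.
Proof. by move=> v4 [_ <-]; rewrite /across v4. Qed.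

(** A smoothing compatible with the orientation multiplies [travel] by two transpositions, one
    within each of its two orbits. Both split an orbit, so four orbits result, whereas a curve with
    one component has two. *)
Lemma oriented_smoothing n d O : valencies n -> valency n d = 4 ->
  ncomponents n e = 1 -> orientation n O -> O (n d) != O d ->
  ncomponents (smoothing n d) e != 1.
Proof.
move=> V v4 c1 oO Od; apply/negP=> c1'.
have con := elimT (one_componentP eK d V) (introT eqP c1).
have V' := smoothing_valencies V v4.
have con' := elimT (one_componentP eK d V') c1'.
have [n4 U mem4] := porbit4 v4; move: (U); rewrite /= !inE !negb_or.
case/and4P=> /and3P[d01 d02 d03] /andP[d12 d13] d23 _.
have v4' : valency n (n d) = 4 by rewrite /valency porbit_next.
have O2 := orientation_opp v4 oO; have O3 := orientation_opp v4' oO.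
set t := tperm d (n (n (n d))); set t' := tperm (n d) (n (n d)).
have E : travel V' = ((travel V * t) * t')%g.
  apply/permP=> x; rewrite !permM !travelE; move: (e x) => {}x.
  have [s0 s1 s2 s3] := smoothing_at v4.
  have [xd|xd] := boolP (x \in porbit n d); last first.
    rewrite smoothing_across_out //.
    have yd : across n x \notin porbit n d by rewrite /across; case: ifP; rewrite !porbit_stable.
    by rewrite tpermD ?tpermD //; apply: contraNneq yd => <-; rewrite ?porbit_stable ?porbit_id.
  have -> : across n x = n (n x).
    by rewrite /across /valency (same_porbit xd) [#|_|]v4.
  rewrite smoothing_across_in //; move: xd; rewrite mem4 !inE.
  case/or4P=> /eqP ->; rewrite ?n4 ?s0 ?s1 ?s2 ?s3 /t /t'.
  - by rewrite [(tperm d _) _]tpermD ?tpermR // eq_sym.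
  - by rewrite [(tperm d _) _]tpermR tpermD // eq_sym.
  - by rewrite [(tperm d _) _]tpermL tpermD // eq_sym.
  - by rewrite [(tperm d _) _]tpermD ?tpermL // eq_sym.
have := card_porbits_travel V' d con'; rewrite E.
have p1 : #|porbits (travel V * t)| = 3.
  have := porbits_mulr_tperm (travel V) d03; rewrite -/t (card_porbits_travel V d con).
  by rewrite (porbit_orientation V _ _ con oO) O3; move: Od;
    case: (O d) (O (n d)) => [] [] //= _; rewrite addn0.
have := porbits_mulr_tperm (travel V * t) d12; rewrite -/t' p1.
(* [t] moves only darts of the other orbit of [travel V], so the way from [n (n d)] to [n d] is
   unchanged. *)
suff -> : n d \in porbit (travel V * t) (n (n d)) by rewrite /= addn0 => ->.
have /porbitP[i] : n d \in porbit (travel V) (n (n d)).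
  by rewrite (porbit_orientation V _ _ con oO) O2; move: Od; case: (O d) (O (n d)) => [] [].
move=> Ei; apply/porbitP; exists i; rewrite [LHS]Ei {Ei}.
elim: i => [|i IH]; first by rewrite !expg0 !perm1.
rewrite !expgSr !permM -IH tpermD //; apply/negP=> /eqP Ed.
  have := travel_orientation V i.+1 (n (n d)) oO.
  by rewrite expgSr permM -Ed O2; case: (O d).
have := travel_orientation V i.+1 (n (n d)) oO.
by rewrite expgSr permM -Ed O3 O2 => /negb_inj /eqP; rewrite (negPf Od).
Qed.

(** If [O (n d) == O d], the other resolution respects the orientation and so disconnects the curve;
    by [smoothing_connected] this one does not. The criterion is local, hence comparable between two
    diagrams. *)
Lemma zero_smoothingE n d O : valencies n -> valency n d = 4 ->
  ncomponents n e = 1 -> orientation n O ->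
  zero_smoothing n e d =
    if O (n d) == O d then smoothing n d else smoothing n (n d).
Proof.
move=> V v4 c1 oO; rewrite /zero_smoothing c1.
have v4' : valency n (n d) = 4 by rewrite /valency porbit_next.
case: (boolP (O (n d) == O d)) => Od; last by rewrite (negPf (oriented_smoothing V v4 c1 oO Od)).
suff -> : ncomponents (smoothing n d) e == 1 by [].
have con := elimT (one_componentP eK d V) (introT eqP c1).
have [/(one_componentP eK d (smoothing_valencies V v4)) //|] :=
  smoothing_connected eK e_neq V v4 con.
move/(one_componentP eK d (smoothing_valencies V v4')) => c1'.
have : O (n (n d)) != O (n d) by rewrite (orientation_opp v4 oO) (eqP Od); case: (O d).
by move/(oriented_smoothing V v4' c1 oO); rewrite c1'.
Qed.

Lemma zero_smoothing_next n d O : valencies n -> valency n d = 4 ->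
  ncomponents n e = 1 -> orientation n O ->
  zero_smoothing n e (n d) = zero_smoothing n e d.
Proof.
move=> V v4 c1 oO; have v4' : valency n (n d) = 4 by rewrite /valency porbit_next.
rewrite !(zero_smoothingE V _ c1 oO) // smoothing_opp //.
by rewrite (orientation_opp v4 oO); case: (O d) (O (n d)) => [] [].
Qed.

Lemma zero_smoothing_at_node n d x : plane_curve n e -> valency n d = 4 ->
  x \in porbit n d -> zero_smoothing n e x = zero_smoothing n e d.
Proof.
move=> P v4; have [V _ _ c1 _] := P.
have con := elimT (one_componentP eK d V) (introT eqP c1).
have oO := orientation_class V d con.
case/porbitP=> i ->; elim: i => [|i IH]; first by rewrite expg0 perm1.
rewrite expgSr permM (zero_smoothing_next _ _ c1 oO) //.
by rewrite -v4 /valency (@same_porbit n d) // mem_porbit.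
Qed.

(** Half of Euler's formula holds without planarity, by [genus_ge0]. To prove a new curve planar it
    is then enough to bound its nodes and faces from below. *)
Lemma euler_le n : valencies n -> ncomponents n e = 1 ->
  #|porbits n| + #|porbits (face n e)| <= #|porbits e| + 2.
Proof.
move=> V c1; case: (pickP T) => [d _|T0]; last first.
  have P0 (s : {perm T}) : #|porbits s| = 0.
    by apply: eq_card0 => P; apply/negP=> /imsetP[x]; have := T0 x.
  by rewrite !P0.
have := genus_ge0 n^-1 e; rewrite porbitsV (card_edges eK e_neq) -/(face n e).
have -> : n_comp (gen n^-1%g e) predT = 1; last by rewrite -addnn; lia.
apply/eqP/(n_comp1P d (@gen_sym _ _ _)) => x y.
have := elimT (one_componentP eK d V) (introT eqP c1) x y.
apply: connect_sub => z w /=; rewrite /strand /= => /orP[]/eqP ->.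
  by apply: connect1; apply: gen_r.
apply: (@connect_porbit _ _ n^-1%g); first by move=> ?; apply: gen_l.
by rewrite porbitV /across; case: ifP => _; rewrite porbit_sym ?porbit_next porbit_id.
Qed.

Lemma smoothing_faceE n d :
  face (smoothing n d) e = (tperm (e^-1 d) (e^-1 (n (n d))) * face n e)%g.
Proof. by rewrite -tpermJ /face /smoothing invMg tpermV conjgE invgK -!mulgA mulKg. Qed.

Lemma card_porbits_smoothing n d : valency n d = 4 ->
  #|porbits (smoothing n d)| = #|porbits n|.+1.
Proof.
move=> v4; have [n4 U _] := porbit4 v4; move: U; rewrite /= !inE !negb_or.
case/and4P=> /and3P[d01 d02 d03] _ _ _.
have := porbits_mulr_tperm n d02; rewrite porbit_sym !porbit_stable porbit_id /=.
by rewrite addn0.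
Qed.

Lemma card_faces_smoothing n d : valency n d = 4 ->
  #|porbits (face n e)| <= #|porbits (face (smoothing n d) e)|.+1.
Proof.
move=> v4; have [n4 U _] := porbit4 v4; move: U; rewrite /= !inE !negb_or.
case/and4P=> /and3P[d01 d02 d03] _ _ _; rewrite smoothing_faceE.
have := porbits_mul_tperm (face n e) (e^-1 d)%g (e^-1 (n (n d)))%g.
by rewrite (inj_eq perm_inj) d02; case: (_ \notin _); rewrite /=; lia.
Qed.

(** [smoothing_curve] cannot simply be applied twice, as the intermediate curve may have two
    components. Two smoothings add two nodes and lose at most two faces, so [euler_le] is an
    equality. *)
Lemma smoothing2_curve n d d' : plane_curve n e -> valency n d = 4 ->
  valency (smoothing n d) d' = 4 ->
  ncomponents (smoothing (smoothing n d) d') e = 1 ->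
  plane_curve (smoothing (smoothing n d) d') e.
Proof.
case=> V _ _ _ euler v4 v4' c1.
have V' := smoothing_valencies (smoothing_valencies V v4) v4'.
split=> //; have := euler_le V' c1; rewrite !card_porbits_smoothing //.
by have := card_faces_smoothing v4; have := card_faces_smoothing v4'; lia.
Qed.

(* A resolution with one component merges two faces, by Euler's formula. *)
Lemma smoothing_face_sub n d x y : plane_curve n e ->
  plane_curve (smoothing n d) e -> valency n d = 4 ->
  y \in porbit (face n e) x -> y \in porbit (face (smoothing n d) e) x.
Proof.
case=> _ _ _ _ euler [_ _ _ _ euler'] v4.
have [n4 U _] := porbit4 v4; move: U; rewrite /= !inE !negb_or.
case/and4P=> /and3P[d01 d02 d03] _ _ _.
move: euler'; rewrite card_porbits_smoothing // smoothing_faceE.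
set u := (e^-1 d)%g; set w := (e^-1 (n (n d)))%g; set f := face n e in euler *; set g := (tperm u w * f)%g.
have uw : u != w by rewrite (inj_eq perm_inj).
move=> euler'; have fE : f = (tperm u w * g)%g by rewrite mulgA tperm2 mul1g.
have uwg : u \in porbit g w.
  have := porbits_mul_tperm g u w; rewrite /= -fE uw.
  case: (u \in _) => //= F; exfalso; move: euler euler' F.
  by move: #|porbits f| #|porbits g| => F G; lia.
case/porbitP=> i ->; elim: i => [|i IH]; first by rewrite expg0 perm1 porbit_id.
rewrite expgSr permM; move: (_ x) IH => z IH; rewrite fE permM porbit_stable.
case: tpermP => // zE; rewrite zE in IH.
  by rewrite -(same_porbit IH) (same_porbit uwg) porbit_id.
by rewrite -(same_porbit IH).
Qed.

Lemma zero_smoothing_face_sub n d x y : plane_curve n e -> valency n d = 4 ->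
  y \in porbit (face n e) x -> y \in porbit (face (zero_smoothing n e d) e) x.
Proof.
move=> P v4 yx; have := zero_smoothing_curve eK e_neq P v4.
rewrite /zero_smoothing; case: ifP => _ P'; apply: smoothing_face_sub => //.
by rewrite /valency porbit_next.
Qed.

End Orientation.

(** [g] induces a map from orbits of [s'] to orbits of [s] whose image contains [P]; the union [F]
    defines it without choosing representatives. *)
Lemma leq_card_porbits (T T' : finType) (s : {perm T}) (s' : {perm T'})
    (g : T' -> T) (P : {set {set T}}) :
  (forall u, g (s' u) \in porbit s (g u)) ->
  (forall Q, Q \in P -> exists u, Q = porbit s (g u)) ->
  #|P| <= #|porbits s'|.
Proof.
move=> gs PE; pose F (Q : {set T'}) := \bigcup_(u in Q) porbit s (g u).
apply: leq_trans (leq_imset_card F _); apply/subset_leq_card/subsetP=> Q /PE[u ->].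
apply/imsetP; exists (porbit s' u); first exact: imset_f.
have H i : porbit s (g ((s' ^+ i)%g u)) = porbit s (g u).
  elim: i => [|i IH]; first by rewrite expg0 perm1.
  by rewrite expgSr permM (same_porbit (gs _)).
apply/setP=> x; apply/idP/bigcupP => [xu|[w /porbitP[i ->]]]; last by rewrite H.
by exists u; rewrite ?porbit_id.
Qed.

Lemma porbit_morph (T T' : finType) (n : {perm T}) (n' : {perm T'}) (g : T' -> T) u :
  (forall v, v \in porbit n' u -> g (n' v) = n (g v)) ->
  porbit n (g u) = g @: porbit n' u.
Proof.
move=> H; have E i : (n ^+ i)%g (g u) = g ((n' ^+ i)%g u).
  elim: i => [|i IH]; first by rewrite !expg0 !perm1.
  by rewrite !expgSr !permM IH H // mem_porbit.
apply/setP=> x; apply/porbitP/imsetP => [[i ->]|[v /porbitP[i ->] ->]].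
  by exists ((n' ^+ i)%g u); rewrite ?mem_porbit ?E.
by exists i; rewrite E.
Qed.

Lemma valency_morph (T T' : finType) (n : {perm T}) (n' : {perm T'}) (g : T' -> T) u :
  {in porbit n' u &, injective g} ->
  (forall v, v \in porbit n' u -> g (n' v) = n (g v)) ->
  valency n (g u) = valency n' u.
Proof. by move=> inj H; rewrite /valency (porbit_morph H) card_in_imset. Qed.

Lemma valency2 (T : finType) (n : {perm T}) b : valency n b = 2 ->
  [/\ n (n b) = b, n b != b & forall x, (x \in porbit n b) = (x == b) || (x == n b)].
Proof.
move=> v2; have [nn nb] := porbit2P n b (introT eqP v2); split=> // x.
have sub : [set b; n b] \subset porbit n b.
  by rewrite subUset !sub1set porbit_stable porbit_id.
suff /eqP <- : [set b; n b] == porbit n b by rewrite !inE.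
by rewrite eqEcard sub cards2 eq_sym nb [#|porbit n b|]v2.
Qed.

Lemma faceE (T : finType) (n e : {perm T}) x : face n e x = (n^-1)%g (e x).
Proof. by rewrite /face permM. Qed.

(** * Deletion of marked points *)

Section Delete.

Variables (D : flat_diagram) (b o : dart D).
Let n := node D.
Let e := edge D.
Hypothesis b2 : valency n b = 2.
Hypothesis eb : e b != n b.
Hypothesis ob : o \notin porbit n b.

Let P := curveP D.
Let eK : involutive e := edgeK P.
Let e_neq : forall x, e x != x := edge_neq P.
Let V : valencies n := valencyE P.

Let T' : finType := {x : dart D | x \notin porbit n b}.

(** A traveller arriving at the deleted point along [x] goes on to [e (n x)]. One jump suffices, as
    [eb] excludes a curve made of [b] alone. *)
Let cut x := if x \in porbit n b then e (n x) else x.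

Let B x : (x \in porbit n b) = (x == b) || (x == n b).
Proof. by have [_ _] := valency2 b2. Qed.

Let cut_out x : x \notin porbit n b -> cut (e x) \notin porbit n b.
Proof.
have [nn nb _] := valency2 b2; rewrite /cut => xb; case: ifP => [|->//].
rewrite !B => /orP[]/eqP ->; rewrite ?nn negb_or ?e_neq ?eb ?andbT //.
by apply: contraNneq eb => E; rewrite -{1}E eK.
Qed.

Let node_out x : x \notin porbit n b -> n x \notin porbit n b.
Proof. by rewrite porbit_stable. Qed.

Let nodef (u : T') : T' := Sub (n (val u)) (node_out (valP u)).
Let edgef (u : T') : T' := Sub (cut (e (val u))) (cut_out (valP u)).

Let nodef_inj : injective nodef.
Proof. by move=> u w /(congr1 val) /= /perm_inj /val_inj. Qed.

Let edgefK : involutive edgef.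
Proof.
have [nn nb _] := valency2 b2.
case=> x xb; apply: val_inj => /=.
rewrite /cut; have [exb|exb] := boolP (e x \in porbit n b); last by rewrite /= eK (negPf xb).
rewrite /= eK porbit_stable exb; move: exb; rewrite B => /orP[]/eqP exE.
  by rewrite exE nn -exE eK.
by rewrite exE nn -exE eK.
Qed.

Let n1 : {perm T'} := perm nodef_inj.
Let e1 : {perm T'} := perm (inv_inj edgefK).

Let n1E u : val (n1 u) = n (val u). Proof. by rewrite permE. Qed.
Let e1E u : val (e1 u) = cut (e (val u)). Proof. by rewrite permE. Qed.

Let valency1 u : valency n1 u = valency n (val u).
Proof.
by apply/esym/valency_morph => [? ? _ _|? _]; [apply: val_inj | apply: n1E].
Qed.

Let V1 : valencies n1.
Proof. by move=> u; rewrite valency1. Qed.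

Let e1K : involutive e1.
Proof. by move=> u; rewrite !permE edgefK. Qed.

Let e1_neq u : e1 u != u.
Proof.
have [nn nb _] := valency2 b2.
apply/negP=> /eqP/(congr1 val); rewrite e1E /cut; case: ifP => [|_ E]; last first.
  by have := e_neq (val u); rewrite E eqxx.
move=> ub /(congr1 e); rewrite eK => E; move: ub; rewrite B.
case/orP=> /eqP E'; move: E nb; rewrite E' ?nn; first by move=> ->; rewrite eqxx.
by move=> <-; rewrite eqxx.
Qed.

Let across1 u : val (across n1 u) = across n (val u).
Proof. by rewrite /across valency1; case: ifP; rewrite !n1E. Qed.

Let o1 : T' := Sub o ob.

(** A dart of the deleted point is identified with the surviving dart of its edge, so that paths of
    the old curve project to paths of the new one. [o1] is only the default of [insubd]. *)
Let retract x : T' := insubd o1 (if x \in porbit n b then e x else x).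

Let retract_val u : retract (val u) = u.
Proof. by rewrite /retract (negPf (valP u)) valKd. Qed.

Let edge_in x : x \in porbit n b -> e x \notin porbit n b.
Proof.
have [nn nb _] := valency2 b2.
rewrite !B => /orP[]/eqP ->; rewrite negb_or ?e_neq ?eb ?andbT //.
by apply: contraNneq eb => E; rewrite -{1}E eK.
Qed.

Let valR x : val (retract x) = if x \in porbit n b then e x else x.
Proof. by rewrite /retract insubdK //; case: ifPn => [/edge_in|]. Qed.

Let component1 : ncomponents n1 e1 = 1.
Proof.
have [nn nb _] := valency2 b2.
apply/eqP/(one_componentP e1K o1 V1) => u w.
have con := elimT (one_componentP eK o V) (introT eqP (one_component P)).
rewrite -[u]retract_val -[w]retract_val.
have : connect (strand n e) (val u) (val w) by apply: con.
case/connectP=> p; elim: p (val u) => [|z p IH] x /=; first by move=> _ ->; rewrite connect0.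
case/andP=> xz /IH{}IH /IH; apply: connect_trans.
case/orP: xz => /eqP ->.
  have [xb|xb] := boolP (x \in porbit n b).
    suff -> : retract (e x) = retract x by apply: connect0.
    by apply: val_inj; rewrite !valR xb (negPf (edge_in xb)).
  have [exb|exb] := boolP (e x \in porbit n b).
    suff -> : retract (e x) = retract x by apply: connect0.
    by apply: val_inj; rewrite !valR exb (negPf xb) eK.
  apply: connect1; rewrite /strand /= -!val_eqE /= e1E !valR (negPf xb) (negPf exb).
  by rewrite /cut (negPf exb) eqxx.
have [xb|xb] := boolP (x \in porbit n b).
  have -> : across n x = n x by rewrite /across /valency (same_porbit xb) [#|_|]b2.
  apply: connect1; rewrite /strand /= -!val_eqE /= e1E !valR porbit_stable xb.
  by rewrite /cut eK xb eqxx.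
have ax : across n x \notin porbit n b by rewrite /across; case: ifP; rewrite !porbit_stable.
apply: connect1; rewrite /strand /= -!val_eqE /= across1 !valR (negPf xb) (negPf ax).
by rewrite eqxx orbT.
Qed.

Let n1V u : val ((n1^-1)%g u) = (n^-1)%g (val u).
Proof. by apply: (@perm_inj _ n); rewrite -n1E !permKV. Qed.

(** The deletion loses one edge, at most one node and no face, so [euler_le] is an equality. *)
Let euler1 : #|porbits n1| + #|porbits (face n1 e1)| = #|porbits e1| + 2.
Proof.
have [nn nb _] := valency2 b2.
have lo := euler_le e1K e1_neq V1 component1; have E := euler_formula P.
have T2 : #|T'| = #|dart D| - 2.
  rewrite card_sig -(cardC (mem (porbit n b))) [#|mem (porbit n b)|]b2 addKn.
  by apply: eq_card => x; rewrite !inE.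
have T0 : 2 <= #|dart D| by rewrite -b2; apply: max_card.
have cE := card_edges eK e_neq; have cE1 := card_edges e1K e1_neq.
have N : #|porbits n| <= #|porbits n1|.+1.
  rewrite (cardsD1 (porbit n b)) imset_f //= add1n ltnS.
  apply: (@leq_card_porbits _ _ n n1 val) => [u|Q].
    by rewrite n1E porbit_stable porbit_id.
  rewrite !inE => /andP[Qb /imsetP[x _ QE]]; move: Qb; rewrite QE eq_porbit_mem => xb.
  by exists (Sub x xb).
(* One step of the new [face] is one or two steps of the old one, and every old face has a dart away
   from [b]. *)
have F : #|porbits (face n e)| <= #|porbits (face n1 e1)|.
  apply: (@leq_card_porbits _ _ (face n e) _ val) => [u|Q /imsetP[x _ ->]].
    rewrite faceE n1V e1E /cut; case: ifP => ub; last by rewrite -(faceE n e) porbit_stable porbit_id.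
    suff -> : (n^-1)%g (e (n (e (val u)))) = face n e (face n e (val u)).
      by rewrite !porbit_stable porbit_id.
    rewrite !faceE; congr ((n^-1)%g (e _)); apply: (@perm_inj _ n); rewrite permKV.
    by move: ub; rewrite B => /orP[]/eqP ->; rewrite nn.
  have [xb|xb] := boolP (x \in porbit n b); last by exists (Sub x xb).
  have fx : face n e x \notin porbit n b.
    by rewrite -porbit_stable faceE permKV edge_in.
  by exists (Sub (face n e x) fx); rewrite /= porbit_next.
move: lo E T2 T0 cE cE1 N F; rewrite -/n -/e -!addnn.
by lia.
Qed.

Let virt1 (u : T') := virt (val u).

Let virt_node1 u : valency n1 u = 4 -> virt1 (n1 u) = virt1 u.
Proof. by rewrite /virt1 valency1 n1E => /virt_node. Qed.

Lemma delete_marked : o \in porbit (face n e) (outer D) ->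
  exists (D1 : flat_diagram) (g : dart D1 -> dart D) (a : dart D1),
    flat_subdivision g a b /\ g (outer D1) = o.
Proof.
have [nn nb _] := valency2 b2.
move=> oo; pose D1 := @FlatDiagram T' n1 e1 virt1 o1 (PlaneCurve V1 e1K e1_neq component1 euler1) virt_node1.
have ebo : e b \notin porbit n b by apply: edge_in; rewrite porbit_id.
have e1a : val (e1 (Sub (e b) ebo)) = e (n b) by rewrite e1E /= /cut eK porbit_id.
exists D1, val, (Sub (e b) ebo); split=> //; split=> //=.
- exact: val_inj.
- by apply/eqP.
- move=> x; apply/codomP/idP => [[u ->]|xb]; first exact: (valP u).
  by exists (Sub x xb).
- move=> u ua; rewrite e1E /cut; case: ifP => // /[!B] ub.
  case/negP: ua; rewrite !inE -!val_eqE /= e1a.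
  by case/orP: ub => /eqP E; rewrite -(eK (val u)) E eqxx ?orbT.
- by rewrite e1a; exact: eK.
Qed.

End Delete.

(** * Cores of diagrams *)

Section Arrive.

Variables (T : finType) (n e : {perm T}) (A : pred T).

(* A traveller along the curve arrives at the node of [z] along [z], and goes on
   through the nodes outside [A], which are marked points. *)
Inductive arrive : T -> T -> Prop :=
| arrive_here z : A z -> arrive z z
| arrive_next z y : ~~ A z -> arrive (e (n z)) y -> arrive z y.

Lemma arrive_det z y y' : arrive z y -> arrive z y' -> y = y'.
Proof.
elim=> {z y} [z Az|z y Az _ IH] H; last first.
  by case: H Az IH => [w -> //|w u _ H _]; apply.
by case: H Az => // w u /negPf ->.
Qed.

End Arrive.

(** [core_edge] describes the edges of [D1] by walks in [D]. Walks are deterministic ([arrive_det]),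
    so this determines [edge D1], whatever the order in which the marked points were deleted. *)
Record core (D : flat_diagram) (A : pred (dart D)) (D1 : flat_diagram)
    (g : dart D1 -> dart D) : Prop := Core {
  core_inj : injective g;
  core_codom : forall x, (x \in codom g) = A x;
  core_node : forall u, g (node D1 u) = node D (g u);
  core_edge : forall u, arrive (node D) (edge D) A (edge D (g u)) (g (edge D1 u));
  core_virt : forall u, double_point u -> virt (g u) = virt u;
  core_equivalent : flat_equiv D1 D
}.

Lemma flat_equiv_sym D D' : flat_equiv D D' -> flat_equiv D' D.
Proof. exact: rst_sym. Qed.

Lemma flat_equiv_trans D D1 D' : flat_equiv D D1 -> flat_equiv D1 D' -> flat_equiv D D'.
Proof. exact: rst_trans. Qed.

Lemma flat_iso_equiv D D' (h : dart D -> dart D') : flat_iso h -> flat_equiv D D'.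
Proof. by move=> H; apply: rst_step; exists h; left; left. Qed.

Lemma core_valency D A D1 (g : dart D1 -> dart D) : core A g ->
  forall u, valency (node D) (g u) = valency (node D1) u.
Proof.
case=> inj _ gn _ _ _ u; apply: valency_morph => [v w _ _|v _]; first exact: inj.
exact: gn.
Qed.

(** Induction on the number of darts outside [A], one marked point being deleted at a time. The dart
    [o] ensures that something is left, and becomes the outer dart. *)
Lemma core_exists (D : flat_diagram) (A : pred (dart D)) (o : dart D) :
  A o -> (forall x, A x -> A (node D x)) -> (forall x, ~~ A x -> marked_point x) ->
  o \in porbit (face (node D) (edge D)) (outer D) ->
  exists (D1 : flat_diagram) (g : dart D1 -> dart D), core A g /\ g (outer D1) = o.
Proof.
have [k] := ubnP #|predC A|; elim: k D A o => // k IH D A o ltk Ao An Am oo.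
have An' x b : b \in porbit (node D) x -> A x -> A b.
  by case/porbitP=> i -> Ax; elim: i => [|i IHi]; rewrite ?expg0 ?perm1 // expgSr permM An.
have [b /= Ab|A1] := pickP (predC A); last first.
  have AT x : A x by apply/negPn; rewrite -[~~ A x]/(predC A x) A1.
  exists (FlatDiagram o (curveP D) (@virt_node D)), id; split=> //; split=> //.
  - by move=> x; rewrite AT; apply/codomP; exists x.
  - by move=> u; apply: arrive_here.
  - apply: rst_step; exists (fun x : dart D => x); left; left; split=> //.
    by exists id.
have [/eqP b2 P] := (Am b Ab, curveP D).
have [nn nb B] := valency2 b2.
have outb x : A x -> x \notin porbit (node D) b.
  by apply: contraL; rewrite porbit_sym => bx; apply: contraNN Ab; apply: An'.
(* Otherwise the point [b] would be a whole component, while [o] lies elsewhere on the connected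
   curve. *)
have eb : edge D b != node D b.
  apply: contraTneq (outb _ Ao) => eb; rewrite negbK.
  have con := elimT (one_componentP (edgeK P) o (valencyE P)) (introT eqP (one_component P)).
  suff H p x : x \in porbit (node D) b -> path (strand (node D) (edge D)) x p ->
      last x p \in porbit (node D) b.
    by case/connectP: (con b o) => p bp ->; apply: H; rewrite ?porbit_id.
  elim: p x => [//|z p IHp] x xb /= /andP[xz]; apply: IHp; case/orP: xz => /eqP ->.
    by move: xb; rewrite !B => /orP[]/eqP ->; [rewrite eb eqxx orbT|rewrite -eb (edgeK P) eqxx].
  by rewrite /across; case: ifP; rewrite !porbit_stable.
have [D1 [g [a [sub go]]]] := delete_marked b2 eb (outb _ Ao) oo.
have [inj _ cod gn ge ge1 ge2 gv gout] := sub.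
have {}cod x : (x \in codom g) = (x \notin porbit (node D) b) by apply: cod.
pose A1 := [pred u | A (g u)].
have val1 u : valency (node D) (g u) = valency (node D1) u.
  by apply: valency_morph => [v w _ _|v _]; [apply: inj | apply: gn].
(* Walks in [D1] lift to [D]: only the two darts of the subdivided edge meet [b], at the cost of one
   more [arrive_next]. *)
have step A' w y : ~~ A' b -> ~~ A' (node D b) -> arrive (node D) (edge D) A' (g (edge D1 w)) y ->
    arrive (node D) (edge D) A' (edge D (g w)) y.
  move=> Ab' Anb' H; have [|/ge <- //] := boolP (w \in [:: a; edge D1 a]).
  rewrite !inE => /orP[]/eqP E; rewrite E in H *.
    by rewrite ge1; apply: arrive_next => //; rewrite -ge2 (edgeK P).
  rewrite ge2; apply: arrive_next => //; rewrite nn -ge1 (edgeK P).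
  by rewrite (edgeK (curveP D1)) in H.
have Anb : ~~ A (node D b) by apply: contraNN Ab => /An; rewrite nn.
have [|||||D2 [g2 [[inj2 cod2 gn2 ge2' gv2 eq2] go2]]] := IH D1 A1 (outer D1).
- apply: leq_trans (_ : #|predC A| <= k) => //.
  have <- : #|[pred x in codom g | ~~ A x]| = #|predC A1|.
    rewrite -(card_image inj); apply: eq_card => x; rewrite !inE.
    apply/andP/imageP => [[/codomP[u ->] Au]|[u Au ->]]; first by exists u.
    by rewrite codom_f.
  apply: proper_card; apply/properP; split; first by apply/subsetP=> x; rewrite !inE => /andP[].
  by exists b; rewrite ?inE //= cod porbit_id.
- by rewrite inE go.
- by move=> u; rewrite !inE gn => /An.
- by move=> u; rewrite inE => /Am; rewrite /marked_point val1.
- exact: porbit_id.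
exists D2, (g \o g2); split; last by rewrite /= go2.
split.
- exact: inj_comp.
- move=> x; apply/codomP/idP => [[u ->]|Ax].
    by have := codom_f g2 u; rewrite cod2.
  have /codomP[u xu] : x \in codom g by rewrite cod outb.
  have /codomP[v uv] : u \in codom g2 by rewrite cod2 /A1 inE -xu.
  by exists v; rewrite xu uv.
- by move=> u; rewrite /= gn2 gn.
- move=> u; apply: (step) => //=; have := ge2' u; move: (edge D1 (g2 u)) (g2 (edge D2 u)) => x y.
  elim=> {x y} [z Az|z y Az _ H]; first exact: arrive_here.
  by apply: arrive_next => //; rewrite -gn; apply: step.
- move=> u u4; rewrite /= gv ?gv2 //; move: u4; rewrite /double_point.
  by rewrite -(@valency_morph _ _ (node D1) (node D2) g2) // => ? ? _ _; apply: inj2.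
- apply: flat_equiv_trans eq2 _; apply: rst_step; exists g; left; right.
  by exists a, b.
Qed.

(** Each diagram is equivalent to its core, and [h] induces an isomorphism of the cores: their edges
    correspond by [arrive_det]. *)
Lemma core_equiv (D D' : flat_diagram) (A : pred (dart D)) (A' : pred (dart D'))
    (h : dart D -> dart D') (o : dart D) :
  A o -> (forall x, A x -> A (node D x)) -> (forall x, ~~ A x -> marked_point x) ->
  (forall x, ~~ A' x -> marked_point x) ->
  o \in porbit (face (node D) (edge D)) (outer D) ->
  h o \in porbit (face (node D') (edge D')) (outer D') ->
  {in A &, injective h} -> (forall y, A' y <-> exists2 x, A x & h x = y) ->
  (forall x, A x -> h (node D x) = node D' (h x)) ->
  (forall x, A x -> double_point x -> virt (h x) = virt x) ->
  (forall x, A x -> exists2 y, arrive (node D) (edge D) A (edge D x) y &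
     arrive (node D') (edge D') A' (edge D' (h x)) (h y)) ->
  flat_equiv D D'.
Proof.
move=> Ao An Am Am' oo oo' inj onto hn hv he.
have An' y : A' y -> A' (node D' y).
  by case/onto=> x Ax <-; apply/onto; exists (node D x); rewrite ?An ?hn.
have Ao' : A' (h o) by apply/onto; exists o.
have [D1 [g [C go]]] := core_exists Ao An Am oo.
have [D2 [g' [C' go']]] := core_exists Ao' An' Am' oo'.
have gA u : A (g u) by rewrite -(core_codom C) codom_f.
have [h1 h1E] : exists h1 : dart D1 -> dart D2, forall u, g' (h1 u) = h (g u).
  apply: (@fin_all_exists (dart D1) (fun=> dart D2) (fun u v => g' v = h (g u))) => u.
  have /codomP[v E] : h (g u) \in codom g'.
    by rewrite (core_codom C'); apply/onto; exists (g u).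
  by exists v.
have injh1 : injective h1.
  by move=> u v /(congr1 g'); rewrite !h1E => /(inj _ _ (gA u) (gA v))/(core_inj C).
have edge1 u : h1 (edge D1 u) = edge D2 (h1 u).
  apply: (core_inj C'); rewrite h1E.
  have [y ey ey'] := he _ (gA u); rewrite (arrive_det (core_edge C u) ey).
  by apply: arrive_det ey' _; rewrite -h1E; apply: core_edge.
have node1 u : h1 (node D1 u) = node D2 (h1 u).
  by apply: (core_inj C'); rewrite h1E (core_node C) hn // (core_node C') h1E.
apply: flat_equiv_trans (flat_equiv_sym (core_equivalent C)) _.
apply: flat_equiv_trans _ (core_equivalent C').
apply: (@flat_iso_equiv _ _ h1); split=> //.
- apply: (inj_card_bij injh1); rewrite -(card_codom (core_inj C)) -(card_codom (core_inj C')).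
  have -> : #|codom g| = #|[seq h x | x in codom g]|.
    by apply/esym/card_in_image => x y; rewrite !(core_codom C); apply: inj.
  apply: subset_leq_card; apply/subsetP=> y; rewrite (core_codom C') => /onto[x Ax <-].
  by apply: image_f; rewrite (core_codom C).
- move=> u u4; rewrite -(core_virt C u4) -(core_virt C') ?h1E ?hv //.
    by rewrite /double_point (core_valency C).
  have inj1 : {in porbit (node D1) u &, injective h1} by move=> ? ? _ _; apply: injh1.
  by rewrite /double_point (valency_morph inj1).
- have -> : outer D2 = h1 (outer D1) by apply: (core_inj C'); rewrite h1E go go'.
  exact: porbit_id.
Qed.

(** * Tables *)

(* The part of a curve inside a disc, its darts being numbered from 0 to
   [tcard - 1]: [tnode] and [tedge] tabulate the two permutations, and
   [tends] lists the darts whose edges cross the boundary of the disc.  The value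
   [tcard + k] in [tedge] stands for the dart outside the disc opposite to the
   end [k]. *)
Record table := Table {
  tcard : nat; tnode : seq nat; tedge : seq nat; tends : seq nat
}.

Definition nd t := nth 0 (tnode t).
Definition ed t := nth 0 (tedge t).
Definition en t := nth 0 (tends t).

Definition table_ok t :=
  [&& size (tnode t) == tcard t, all (mem (tnode t)) (iota 0 (tcard t)),
      all (fun i => nd t i < tcard t) (iota 0 (tcard t)),
      all (fun i => (ed t i < tcard t) ||
             (ed t i - tcard t < size (tends t)) && (en t (ed t i - tcard t) == i))
        (iota 0 (tcard t))
    & all (fun k => (en t k < tcard t) && (ed t (en t k) == tcard t + k))
        (iota 0 (size (tends t)))].

(** The transposition acts on the values of [tnode], not on the positions, because [smoothing]
    multiplies [node] by it on the right. *)
Definition resolve t i := Table (tcard t)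
  [seq if j == i then nd t (nd t i) else if j == nd t (nd t i) then i else j | j <- tnode t]
  (tedge t) (tends t).

(* [None] is never reached: [f] is only fuel.  A walk ends at a dart of [js] or
   at an end [k], coded [tcard t + k]. *)
Fixpoint walk t (js : seq nat) f i : option nat :=
  if i \in js then Some i else
  if f isn't f'.+1 then None else
  let j := ed t (nd t i) in if j < tcard t then walk t js f' j else Some j.

Definition arrival t js := walk t js (tcard t).

Definition departure t js i : option nat :=
  if ed t i < tcard t then arrival t js (ed t i) else Some (ed t i).

Definition straight t i := if nd t (nd t i) == i then nd t i else nd t (nd t i).

(** Unlike [walk], it goes straight through crossings; on a closed curve inside the disc it runs out
    of fuel and gives [None]. *)
Fixpoint leave t f i : option nat :=
  if ed t i < tcard t then
    if f is f'.+1 then leave t f' (straight t (ed t i)) else None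
  else Some (ed t i - tcard t).

Definition exit t i := leave t (tcard t) i.

(** A code independent of the numbering of the darts, so that the spots of two tables can be
    compared: kept darts come first, then the ends. *)
Definition spot_rank t (js : seq nat) r := if r < tcard t then index r js else size js + (r - tcard t).

Definition same_spot t js t' js' (r r' : option nat) :=
  if (r, r') is (Some r, Some r') then spot_rank t js r == spot_rank t' js' r' else false.

Definition marked_off t (js : seq nat) :=
  all (fun i => (i \in js) || (nd t (nd t i) == i) && (nd t i != i)) (iota 0 (tcard t)).

(* Deleting the marked points outside [js] and [js'] leaves the same picture, the
   k-th dart of [js] corresponding to the k-th one of [js']. *)
Definition same_core t js t' js' :=
  [&& all (fun i => i < tcard t) js, all (fun i => i < tcard t') js',
      uniq js && uniq js', size js == size js', size (tends t) == size (tends t'),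
      all (fun k => same_spot t js t' js' (arrival t js (en t k)) (arrival t' js' (en t' k)))
        (iota 0 (size (tends t))),
      all (fun k => same_spot t js t' js' (departure t js (nth 0 js k)) (departure t' js' (nth 0 js' k)))
        (iota 0 (size js)),
      all (fun k => (nd t (nth 0 js k) \in js) &&
             (index (nd t (nth 0 js k)) js == index (nd t' (nth 0 js' k)) js'))
        (iota 0 (size js)),
      marked_off t js & marked_off t' js'].

(* The curves join the ends of the disc in the same pairs. *)
Definition same_ends t t' :=
  (size (tends t) == size (tends t')) &&
  all (fun i => if (exit t i, exit t (straight t i)) is (Some k, Some k') then
         (exit t' (straight t' (en t' k)) == Some k') &&
         ((ed t i < tcard t) ==> (exit t (straight t (ed t i)) == Some k))
       else false) (iota 0 (tcard t)).

Lemma all_iota (p : pred nat) N i : all p (iota 0 N) -> i < N -> p i.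
Proof. by move/allP=> H iN; apply: H; rewrite mem_iota. Qed.

(** * Tables realized in a curve *)

Section Patch.

Variables (T : finType) (x0 : T) (n e : {perm T}) (L : seq T) (t : table).

Record patch : Prop := Patch {
  patch_uniq : uniq L;
  patch_size : size L = tcard t;
  patch_ok : table_ok t;
  patch_node : forall i, i < tcard t -> n (nth x0 L i) = nth x0 L (nd t i);
  patch_edge : forall i, i < tcard t -> ed t i < tcard t ->
    e (nth x0 L i) = nth x0 L (ed t i);
  patch_out : forall i, i < tcard t -> tcard t <= ed t i -> e (nth x0 L i) \notin L
}.

Definition keep (js : seq nat) : pred T := [pred x | (x \notin L) || (index x L \in js)].

Definition spot r :=
  if r < tcard t then nth x0 L r else e (nth x0 L (en t (r - tcard t))).

Hypothesis P : patch.
Hypothesis eK : involutive e.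

Lemma nd_lt i : i < tcard t -> nd t i < tcard t.
Proof. by case/and5P: (patch_ok P) => _ _ H _ _; apply: (all_iota H). Qed.

Lemma ed_out i : i < tcard t -> tcard t <= ed t i ->
  ed t i - tcard t < size (tends t) /\ en t (ed t i - tcard t) = i.
Proof.
case/and5P: (patch_ok P) => _ _ _ H _ it le; have := all_iota H it.
by rewrite ltnNge le /= => /andP[-> /eqP].
Qed.

Lemma en_lt k : k < size (tends t) -> en t k < tcard t /\ ed t (en t k) = tcard t + k.
Proof.
by case/and5P: (patch_ok P) => _ _ _ _ H kt; have /andP[-> /eqP] := all_iota H kt.
Qed.

Lemma nth_patch i : i < tcard t -> nth x0 L i \in L.
Proof. by move=> it; apply: mem_nth; rewrite (patch_size P). Qed.

Lemma patchP x : reflect (exists2 i, i < tcard t & x = nth x0 L i) (x \in L).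
Proof.
apply: (iffP (nthP x0)) => -[i iL xi]; exists i => //; first by rewrite -(patch_size P).
by rewrite (patch_size P).
Qed.

Lemma index_patch i : i < tcard t -> index (nth x0 L i) L = i.
Proof. by move=> it; rewrite index_uniq ?(patch_size P) ?(patch_uniq P). Qed.

Lemma keep_nth js i : i < tcard t -> keep js (nth x0 L i) = (i \in js).
Proof. by move=> it; rewrite /keep /= nth_patch // index_patch. Qed.

Lemma keep_out js x : x \notin L -> keep js x.
Proof. by rewrite /keep /= => ->. Qed.

Lemma keepP js x : all (fun i => i < tcard t) js -> keep js x ->
  x \notin L \/ exists2 k, k < size js & x = nth x0 L (nth 0 js k).
Proof.
move=> jst /orP[|xj]; first by left.
have [xL|] := boolP (x \in L); last by left.
by right; exists (index (index x L) js); rewrite ?index_mem // nth_index // nth_index.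
Qed.

Lemma end_out k : k < size (tends t) -> e (nth x0 L (en t k)) \notin L.
Proof. by move=> /en_lt[lt E]; apply: (patch_out P) => //; rewrite E leq_addr. Qed.

Lemma end_edge x : x \notin L -> e x \in L ->
  exists2 k, k < size (tends t) & e x = nth x0 L (en t k).
Proof.
move=> xL /patchP[i it E]; have : tcard t <= ed t i.
  rewrite leqNgt; apply: contraNN xL => lt.
  by rewrite -(eK x) E (patch_edge P) ?nth_patch.
by case/(ed_out it) => lt Ei; exists (ed t i - tcard t); rewrite ?Ei.
Qed.

(** [tnode] is onto, so every dart of the disc is already the image of a dart of the disc, and [n]
    is injective. *)
Lemma patch_stable x : x \notin L -> n x \notin L.
Proof.
case/and5P: (patch_ok P) => /eqP sz H _ _ _; apply: contraNN => /patchP[i it E].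
have : i \in tnode t by apply: (all_iota H).
case/(nthP 0)=> j; rewrite sz => jt ij; rewrite (_ : x = nth x0 L j) ?nth_patch //.
by apply: (@perm_inj _ n); rewrite E (patch_node P) // -ij.
Qed.

Lemma spot_out i : i < tcard t -> tcard t <= ed t i -> spot (ed t i) = e (nth x0 L i).
Proof. by move=> it le; have [_ E] := ed_out it le; rewrite /spot ltnNge le /= E. Qed.

Definition spot_ok (js : seq nat) r := if r < tcard t then r \in js else r - tcard t < size (tends t).

Lemma walkP js f i r : i < tcard t -> walk t js f i = Some r ->
  arrive n e (keep js) (nth x0 L i) (spot r) /\ spot_ok js r.
Proof.
have here j : j < tcard t -> j \in js -> Some j = Some r ->
    arrive n e (keep js) (nth x0 L j) (spot r) /\ spot_ok js r.
  move=> it ij [<-]; rewrite /spot /spot_ok it; split=> //; apply: arrive_here.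
  by rewrite keep_nth.
elim: f i => [|f IH] i it /=; case: ifPn => [ij|ij] //; try exact: here.
have next y : arrive n e (keep js) (e (nth x0 L (nd t i))) y ->
    arrive n e (keep js) (nth x0 L i) y.
  by move=> H; apply: arrive_next; rewrite ?keep_nth // (patch_node P).
have ndt := nd_lt it; case: ltnP => [lt|le].
  by case/(IH _ lt) => H; split=> //; apply: next; rewrite (patch_edge P).
case=> <-; split; last by rewrite /spot_ok ltnNge le /=; case: (ed_out ndt le).
by apply: next; rewrite spot_out //; apply: arrive_here; apply/keep_out/(patch_out P).
Qed.

Lemma arrivalP js k r : k < size (tends t) -> arrival t js (en t k) = Some r ->
  arrive n e (keep js) (nth x0 L (en t k)) (spot r) /\ spot_ok js r.
Proof. by move/en_lt=> [lt _]; apply: walkP. Qed.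

Lemma departureP js i r : i < tcard t -> departure t js i = Some r ->
  arrive n e (keep js) (e (nth x0 L i)) (spot r) /\ spot_ok js r.
Proof.
move=> it; rewrite /departure; case: ltnP => [lt|le].
  by rewrite (patch_edge P) //; apply: walkP.
case=> <-; rewrite /spot_ok ltnNge le /=; split; last by case: (ed_out it le).
by rewrite spot_out //; apply/arrive_here/keep_out/(patch_out P).
Qed.

Lemma marked_offP js x : marked_off t js -> ~~ keep js x -> valency n x = 2.
Proof.
move=> H; rewrite negb_or negbK => /andP[/patchP[i it ->]].
rewrite index_patch // => ij; have := all_iota H it.
rewrite (negPf ij) /= => /andP[/eqP nn ni]; apply/eqP/porbit2P.
have ndt := nd_lt it; rewrite !(patch_node P) // nn; split=> //.
by rewrite nth_uniq ?(patch_size P) // (patch_uniq P).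
Qed.

Lemma straight_lt i : i < tcard t -> straight t i < tcard t.
Proof. by rewrite /straight; case: ifP => _ it; rewrite !nd_lt. Qed.

(** The table shows the valency: only 2 and 4 occur, and returning after two turns tells them
    apart. *)
Lemma acrossE i : valencies n -> i < tcard t ->
  across n (nth x0 L i) = nth x0 L (straight t i).
Proof.
move=> V it; have ndt := nd_lt it; have nd2 := nd_lt ndt.
have nn : n (n (nth x0 L i)) = nth x0 L (nd t (nd t i)) by rewrite !(patch_node P).
rewrite /across /straight; case: eqP => [v4|v4]; case: eqP => [E|E] //.
- have [_] := porbit4 v4; rewrite nn E /= !inE eqxx.
  by rewrite !negb_or !andbF.
- by rewrite (patch_node P).
- have /orP[v2|/eqP //] := V (nth x0 L i); have [nnE _] := porbit2P _ _ v2.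
  have := congr1 (index^~ L) nnE; rewrite nn !index_patch //.
Qed.

Lemma exit_lt f i k : i < tcard t -> leave t f i = Some k -> k < size (tends t).
Proof.
elim: f i => [|f IH] i it /=; case: ltnP => [lt|le] //.
- by case=> <-; case: (ed_out it le).
- by apply: IH; apply: straight_lt.
- by case=> <-; case: (ed_out it le).
Qed.

Lemma exit_orientation O f i k : valencies n -> orientation e n O ->
  i < tcard t -> leave t f i = Some k -> O (nth x0 L i) = O (nth x0 L (en t k)).
Proof.
move=> V oO; have [Oe Oa] := oO.
elim: f i => [|f IH] i it /=; case: ltnP => [lt|le] //; try by case=> <-; case: (ed_out it le) => _ ->.
by move/(IH _ (straight_lt lt)) => <-; rewrite -acrossE // Oa -(patch_edge P) // Oe negbK.
Qed.

Lemma exit_connect f i k : valencies n ->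
  i < tcard t -> leave t f i = Some k ->
  connect (strand n e) (nth x0 L i) (nth x0 L (en t k)).
Proof.
move=> V; elim: f i => [|f IH] i it /=; case: ltnP => [lt|le] //;
  try by case=> <-; case: (ed_out it le) => _ ->.
move/(IH _ (straight_lt lt)); apply: connect_trans.
apply: (@connect_trans _ _ (e (nth x0 L i))); apply: connect1; first by rewrite /strand /= eqxx.
by rewrite /strand /= (patch_edge P) // -acrossE // eqxx orbT.
Qed.

Lemma porbit_patch i x : i < tcard t -> x \in porbit n (nth x0 L i) -> x \in L.
Proof.
move=> it; case/porbitP=> k ->; elim: k => [|k IH]; first by rewrite expg0 perm1 nth_patch.
rewrite expgSr permM; have /patchP[j jt ->] := IH.
by rewrite (patch_node P) // nth_patch // nd_lt.
Qed.

Lemma smoothing_off i d x : i < tcard t -> d = nth x0 L i -> x \notin L ->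
  smoothing n d x = n x.
Proof.
move=> it ->; have [/(porbit_patch it) -> //|xd _] := boolP (x \in porbit n (nth x0 L i)).
exact: smoothing_next.
Qed.

Lemma valency_off (n2 : {perm T}) x : (forall y, y \notin L -> n2 y = n y) -> x \notin L ->
  valency n2 x = valency n x.
Proof.
move=> N xL; apply: (@valency_morph _ _ n2 n id) => [//|y].
suff yL : y \in porbit n x -> y \notin L by move/yL/N.
case/porbitP=> i ->; elim: i => [|i IH]; first by rewrite expg0 perm1.
by rewrite expgSr permM patch_stable.
Qed.

End Patch.

Lemma resolve_patch (T : finType) (x0 : T) (n e : {perm T}) L t i d :
  patch x0 n e L t -> i < tcard t -> d = nth x0 L i ->
  table_ok (resolve t i) -> patch x0 (smoothing n d) e L (resolve t i).
Proof.
move=> P it -> ok; case: (P) => U sz _ nodeP edgeP outP; split=> // j jt.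
have [i1 i2] : nd t i < tcard t /\ nd t (nd t i) < tcard t by rewrite !(nd_lt P) // (nd_lt P).
have j1 := nd_lt P jt; have nt : size (tnode t) = tcard t by case/and5P: (patch_ok P) => /eqP.
have jn : j < size (tnode t) by rewrite nt.
have inj k l : k < tcard t -> l < tcard t -> (nth x0 L k == nth x0 L l) = (k == l).
  by move=> kt lt; rewrite nth_uniq ?sz.
rewrite permM !nodeP // [nd (resolve t i) j](nth_map 0) // -/(nd t j).
case: tpermP => [/eqP|/eqP|/eqP E1 /eqP E2].
- by rewrite inj // => ->.
- by rewrite inj // => /eqP ->; rewrite eqxx; case: eqP => // ->.
- by move: E1 E2; rewrite !inj // => /negPf-> /negPf->.
Qed.

(** What [replaced] says of the outside of the disc and of its ends, for bare permutations. It
    survives any change of the nodes inside the discs ([match_off]), in particular smoothings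
    there. *)
Record outside_match (T T' : finType) (n e : {perm T}) (v : pred T)
    (n' e' : {perm T'}) (v' : pred T') (h : T -> T') (L : seq T) (L' : seq T')
    (es : seq T) (es' : seq T') : Prop := OutsideMatch {
  match_inj : {in [predC L] &, injective h};
  match_onto : forall y, y \notin L' <-> exists2 x, x \notin L & h x = y;
  match_node : forall x, x \notin L -> h (n x) = n' (h x);
  match_edge : forall x, x \notin L -> e x \notin L -> h (e x) = e' (h x);
  match_ends : size es = size es' /\
    forall x0 x0' k, k < size es -> e' (nth x0' es' k) = h (e (nth x0 es k));
  match_virt : forall x, x \notin L -> valency n x = 4 -> v' (h x) = v x
}.

Section Match.

Variables (T T' : finType) (x0 : T) (x0' : T') (n e : {perm T}) (v : pred T).
Variables (n' e' : {perm T'}) (v' : pred T') (h : T -> T').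
Variables (L : seq T) (L' : seq T') (t t' : table).
Hypothesis P : patch x0 n e L t.
Hypothesis P' : patch x0' n' e' L' t'.
Hypothesis M : outside_match n e v n' e' v' h L L'
  [seq nth x0 L i | i <- tends t] [seq nth x0' L' i | i <- tends t'].
Hypothesis eK : involutive e.
Hypothesis eK' : involutive e'.

Lemma match_size : size (tends t) = size (tends t').
Proof. by case: (match_ends M); rewrite !size_map. Qed.

Lemma match_end k : k < size (tends t) ->
  e' (nth x0' L' (en t' k)) = h (e (nth x0 L (en t k))).
Proof.
move=> kt; have [_ /(_ x0 x0' k)] := match_ends M; rewrite size_map => /(_ kt).
by rewrite !(nth_map 0) -?match_size.
Qed.

Lemma match_out x : x \notin L -> h x \notin L'.
Proof. by move=> xL; apply/(match_onto M); exists x. Qed.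

Lemma match_valency x : x \notin L -> valency n' (h x) = valency n x.
Proof.
move=> xL; have out y : y \in porbit n x -> y \notin L.
  case/porbitP=> i ->; elim: i => [|i IH]; first by rewrite expg0 perm1.
  by rewrite expgSr permM (patch_stable P).
apply: valency_morph => [y z yx zx|y yx].
  by apply: (match_inj M); rewrite inE /= out.
by apply: (match_node M); apply: out.
Qed.

Lemma match_across x : x \notin L -> h (across n x) = across n' (h x).
Proof.
move=> xL; rewrite /across match_valency //; case: ifP => _; rewrite !(match_node M) //.
by apply: (patch_stable P).
Qed.

(** A dart inside the disc takes its direction from the end by which the curve leaves along it, read
    in the other disc. Under [same_ends] the default [0] is never reached. *)
Definition pullback (O : pred T') : pred T := [pred x | if x \in L
  then O (nth x0' L' (en t' (odflt 0 (exit t (index x L))))) else O (h x)].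

Lemma pullback_nth O i k : i < tcard t -> exit t i = Some k ->
  pullback O (nth x0 L i) = O (nth x0' L' (en t' k)).
Proof. by move=> it E; rewrite /pullback /= (nth_patch P) // (index_patch P) // E. Qed.

Lemma pullback_out O x : x \notin L -> pullback O x = O (h x).
Proof. by rewrite /pullback /= => /negPf ->. Qed.

Lemma pullback_orientation O : valencies n -> valencies n' ->
  same_ends t t' -> orientation e' n' O -> orientation e n (pullback O).
Proof.
move=> V V' /andP[_ C] oO; have [Oe' Oa'] := oO.
(* The last clause says that one more unit of fuel does not change [exit]; [same_ends] checks it by
   computation. *)
have Hexit i : i < tcard t -> exists k k', [/\ exit t i = Some k,
    exit t (straight t i) = Some k', exit t' (straight t' (en t' k)) = Some k'
    & ed t i < tcard t -> exit t (straight t (ed t i)) = Some k].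
  move=> it; have := all_iota C it; case: (exit t i) => // k.
  by case: (exit t (straight t i)) => // k' /andP[/eqP E /implyP H]; exists k, k'; split=> // /H/eqP.
have Ha x : pullback O (across n x) = ~~ pullback O x.
  have [/(patchP P)[i it ->]|xL] := boolP (x \in L); last first.
    have xaL : across n x \notin L by rewrite /across; case: ifP; rewrite ?(patch_stable P).
    by rewrite !pullback_out // match_across // Oa'.
  have [k [k' [Ek Ek' E _]]] := Hexit i it; have st := straight_lt P it.
  rewrite (acrossE P) // !(pullback_nth _ _ Ek, pullback_nth _ _ Ek') //.
  have kt : k < size (tends t') by rewrite -match_size (exit_lt P it Ek).
  have [lt _] := en_lt P' kt.
  by rewrite -(exit_orientation P' V' oO (straight_lt P' lt) E) -(acrossE P') // Oa'.
have He i : i < tcard t -> pullback O (e (nth x0 L i)) = ~~ pullback O (nth x0 L i).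
  move=> it; have [k [k' [Ek Ek' _ H]]] := Hexit i it.
  have [lt|le] := ltnP (ed t i) (tcard t).
    rewrite (patch_edge P) // (pullback_nth _ it Ek).
    rewrite -(pullback_nth _ (straight_lt P lt) (H lt)) -(acrossE P) // Ha.
    by rewrite negbK.
  have [kt Ei] := ed_out P it le; rewrite pullback_out ?(patch_out P) //.
  rewrite -{1}Ei -match_end // Oe' (pullback_nth _ it (_ : _ = Some (ed t i - tcard t))) //.
  by have /(_ (tcard t)) : forall f, leave t f i = Some (ed t i - tcard t) by case=> [|f] /=; rewrite ltnNge le.
split=> // x; have [/(patchP P)[i it ->]|xL] := boolP (x \in L); first exact: He.
have [exL|exL] := boolP (e x \in L).
  by case/(patchP P): exL => i it exE; rewrite exE -(eK x) exE He // negbK.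
by rewrite !pullback_out // (match_edge M) // Oe'.
Qed.

End Match.

(** * Diagrams equal up to marked points *)

Section SameCore.

Variables (S S' : flat_diagram) (x0 : dart S) (x0' : dart S') (h : dart S -> dart S').
Variables (L : seq (dart S)) (L' : seq (dart S')) (t t' : table) (js js' : seq nat).
Let n := node S. Let e := edge S.
Let n' := node S'. Let e' := edge S'.
Hypothesis P : patch x0 n e L t.
Hypothesis P' : patch x0' n' e' L' t'.
Hypothesis M : outside_match n e (@virt S) n' e' (@virt S') h L L'
  [seq nth x0 L i | i <- tends t] [seq nth x0' L' i | i <- tends t'].
Hypothesis C : same_core t js t' js'.
Hypothesis kept_virt : forall k, k < size js ->
  virt (nth x0' L' (nth 0 js' k)) = virt (nth x0 L (nth 0 js k)).

Let eK : involutive e := edgeK (curveP S).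
Let eK' : involutive e' := edgeK (curveP S').

Let glue x := if x \in L then nth x0' L' (nth 0 js' (index (index x L) js)) else h x.

(** An instance of [core_equiv] for the glued map. A walk entering the disc from outside is an
    [arrival] at an end, one starting at a kept dart inside is a [departure], and [same_core]
    compares where they stop. *)
Lemma same_core_equiv o : o \notin L ->
  o \in porbit (face n e) (outer S) -> h o \in porbit (face n' e') (outer S') ->
  flat_equiv S S'.
Proof.
case/and5P: C => jt jt' /andP[uj uj'] /eqP szj /and5P[/eqP szt Carr Cdep Cnode].
case/andP=> off off' oL oo oo'.
have jlt k : k < size js -> nth 0 js k < tcard t by move=> kj; apply: (allP jt); rewrite mem_nth.
have jlt' k : k < size js -> nth 0 js' k < tcard t'.
  by rewrite szj => kj; apply: (allP jt'); rewrite mem_nth.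
have glue_js k : k < size js -> glue (nth x0 L (nth 0 js k)) = nth x0' L' (nth 0 js' k).
  by move=> kj; rewrite /glue (nth_patch P) ?jlt // (index_patch P) ?jlt // index_uniq.
have glue_out x : x \notin L -> glue x = h x by rewrite /glue => /negPf ->.
have keep_js k : k < size js -> keep L js (nth x0 L (nth 0 js k)).
  by move=> kj; rewrite (keep_nth P) ?jlt ?mem_nth.
have glue_spot r r' : spot_ok t js r -> spot_ok t' js' r' ->
    spot_rank t js r = spot_rank t' js' r' -> glue (spot x0 e L t r) = spot x0' e' L' t' r'.
  rewrite /spot_ok /spot_rank /spot; case: (ltnP r (tcard t)) => rt; case: (ltnP r' (tcard t')) => rt' rok rok' E.
  - rewrite -(nth_index 0 rok) glue_js ?index_mem // E nth_index //.
  - by move: rok; rewrite -index_mem E szj ltnNge leq_addr.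
  - by move: rok'; rewrite -index_mem -E szj ltnNge leq_addr.
  - have <- : r - tcard t = r' - tcard t' by move: E; rewrite szj => /addnI.
    by rewrite glue_out ?(end_out P) // (match_end M).
apply: (@core_equiv S S' (keep L js) (keep L' js') glue o) => //.
- exact: keep_out.
- move=> x /(keepP x0 jt)[xL|[k kj ->]]; first by apply/keep_out/(patch_stable P).
  rewrite (patch_node P) ?jlt // (keep_nth P) ?(nd_lt P) ?jlt //.
  by have /andP[] := all_iota Cnode kj.
- by move=> x /(marked_offP P off) v2; apply/eqP.
- by move=> x /(marked_offP P' off') v2; apply/eqP.
- by rewrite glue_out.
- move=> x y /(keepP x0 jt)[xL|[k kj ->]] /(keepP x0 jt)[yL|[l lj ->]].
  + by rewrite !glue_out //; apply: (match_inj M).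
  + rewrite glue_out // glue_js // => E; have := match_out M xL.
    by rewrite E (nth_patch P') ?jlt'.
  + rewrite (glue_out y) // glue_js // => E; have := match_out M yL.
    by rewrite -E (nth_patch P') ?jlt'.
  + rewrite !glue_js // => /eqP; rewrite nth_uniq ?(patch_size P') ?(patch_uniq P') ?jlt' //.
    by rewrite nth_uniq -?szj // => /eqP ->.
- move=> y; split.
    case/(keepP x0' jt') => [yL|[k]].
      by case/(match_onto M): yL => x xL <-; exists x; [apply: keep_out | apply: glue_out].
    by rewrite -szj => kj ->; exists (nth x0 L (nth 0 js k)); [apply: keep_js | apply: glue_js].
  case=> x /(keepP x0 jt)[xL|[k kj ->]] <-.
    by rewrite glue_out //; apply/keep_out/(match_out M).
  by rewrite glue_js // (keep_nth P') ?jlt' // mem_nth -?szj.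
- move=> x /(keepP x0 jt)[xL|[k kj ->]].
    by rewrite !glue_out ?(patch_stable P) // (match_node M).
  rewrite glue_js // (patch_node P) ?jlt // (patch_node P') ?jlt' //.
  have /andP[nj /eqP E] := all_iota Cnode kj.
  rewrite -(nth_index 0 nj) glue_js ?index_mem // E nth_index //.
  by rewrite -index_mem -szj -E index_mem.
- move=> x /(keepP x0 jt)[xL|[k kj ->]] x4; first by rewrite glue_out // (match_virt M) //; apply/eqP.
  by rewrite glue_js // kept_virt.
- move=> x /(keepP x0 jt)[xL|[k kj ->]].
    have hxL := match_out M xL.
    have [exL|exL] := boolP (e x \in L); last first.
      exists (e x); first by apply/arrive_here/keep_out.
      rewrite !glue_out // -(match_edge M) //.
      by apply/arrive_here/keep_out/(match_out M).
    have [k kt exE] := end_edge P eK xL exL.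
    have := all_iota Carr kt; rewrite /same_spot.
    case Er: arrival => [r|] //; case Er': arrival => [r'|] // /eqP E.
    have [a1 ok1] := arrivalP P kt Er.
    have kt' : k < size (tends t') by rewrite -szt.
    have [a2 ok2] := arrivalP P' kt' Er'.
    exists (spot x0 e L t r); first by rewrite -/e exE.
    rewrite (glue_spot _ _ ok1 ok2 E) glue_out // -/e' -[x]eK exE.
    by rewrite -(match_end M) // eK'.
  have := all_iota Cdep kj; rewrite /same_spot.
  case Er: departure => [r|] //; case Er': departure => [r'|] // /eqP E.
  have [a1 ok1] := departureP P (jlt _ kj) Er.
  have [a2 ok2] := departureP P' (jlt' _ kj) Er'.
  by exists (spot x0 e L t r) => //; rewrite (glue_spot _ _ ok1 ok2 E) glue_js.
Qed.

End SameCore.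

(* After deletion of the other marked points the insides of the discs have the
   darts [js] and [js'] and the boundaries [b] and [b']. *)
Definition same_disc t (js : seq nat) b t' (js' : seq nat) b' :=
  [&& size b == size b', size (tends t) == size (tends t'),
      all (fun k => if (arrival t js (en t k), arrival t' js' (en t' k)) is (Some r, Some r')
        then if r < tcard t then (r' < tcard t') &&
               all (fun i => (nth 0 b i == r) ==> (nth 0 b' i == r')) (iota 0 (size b))
             else (tcard t' <= r') && (r - tcard t == r' - tcard t')
        else false) (iota 0 (size (tends t)))
    & all (fun i => [&& nth 0 b i < tcard t, nth 0 b' i < tcard t'
                      & if departure t js (nth 0 b i) is Some r then tcard t <= r else false])
        (iota 0 (size b))].

Section CoreReplaced.

Variables (D S : flat_diagram) (x0 : dart D) (x0' : dart S) (h0 : dart D -> dart S).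
Variables (L : seq (dart D)) (L' : seq (dart S)) (t t' : table) (js js' b b' : seq nat).
Let n := node D. Let e := edge D.
Let n' := node S. Let e' := edge S.
Hypothesis P : patch x0 n e L t.
Hypothesis P' : patch x0' n' e' L' t'.
Hypothesis M : outside_match n e (@virt D) n' e' (@virt S) h0 L L'
  [seq nth x0 L i | i <- tends t] [seq nth x0' L' i | i <- tends t'].
Hypothesis C : same_disc t js b t' js' b'.

Variables (D1 S1 : flat_diagram) (g : dart D1 -> dart D) (g' : dart S1 -> dart S).
Hypothesis G : core (keep L js) g.
Hypothesis G' : core (keep L' js') g'.
Hypothesis go : g (outer D1) \notin L.
Hypothesis go' : g' (outer S1) = h0 (g (outer D1)).
Variables (ns es : seq (dart D1)) (ns' es' : seq (dart S1)).
Hypothesis nsE : forall u, inside ns u = (g u \in L).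
Hypothesis nsE' : forall u, inside ns' u = (g' u \in L').
Hypothesis esE : map g es = [seq nth x0 L i | i <- b].
Hypothesis esE' : map g' es' = [seq nth x0' L' i | i <- b'].

Let eK : involutive e := edgeK (curveP D).
Let eK' : involutive e' := edgeK (curveP S).

(** The cores differ by a replacement of discs even when extra marked points prevent this for [D]
    and [S]. Edges from outside into the disc are compared through the arrivals at its ends. *)
Lemma core_replaced : exists2 h : dart D1 -> dart S1,
  replaced h ns es ns' es' & forall u, g u \notin L -> g' (h u) = h0 (g u).
Proof.
case/and4P: C => /eqP szb /eqP szt Carr Cdep.
have szes : size es = size b by rewrite -(size_map g) esE size_map.
have szes' : size es' = size b' by rewrite -(size_map g') esE' size_map.
have esg u i : i < size es -> g (nth u es i) = nth x0 L (nth 0 b i).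
  by move=> ie; rewrite -(nth_map _ x0) // esE (nth_map 0) // -szes.
have esg' u i : i < size es -> g' (nth u es' i) = nth x0' L' (nth 0 b' i).
  move=> ie; rewrite -(nth_map _ x0') ?esE' ?(nth_map 0) //; last by rewrite szes' -szb -szes.
  by rewrite -szb -szes.
have [h hE] : exists h : dart D1 -> dart S1, forall u, g u \notin L -> g' (h u) = h0 (g u).
  apply: (@fin_all_exists (dart D1) (fun=> dart S1)
    (fun u v => g u \notin L -> g' v = h0 (g u))) => u.
  (* Inside the disc the value of [h] is irrelevant; [outer S1] is a default. *)
  have [uL|uL] := boolP (g u \in L); first by exists (outer S1).
  have /codomP[v vE] : h0 (g u) \in codom g'.
    by rewrite (core_codom G'); apply/keep_out/(match_out M).
  by exists v => _.
have edge_out u : g u \notin L -> e (g u) \notin L -> g (edge D1 u) = e (g u).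
  move=> _ eL; apply: arrive_det (core_edge G u) _; exact/arrive_here/keep_out.
have edge_out' u : g' u \notin L' -> e' (g' u) \notin L' -> g' (edge S1 u) = e' (g' u).
  move=> _ eL; apply: arrive_det (core_edge G' u) _; exact/arrive_here/keep_out.
have edge_in u : g u \notin L -> e (g u) \in L -> exists k r r',
    [/\ k < size (tends t), arrival t js (en t k) = Some r,
        arrival t' js' (en t' k) = Some r', g (edge D1 u) = spot x0 e L t r
      & g' (edge S1 (h u)) = spot x0' e' L' t' r'].
  move=> uL eL; have [k kt ek] := end_edge P eK uL eL; have := all_iota Carr kt.
  case Er: arrival => [r|] //; case Er': arrival => [r'|] // _.
  have [a1 _] := arrivalP P kt Er.
  have kt' : k < size (tends t') by rewrite -szt.
  have [a2 _] := arrivalP P' kt' Er'.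
  exists k, r, r'; split=> //; first by apply: arrive_det (core_edge G u) _; rewrite -/e ek.
  apply: arrive_det (core_edge G' _) _; rewrite hE // -/e' -[g u]eK ek.
  by rewrite -(match_end M) // eK'.
exists h => //; split.
- have out u : u \in [predC inside ns] -> g u \notin L by rewrite -nsE.
  move=> u w /out uL /out wL /(congr1 g'); rewrite !hE //.
  by move/(match_inj M uL wL)/(core_inj G).
- move=> y; rewrite nsE'; split=> [/(match_onto M)[x xL xE]|[x]].
    have /codomP[u uE] : x \in codom g by rewrite (core_codom G); apply: keep_out.
    rewrite uE in xL xE; exists u; first by rewrite nsE.
    by apply: (core_inj G'); rewrite hE.
  by rewrite nsE => xL <-; rewrite hE //; apply: match_out M _ xL.
- move=> u; rewrite nsE => uL; apply: (core_inj G').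
  rewrite (core_node G') hE ?(core_node G) ?(patch_stable P) // (match_node M) //.
  by rewrite hE.
- move=> u; rewrite !nsE => uL eL; apply: (core_inj G'); rewrite hE //.
  have [euL|euL] := boolP (e (g u) \in L).
    have [k [r [r' [kt Er Er' E E']]]] := edge_in u uL euL; rewrite E'.
    have := all_iota Carr kt; rewrite Er Er'; move: eL; rewrite E /spot.
    case: ltnP => rt; first by rewrite (nth_patch P).
    move=> eL /andP[rt' /eqP <-]; rewrite (ltnNge r') rt' /= (match_end M) //.
    have [_] := arrivalP P kt Er; by rewrite /spot_ok ltnNge rt.
  by rewrite edge_out // (match_edge M) // edge_out' hE // -?(match_edge M) //; apply: match_out M _ _.
- move=> x xes; rewrite nsE; have := nth_index x xes; move: xes; rewrite -index_mem.
  move: (index x es) => i ie <-; have := all_iota Cdep (_ : i < size b); rewrite -szes => /(_ ie).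
  case/and3P=> bt _; case Er: departure => [r|] // rt.
  have [a1 ok1] := departureP P bt Er.
  have -> : g (edge D1 (nth x es i)) = spot x0 e L t r.
    by apply: arrive_det (core_edge G _) _; rewrite esg.
  by move: ok1; rewrite /spot_ok /spot (ltnNge r) rt /= => kt; apply: (end_out P).
- by rewrite szes szes' szb.
- move=> u i; rewrite nsE => uL ie uE.
  have bi : nth 0 b i < tcard t /\ nth 0 b' i < tcard t'.
    by have := all_iota Cdep (_ : i < size b); rewrite -szes => /(_ ie)/and3P[].
  have eL : e (g u) \in L.
    apply: contraT => euL; have := edge_out u uL euL; rewrite uE esg // => E.
    by move: euL; rewrite -E (nth_patch P) //; case: bi.
  have [k [r [r' [kt Er Er' E E']]]] := edge_in u uL eL.
  apply: (core_inj G'); rewrite E' esg' //.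
  have := all_iota Carr kt; rewrite Er Er'; move: E; rewrite uE esg // /spot.
  have [bt bt'] := bi; have [_] := arrivalP P kt Er; rewrite /spot_ok.
  case: ltnP => rt ok; last first.
    by move=> E; have := end_out P ok; rewrite -E (nth_patch P).
  move=> /eqP; rewrite nth_uniq ?(patch_uniq P) ?(patch_size P) // => /eqP E.
  case/andP=> rt'; rewrite rt' -szes => /all_iota /(_ ie); rewrite E eqxx => /eqP ->.
  by [].
- move=> u; rewrite nsE => uL u4.
  have v1 : valency (node D) (g u) = valency (node D1) u := core_valency G u.
  have v2 : valency (node S) (g' (h u)) = valency (node S1) (h u) := core_valency G' _.
  have v3 := match_valency P M uL; rewrite -/n -/n' -hE // in v1 v2 v3.
  rewrite -(core_virt G u4) -(core_virt G') ?hE ?(match_virt M) //.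
    by rewrite -/n v1; apply/eqP.
  by rewrite /double_point -v2 v3 v1.
- exists (outer D1); rewrite nsE porbit_id; split=> //.
  rewrite (_ : h (outer D1) = outer S1) ?porbit_id //.
  by apply: (core_inj G'); rewrite hE // go'.
Qed.

End CoreReplaced.

(** The ends are paired as before, and the condition on [exit t2] forbids closed curves inside the
    disc. Replacing a dart inside by the end reached along it ([r]) turns paths of the old curve
    into paths of the new one. *)
Lemma same_ends_component (T : finType) (x0 : T) (n n2 e : {perm T}) L t t2 :
  involutive e -> valencies n -> valencies n2 ->
  patch x0 n e L t -> patch x0 n2 e L t2 -> tends t = tends t2 ->
  (forall x, x \notin L -> n2 x = n x) ->
  same_ends t t2 -> all (fun i => exit t2 i) (iota 0 (tcard t2)) ->
  ncomponents n e = 1 -> ncomponents n2 e = 1.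
Proof.
move=> eK V V2 P P2 Et N /andP[_ Ce] Cx c1.
have con := elimT (one_componentP eK x0 V) (introT eqP c1).
apply/eqP/(one_componentP eK x0 V2).
have S2 := strand_sym eK V2.
set C2 := connect (strand n2 e) in S2 *.
have Esz : tcard t2 = tcard t by rewrite -(patch_size P2) (patch_size P).
have Een k : en t2 k = en t k by rewrite /en Et.
have conx i k : i < tcard t2 -> exit t2 i = Some k -> C2 (nth x0 L i) (nth x0 L (en t k)).
  by move=> it E; rewrite -Een; apply: (exit_connect P2 V2 it E).
have out x : x \notin L -> across n2 x = across n x.
  move=> xL; have VE := valency_off P N xL.
  by rewrite /across VE !N ?(patch_stable P).
have Hexit i : i < tcard t -> exists k k', [/\ exit t i = Some k,
    exit t (straight t i) = Some k', C2 (nth x0 L (en t k)) (nth x0 L (en t k'))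
    & ed t i < tcard t -> exit t (straight t (ed t i)) = Some k].
  move=> it; have := all_iota Ce it; case Ek: (exit t i) => [k|] //.
  case: (exit t (straight t i)) => // k' /andP[/eqP E /implyP H]; exists k, k'.
  split=> // [|/H/eqP //]; rewrite Een in E.
  have [kt _] := en_lt P (exit_lt P it Ek); rewrite -Esz in kt.
  apply: connect_trans (conx _ _ (straight_lt P2 kt) E); apply: connect1.
  by rewrite /strand /= -(acrossE P2) // eqxx orbT.
pose r x := if x \in L then nth x0 L (en t (odflt 0 (exit t (index x L)))) else x.
have r_in i k : i < tcard t -> exit t i = Some k -> r (nth x0 L i) = nth x0 L (en t k).
  by move=> it E; rewrite /r (nth_patch P) // (index_patch P) // E.
have r_out x : x \notin L -> r x = x by rewrite /r => /negPf->.
have exit_end k : k < size (tends t) -> exit t (en t k) = Some k.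
  move=> kt; have [_ E] := en_lt P kt; rewrite /exit.
  by have /(_ (tcard t)) : forall f, leave t f (en t k) = Some k
    by case=> [|f] /=; rewrite E ltnNge leq_addr /= addKn.
have r_end k : k < size (tends t) -> r (nth x0 L (en t k)) = nth x0 L (en t k).
  by move=> kt; have [lt _] := en_lt P kt; rewrite (r_in _ k) ?exit_end.
have conr x y : connect (strand n e) x y -> C2 (r x) (r y).
  case/connectP=> p; elim: p x => [|z p IH] x /=; first by move=> _ ->; apply: connect0.
  case/andP=> xz /IH{}IH /IH; apply: connect_trans.
  have eK2 w : C2 w (e w) by apply: connect1; rewrite /strand /= eqxx.
  have [/(patchP P)[i it xE]|xL] := boolP (x \in L).
    have [k [k' [Ek Ek' kk' H]]] := Hexit i it.
    rewrite xE in xz *; rewrite (r_in _ _ it Ek); case/orP: xz => /eqP ->; last first.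
      by rewrite (acrossE P) // (r_in _ _ (straight_lt P it) Ek').
    have [lt|le] := ltnP (ed t i) (tcard t).
      rewrite (patch_edge P) //; have [l [l' [El El' ll' _]]] := Hexit _ lt.
      by rewrite (r_in _ _ lt El) S2; move: El'; rewrite (H lt) => -[->].
    rewrite r_out ?(patch_out P) // -{1}(ed_out P it le).2.
    have kt := (ed_out P it le).1.
    by move: Ek; rewrite -{1}(ed_out P it le).2 exit_end // => -[<-].
  rewrite r_out //; case/orP: xz => /eqP ->.
    have [exL|exL] := boolP (e x \in L); last by rewrite r_out.
    by have [k kt ek] := end_edge P eK xL exL; rewrite ek r_end // -ek.
  rewrite r_out; first by apply: connect1; rewrite /strand /= out // eqxx orbT.
  by rewrite /across; case: ifP => _; rewrite ?(patch_stable P).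
have to_r x : exists2 y, C2 x y & r y = y.
  have [/(patchP P2)[i it ->]|xL] := boolP (x \in L); last first.
    by exists x; [apply: connect0 | apply: r_out].
  have := all_iota Cx it; case E: (exit t2 i) => [k|] // _.
  exists (nth x0 L (en t k)); first exact: conx.
  by rewrite r_end // Et; apply: (exit_lt P2 it E).
move=> x y; have [x' xx' rx] := to_r x; have [y' yy' ry] := to_r y.
apply: connect_trans xx' _; rewrite S2; apply: connect_trans yy' _; rewrite S2.
by rewrite -rx -ry; apply: conr.
Qed.

(** * The pictures of the moves *)

(* The darts are numbered from 0 in the order of their nodes in the records
   [kink_removal], [bigon_removal] and [triangle_move], counterclockwise from the
   named dart of each node. *)
Definition kink_table := Table 4 [:: 1; 2; 3; 0] [:: 4; 2; 1; 5] [:: 0; 3].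

Definition arc_table := Table 2 [:: 1; 0] [:: 2; 3] [:: 0; 1].

Definition bigon_table := Table 8 [:: 1; 2; 3; 0; 5; 6; 7; 4]
  [:: 4; 8; 9; 5; 0; 3; 10; 11] [:: 1; 2; 6; 7].

Definition arcs_table := Table 4 [:: 1; 0; 3; 2] [:: 5; 6; 4; 7] [:: 2; 0; 1; 3].

Definition triangle_table := Table 12 [:: 1; 2; 3; 0; 5; 6; 7; 4; 9; 10; 11; 8]
  [:: 9; 6; 15; 16; 13; 14; 1; 8; 7; 0; 17; 12] [:: 11; 4; 5; 2; 3; 10].

Definition triangle_table' := Table 12 [:: 1; 2; 3; 0; 5; 6; 7; 4; 9; 10; 11; 8]
  [:: 12; 13; 11; 4; 3; 10; 16; 17; 14; 15; 5; 2] [:: 0; 1; 8; 9; 6; 7].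

Definition darts4 (T : finType) (n : {perm T}) d := [:: d; n d; n (n d); n (n (n d))].

Section Patches.

Variables (T : finType) (n e : {perm T}).
Hypothesis eK : involutive e.

Lemma darts4_mem d x : valency n d = 4 -> (x \in darts4 n d) = (x \in porbit n d).
Proof. by move=> v4; have [_ _ ->] := porbit4 v4. Qed.

Lemma porbit_disjoint a b x : b \notin porbit n a -> x \in porbit n b -> x \notin porbit n a.
Proof.
by move=> ab xb; apply: contraNN ab => xa; rewrite -(same_porbit xa) (same_porbit xb) porbit_id.
Qed.

Lemma uniq_darts4 d : valency n d = 4 -> uniq (darts4 n d).
Proof. by case/porbit4. Qed.

Lemma uniq_cat_darts4 d (s : seq T) : valency n d = 4 -> uniq s ->
  (forall x, x \in s -> x \notin porbit n d) -> uniq (darts4 n d ++ s).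
Proof.
move=> v4 us sd; rewrite cat_uniq uniq_darts4 //= us andbT.
by apply/hasPn => x /sd; rewrite -darts4_mem.
Qed.

Lemma kink_patch a : valency n a = 4 -> e (n a) = n (n a) ->
  e a \notin porbit n a -> e (n (n (n a))) \notin porbit n a ->
  patch a n e (darts4 n a) kink_table.
Proof.
move=> v4 loop e0 e3; have [n4 U _] := porbit4 v4; have loop' := canRL eK loop.
split=> // -[|[|[|[|i]]]] //= _ _; rewrite ?darts4_mem //.
Qed.

Lemma arc_patch b : valency n b = 2 -> e b \notin porbit n b -> e (n b) \notin porbit n b ->
  patch b n e [:: b; n b] arc_table.
Proof.
move=> v2 e0 e1; have [nn nb B] := valency2 v2.
have mem x : (x \in [:: b; n b]) = (x \in porbit n b) by rewrite B !inE.
split=> //.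
- by rewrite /= inE eq_sym nb.
- by case=> [|[|i]].
- by case=> [|[|i]].
- by case=> [|[|i]] //= _ _; rewrite mem.
Qed.

Lemma bigon_patch a b (L := darts4 n a ++ darts4 n b) :
  valency n a = 4 -> valency n b = 4 -> b \notin porbit n a ->
  e a = b -> e (n (n (n a))) = n b ->
  (forall x, x \in [:: n a; n (n a); n (n b); n (n (n b))] -> e x \notin L) ->
  patch a n e L bigon_table.
Proof.
move=> va vb ab eab eab' out; have [na _ _] := porbit4 va; have [nb _ _] := porbit4 vb.
have eba := canRL eK eab; have eba' := canRL eK eab'.
split=> //.
- apply: uniq_cat_darts4; rewrite ?uniq_darts4 // => x; rewrite darts4_mem //.
  exact: porbit_disjoint.
- by do 8?[case=> [|]].
- by do 8?[case=> [|]].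
- by do 8?[case=> [|]] => //= *; apply: out; rewrite !inE eqxx ?orbT.
Qed.

Lemma arcs_patch p q (L := [:: p; n p; q; n q]) :
  valency n p = 2 -> valency n q = 2 -> q \notin porbit n p ->
  (forall x, x \in L -> e x \notin L) ->
  patch p n e L arcs_table.
Proof.
move=> vp vq pq out; have [pp np P] := valency2 vp; have [qq nq Q] := valency2 vq.
split=> //.
- have [qp nqp] : q \notin porbit n p /\ n q \notin porbit n p by rewrite porbit_stable.
  move: qp nqp; rewrite !P !negb_or => /andP[qp qnp] /andP[nqp nqnp].
  by rewrite /= !inE !negb_or ![_ == q]eq_sym ![_ == n q]eq_sym [p == n p]eq_sym qp nqp qnp nqnp nq np.
- by do 4?[case=> [|]].
- by do 4?[case=> [|]].
- by do 4?[case=> [|]] => //= *; apply: out; rewrite !inE eqxx ?orbT.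
Qed.

Lemma triangle_patch x y z (L := darts4 n x ++ darts4 n y ++ darts4 n z) :
  valency n x = 4 -> valency n y = 4 -> valency n z = 4 ->
  y \notin porbit n x -> z \notin porbit n y -> x \notin porbit n z ->
  uniq L /\ (forall i, i < 12 -> n (nth x L i) = nth x L (nd triangle_table i)).
Proof.
move=> vx vy vz xy yz zx; have [nx _ _] := porbit4 vx; have [ny _ _] := porbit4 vy.
have [nz _ _] := porbit4 vz; split; last by do 12?[case=> [|]].
apply: uniq_cat_darts4 => // [|w].
  apply: uniq_cat_darts4; rewrite ?uniq_darts4 // => w; rewrite darts4_mem //.
  exact: porbit_disjoint.
rewrite mem_cat !darts4_mem // => /orP[]; apply: porbit_disjoint => //.
by rewrite porbit_sym.
Qed.

End Patches.

Lemma kink_patches v D D' (h : dart D -> dart D') a b : kink_removal v h a b ->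
  [/\ patch a (node D) (edge D) (darts4 (node D) a) kink_table,
      patch b (node D') (edge D') [:: b; node D' b] arc_table,
      forall x, inside [:: a] x = (x \in darts4 (node D) a)
    & forall x, inside [:: b] x = (x \in [:: b; node D' b])].
Proof.
case=> /eqP a4 _ loop /eqP b2 R; cbv zeta in R.
have insD x : inside [:: a] x = (x \in porbit (node D) a) by rewrite /inside /= orbF.
have insD' x : inside [:: b] x = (x \in porbit (node D') b) by rewrite /inside /= orbF.
have [n4 _ _] := porbit4 a4; have [nn _ B] := valency2 b2.
have out k : k < 2 -> edge D' (nth b [:: b; node D' b] k) \notin porbit (node D') b.
  move=> k2; have := rep_boundary R (mem_nth a (k2 : k < size [:: a; node D (node D (node D a))])).
  set d := edge D _ => dout; have := rep_ends R dout k2; rewrite (edgeK (curveP D)).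
  rewrite (set_nth_default d) // => /(_ erefl)/(canRL (edgeK (curveP D'))).
  rewrite (set_nth_default b) // => <-; rewrite -insD'.
  by apply/(rep_onto R); exists d.
split.
- apply: (kink_patch (edgeK (curveP D)) a4 loop); rewrite -insD.
    by apply: (rep_boundary R); rewrite !inE eqxx.
  by apply: (rep_boundary R); rewrite !inE eqxx orbT.
- by apply: arc_patch b2 (out 0 _) (out 1 _).
- by move=> x; rewrite insD darts4_mem.
- by move=> x; rewrite insD' B !inE.
Qed.

Lemma replaced_match D D' (h : dart D -> dart D') ns es ns' es' L L' :
  replaced h ns es ns' es' ->
  (forall x, inside ns x = (x \in L)) -> (forall x, inside ns' x = (x \in L')) ->
  outside_match (node D) (edge D) (@virt D) (node D') (edge D') (@virt D') h L L' es es'.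
Proof.
move=> R insD insD'; split.
- have out u : u \in [predC L] -> u \in [predC inside ns].
    by rewrite inE /= -insD.
  by move=> x y /out xL /out yL; apply: (rep_inj R).
- move=> y; rewrite -insD'; split=> [/(rep_onto R)[x xL xE]|[x xL xE]].
    by exists x; rewrite -?insD.
  by apply/(rep_onto R); exists x; rewrite ?insD.
- by move=> x; rewrite -insD; apply: (rep_node R).
- by move=> x; rewrite -!insD; apply: (rep_edge R).
- split=> [|x0 x0' k kes]; first exact: (rep_size R).
  have := rep_boundary R (mem_nth x0 kes); set d := edge D _ => dout.
  have := rep_ends R dout kes; rewrite (edgeK (curveP D)) (set_nth_default x0) //.
  move=> /(_ erefl)/(canRL (edgeK (curveP D'))) ->.
  by rewrite (set_nth_default x0') // -(rep_size R).
- by move=> x; rewrite -insD => xL x4; apply: (rep_virt R xL); apply/eqP.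
Qed.

(** For the second disc this comes from [rep_ends], which makes the edge of each end lead to a dart
    outside. *)
Lemma replaced_boundary D D' (h : dart D -> dart D') ns es ns' es' :
  replaced h ns es ns' es' ->
  (forall x, x \in es -> ~~ inside ns (edge D x)) /\
  (forall y, y \in es' -> ~~ inside ns' (edge D' y)).
Proof.
move=> R; split; first exact: rep_boundary R.
move=> y yes; have := nth_index y yes; move: yes; rewrite -index_mem -(rep_size R).
move: (index y es') => k kes <-; have [d0 _] := rep_outer R.
have := rep_boundary R (mem_nth d0 kes); set d := edge D _ => dout.
have := rep_ends R dout kes; rewrite (edgeK (curveP D)) (set_nth_default d0) //.
move=> /(_ erefl)/(canRL (edgeK (curveP D'))).
rewrite (set_nth_default y) -?(rep_size R) // => <-.
by apply/(rep_onto R); exists d.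
Qed.

Lemma inside2 (D : flat_diagram) (a b x : dart D) :
  inside [:: a; b] x = (x \in porbit (node D) a) || (x \in porbit (node D) b).
Proof. by rewrite /inside /= orbF. Qed.

Lemma inside3 (D : flat_diagram) (a b c x : dart D) :
  inside [:: a; b; c] x = [|| x \in porbit (node D) a, x \in porbit (node D) b
                           | x \in porbit (node D) c].
Proof. by rewrite /inside /= orbF. Qed.

Lemma bigon_patches v D D' (h : dart D -> dart D') a b p q :
  bigon_removal v h a b p q ->
  [/\ patch a (node D) (edge D) (darts4 (node D) a ++ darts4 (node D) b) bigon_table,
      patch p (node D') (edge D') [:: p; node D' p; q; node D' q] arcs_table,
      forall x, inside [:: a; b] x = (x \in darts4 (node D) a ++ darts4 (node D) b)
    & forall x, inside [:: p; q] x = (x \in [:: p; node D' p; q; node D' q])].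
Proof.
case=> /eqP a4 /eqP b4 ab _ _ up lo /eqP p2 /eqP q2 pq R; cbv zeta in R, lo.
have insD x : inside [:: a; b] x = (x \in darts4 (node D) a ++ darts4 (node D) b).
  by rewrite mem_cat !darts4_mem // inside2.
have [pp _ P] := valency2 p2; have [qq _ Q] := valency2 q2.
have insD' x : inside [:: p; q] x = (x \in [:: p; node D' p; q; node D' q]).
  by rewrite inside2 P Q !inE -!orbA.
have [out out'] := replaced_boundary R; split=> //.
  by apply: (bigon_patch (edgeK (curveP D))) => // x xL; rewrite -insD out.
apply: arcs_patch => // x xL; rewrite -insD' out' //; move: xL; rewrite !inE.
by case/or4P=> ->; rewrite ?orbT.
Qed.

Lemma triangle_patches vx vy vz D D' (h : dart D -> dart D') x y z x' y' z' :
  triangle_move vx vy vz h x y z x' y' z' ->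
  let L := darts4 (node D) x ++ darts4 (node D) y ++ darts4 (node D) z in
  let L' := darts4 (node D') x' ++ darts4 (node D') y' ++ darts4 (node D') z' in
  [/\ patch x (node D) (edge D) L triangle_table,
      patch x' (node D') (edge D') L' triangle_table',
      forall w, inside [:: x; y; z] w = (w \in L)
    & forall w, inside [:: x'; y'; z'] w = (w \in L')].
Proof.
case=> -[/eqP x4 /eqP y4 /eqP z4] [xy yz zx] _ [E1 E2 E3] [/eqP x4' /eqP y4' /eqP z4'].
case=> xy' yz' zx' _ [E1' E2' E3'] R L L'; cbv zeta in R, E1, E2, E3, E1', E2', E3'.
have insD w : inside [:: x; y; z] w = (w \in L).
  by rewrite !mem_cat !darts4_mem // inside3.
have insD' w : inside [:: x'; y'; z'] w = (w \in L').
  by rewrite !mem_cat !darts4_mem // inside3.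
have [out out'] := replaced_boundary R.
have eK := edgeK (curveP D); have eK' := edgeK (curveP D').
have [U N] := triangle_patch x4 y4 z4 xy yz zx.
have [U' N'] := triangle_patch x4' y4' z4' xy' yz' zx'.
split=> //; split=> //.
- have F1 := canRL eK E1; have F2 := canRL eK E2; have F3 := canRL eK E3.
  by do 12?[case=> [|]].
- by do 12?[case=> [|]] => //= *; rewrite -insD out // !inE eqxx ?orbT.
- have F1 := canRL eK' E1'; have F2 := canRL eK' E2'; have F3 := canRL eK' E3'.
  by do 12?[case=> [|]].
- by do 12?[case=> [|]] => //= *; rewrite -insD' out' // !inE eqxx ?orbT.
Qed.

Lemma curve_orientation (T : finType) (n e : {perm T}) (x0 : T) : plane_curve n e ->
  exists O, orientation e n O.
Proof.
case=> V eK e_neq c1 _; have con := elimT (one_componentP eK x0 V) (introT eqP c1).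
by exists (mem (porbit (travel eK V) x0)); apply: orientation_class.
Qed.

(** Besides agreeing outside, the two orientations agree on darts inside along which the curve
    leaves by the same end; this compares the 0-smoothings of corresponding crossings of the two
    discs. *)
Lemma same_ends_orientation D D' x0 x0' (h : dart D -> dart D') L L' t t' :
  patch x0 (node D) (edge D) L t -> patch x0' (node D') (edge D') L' t' ->
  outside_match (node D) (edge D) (@virt D) (node D') (edge D') (@virt D') h L L'
    [seq nth x0 L i | i <- tends t] [seq nth x0' L' i | i <- tends t'] ->
  same_ends t t' ->
  exists O O', [/\ orientation (edge D) (node D) O, orientation (edge D') (node D') O',
    forall x, x \notin L -> O x = O' (h x)
  & forall i i' k, i < tcard t -> i' < tcard t' -> exit t i = Some k ->
      exit t' i' = Some k -> O (nth x0 L i) = O' (nth x0' L' i')].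
Proof.
move=> P P' M C; have [O' oO'] := curve_orientation x0' (curveP D').
have V := valencyE (curveP D); have V' := valencyE (curveP D').
exists (pullback x0' h L L' t t' O'), O'; split=> //.
- by have := pullback_orientation P P' M (edgeK (curveP D)) V V' C oO'.
- by move=> x; apply: pullback_out.
- move=> i i' k it it' E E'; rewrite (pullback_nth x0' h L' t' P O' it E).
  by rewrite (exit_orientation P' V' oO' it' E').
Qed.

(** By [zero_smoothingE] the choice of the resolution depends only on the orientation at [d] and
    [n d]. So [h] need not respect edges, some of which cross the boundary of the disc or are
    subdivided. *)
Lemma zero_smoothing_transfer (T T' : finType) (n e : {perm T}) (n' e' : {perm T'})
    (h : T -> T') (A : pred T) (O : pred T) (O' : pred T') (d x : T) :
  plane_curve n e -> plane_curve n' e' -> orientation e n O -> orientation e' n' O' ->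
  (forall y, A y -> A (n y)) -> {in A &, injective h} ->
  (forall y, A y -> h (n y) = n' (h y)) -> (forall y, A y -> O y = O' (h y)) ->
  valency n d = 4 -> A d -> A x ->
  h (zero_smoothing n e d x) = zero_smoothing n' e' (h d) (h x).
Proof.
case=> V eK e_neq c1 _ [V' eK' e_neq' c1' _] oO oO' An inj hn OE v4 Ad Ax.
have And := An d Ad.
have v4' : valency n' (h d) = 4.
  rewrite -v4; have Ad' y : y \in porbit n d -> A y.
    case/porbitP=> i ->; elim: i => [|i IH]; first by rewrite expg0 perm1.
    by rewrite expgSr permM An.
  by apply: valency_morph => [y z /Ad' Ay /Ad' Az|y /Ad' /hn //]; apply: inj.
have S y : A y -> valency n y = 4 -> h (smoothing n y x) = smoothing n' (h y) (h x).
  move=> Ay _; have Anx := An _ Ax; have Anny := An _ (An _ Ay).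
  rewrite /smoothing !permM -!hn ?An //.
  case: (tpermP y) => [->|->|yx nnyx]; rewrite ?tpermL ?tpermR //.
  by rewrite tpermD //; apply/eqP => /inj E; [case: yx|case: nnyx]; rewrite E.
rewrite (zero_smoothingE eK e_neq V v4 c1 oO) (zero_smoothingE eK' e_neq' V' v4' c1' oO').
rewrite -hn // -!OE //; case: ifP => _; rewrite S //.
by rewrite /valency porbit_next.
Qed.

(** * Moves away from the smoothed crossing *)

Section FlatIndex.

Variables (K : virtual_diagram) (c : real_crossing K).

Let S := flat_index c.

Lemma flat_index_node (x : dart K) : at_node (val c) x ->
  node S = zero_smoothing (node K) (edge K) x.
Proof.
move=> xc; have P := curveP K.
by rewrite (zero_smoothing_at_node (edgeK P) (edge_neq P) P (crossing_valency c) xc).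
Qed.

Lemma flat_index_out x : x \notin porbit (node K) (val c) ->
  porbit (node S) x = porbit (node K) x /\ node S x = node K x.
Proof. exact: zero_smoothing_out. Qed.

Lemma flat_index_face x y : y \in porbit (face (node K) (edge K)) x ->
  y \in porbit (face (node S) (edge S)) x.
Proof.
move=> yx; have P := curveP K.
by have := zero_smoothing_face_sub (edgeK P) (edge_neq P) P (crossing_valency c) yx.
Qed.

Lemma flat_index_double (x : dart K) : @double_point S x -> @double_point K x.
Proof. by move=> /eqP x4; have [v4 _] := zero_smoothing4 (c := c) x4; apply/eqP. Qed.

Lemma flat_index_virt (x : dart K) : @virt S x = @virt K x.
Proof. by []. Qed.

End FlatIndex.

Lemma flat_index_darts4 K (c : real_crossing K) (S := flat_index c) a :
  a \notin porbit (node K) (val c) ->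
  [/\ valency (node S) a = valency (node K) a, node S a = node K a,
      node S (node K a) = node K (node K a)
    & node S (node K (node K a)) = node K (node K (node K a))].
Proof.
move=> ac; rewrite /valency (flat_index_out ac).1.
by rewrite !(flat_index_out _).2 // !porbit_stable.
Qed.

Lemma inside_flat_index K (c : real_crossing K) (S := flat_index c) ns x :
  ~~ inside ns (val c) -> @inside S ns x = @inside K ns x.
Proof.
move/hasPn=> cout; apply: eq_in_has => a /cout; rewrite /at_node porbit_sym => ac.
by rewrite (flat_index_out ac).1.
Qed.

Section SmoothReplaced.

Variables (K K' : virtual_diagram) (h : dart K -> dart K').
Variables (ns es : seq (dart K)) (ns' es' : seq (dart K')).
Variables (c : real_crossing K) (c' : real_crossing K').
Hypothesis R : replaced h ns es ns' es'.
Hypothesis cout : ~~ inside ns (val c).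
Hypothesis cc' : at_node (h (val c)) (val c').

Lemma inside_stable (D : flat_diagram) (ms : seq (dart D)) x y :
  y \in porbit (node D) x -> inside ms y = inside ms x.
Proof.
by move=> yx; apply: eq_has => a; rewrite /at_node ![_ \in porbit _ a]porbit_sym (same_porbit yx).
Qed.

Lemma replaced_out : ~~ inside ns' (val c').
Proof. by rewrite (inside_stable _ cc'); apply/(rep_onto R); exists (val c). Qed.

Lemma smooth_replaced O O' :
  orientation (edge K) (node K) O -> orientation (edge K') (node K') O' ->
  (forall x, ~~ inside ns x -> O x = O' (h x)) ->
  @replaced (flat_index c) (flat_index c') h ns es ns' es'.
Proof.
move=> oO oO' OE; have [P P'] := (curveP K, curveP K').
have c4 := crossing_valency c; have c4' := crossing_valency c'.
have inE x : @inside (flat_index c) ns x = inside ns x by apply: inside_flat_index.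
have inE' x : @inside (flat_index c') ns' x = inside ns' x.
  by apply: inside_flat_index; apply: replaced_out.
have nodeS y : ~~ inside ns y -> ~~ inside ns (node K y).
  by rewrite (@inside_stable K ns y (node K y)) // porbit_stable porbit_id.
split.
- have out x : x \in [predC @inside (flat_index c) ns] -> x \in [predC inside ns].
    by move=> xo; have : ~~ inside ns x by rewrite -inE.
  by move=> x y /out xo /out yo; apply: (rep_inj R).
- move=> y; rewrite inE'; split=> [/(rep_onto R)[x xo <-]|[x xo <-]].
    by exists x; rewrite ?inE.
  by apply/(rep_onto R); exists x; rewrite -?inE.
- move=> x; rewrite inE => xo /=.
  rewrite (zero_smoothing_transfer P P' oO oO' (A := [predC inside ns])) //.
  + by rewrite (zero_smoothing_at_node (edgeK P') (edge_neq P') P' _ cc') // -c4' /valency (same_porbit cc').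
  + exact: rep_inj R.
  + exact: rep_node R.
- by move=> x; rewrite !inE; apply: (rep_edge R).
- by move=> x; rewrite inE; apply: (rep_boundary R).
- exact: rep_size R.
- by move=> x i; rewrite inE; apply: (rep_ends R).
- move=> x; rewrite inE !flat_index_virt => xo /flat_index_double.
  exact: (rep_virt R xo).
- have [x [xo xD xD']] := rep_outer R; exists x; split; first by rewrite inE.
    by have := flat_index_face c xD.
  by have := flat_index_face c' xD'.
Qed.

End SmoothReplaced.

Lemma patched_orientation D D' x0 x0' (h : dart D -> dart D') ns es ns' es' L L' t t' :
  patch x0 (node D) (edge D) L t -> patch x0' (node D') (edge D') L' t' ->
  (forall x, inside ns x = (x \in L)) -> (forall x, inside ns' x = (x \in L')) ->
  es = [seq nth x0 L i | i <- tends t] -> es' = [seq nth x0' L' i | i <- tends t'] ->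
  replaced h ns es ns' es' -> same_ends t t' ->
  exists O O', [/\ orientation (edge D) (node D) O, orientation (edge D') (node D') O'
    & forall x, ~~ inside ns x -> O x = O' (h x)].
Proof.
move=> P P' insD insD' -> -> R C.
have [O [O' [oO oO' OE _]]] := same_ends_orientation P P' (replaced_match R insD insD') C.
by exists O, O'; split=> // x; rewrite insD; apply: OE.
Qed.

Section FlatMoveSmooth.

Variables (K K' : virtual_diagram) (h : dart K -> dart K').
Variables (c : real_crossing K) (c' : real_crossing K').
Hypothesis cc' : at_node (h (val c)) (val c').

Lemma inside_out (D : flat_diagram) ns (a x : dart D) :
  ~~ inside ns x -> a \in ns -> a \notin porbit (node D) x.
Proof. by move/hasPn=> H /H; rewrite /at_node porbit_sym. Qed.

Lemma kink_removal_smooth v a b : ~~ inside [:: a] (val c) -> kink_removal v h a b ->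
  @kink_removal v (flat_index c) (flat_index c') h a b.
Proof.
move=> cout H; have [P P' insD insD'] := kink_patches H.
case: H => a4 av loop b2 R; cbv zeta in R.
have cout' := replaced_out R cout cc'.
have [v4 n0 n1 n2] := flat_index_darts4 (inside_out cout (mem_head _ _)).
have [v2 m0 m1 m2] := flat_index_darts4 (inside_out cout' (mem_head _ _)).
have [O [O' [oO oO' OE]]] := patched_orientation P P' insD insD' erefl erefl R isT.
split=> //; cbv zeta; rewrite ?n0 ?n1 ?n2 ?m0 ?m1 //.
- by rewrite /double_point v4.
- by rewrite /marked_point v2.
- exact: (smooth_replaced R cout cc' oO oO' OE).
Qed.

Lemma bigon_removal_smooth v a b p q : ~~ inside [:: a; b] (val c) ->
  bigon_removal v h a b p q ->
  @bigon_removal v (flat_index c) (flat_index c') h a b p q.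
Proof.
move=> cout H; have [P P' insD insD'] := bigon_patches H.
case: H => a4 b4 ab av bv up lo p2 q2 pq R; cbv zeta in R, lo.
have cout' := replaced_out R cout cc'.
have ac := inside_out cout (mem_head _ _); have pc := inside_out cout' (mem_head _ _).
have [va a0 a1 a2] := flat_index_darts4 ac.
have [vb b0 b1 b2] : [/\ _, _, _ & _] := flat_index_darts4 (inside_out cout (mem_last a [:: b])).
have [vp p0 p1 _] := flat_index_darts4 pc.
have [vq q0 q1 _] : [/\ _, _, _ & _] := flat_index_darts4 (inside_out cout' (mem_last p [:: q])).
have [O [O' [oO oO' OE]]] := patched_orientation P P' insD insD' erefl erefl R isT.
split=> //; cbv zeta; rewrite ?a0 ?a1 ?a2 ?b0 ?b1 ?b2 ?p0 ?q0 //.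
- by rewrite /double_point va.
- by rewrite /double_point vb.
- by rewrite /at_node (flat_index_out ac).1.
- by rewrite /marked_point vp.
- by rewrite /marked_point vq.
- by rewrite /at_node (flat_index_out pc).1.
- exact: (smooth_replaced R cout cc' oO oO' OE).
Qed.

Lemma triangle_move_smooth vx vy vz x y z x' y' z' : ~~ inside [:: x; y; z] (val c) ->
  triangle_move vx vy vz h x y z x' y' z' ->
  @triangle_move vx vy vz (flat_index c) (flat_index c') h x y z x' y' z'.
Proof.
move=> cout H; have [P P' insD insD'] := triangle_patches H.
case: H => -[x4 y4 z4] [xy yz zx] virt1 sides [x4' y4' z4'] [xy' yz' zx'] virt1' sides' R.
cbv zeta in R, sides, sides'; have cout' := replaced_out R cout cc'.
have xc : x \notin porbit (node K) (val c) by apply: inside_out cout _; rewrite !inE eqxx.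
have yc : y \notin porbit (node K) (val c) by apply: inside_out cout _; rewrite !inE eqxx orbT.
have zc : z \notin porbit (node K) (val c) by apply: inside_out cout _; rewrite !inE eqxx !orbT.
have xc' : x' \notin porbit (node K') (val c') by apply: inside_out cout' _; rewrite !inE eqxx.
have yc' : y' \notin porbit (node K') (val c') by apply: inside_out cout' _; rewrite !inE eqxx orbT.
have zc' : z' \notin porbit (node K') (val c') by apply: inside_out cout' _; rewrite !inE eqxx !orbT.
have [vx0 x0 x1 x2] := flat_index_darts4 xc.
have [vy0 y0 y1 y2] := flat_index_darts4 yc.
have [vz0 z0 z1 z2] := flat_index_darts4 zc.
have [vx0' x0' x1' x2'] := flat_index_darts4 xc'.
have [vy0' y0' y1' y2'] := flat_index_darts4 yc'.
have [vz0' z0' z1' z2'] := flat_index_darts4 zc'.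
have [O [O' [oO oO' OE]]] := patched_orientation P P' insD insD' erefl erefl R isT.
split=> //; cbv zeta; rewrite ?x0 ?x1 ?x2 ?y0 ?y1 ?y2 ?z0 ?z1 ?z2
  ?x0' ?x1' ?x2' ?y0' ?y1' ?y2' ?z0' ?z1' ?z2' //.
- by rewrite /double_point vx0 vy0 vz0.
- by rewrite /at_node (flat_index_out xc).1 (flat_index_out yc).1 (flat_index_out zc).1.
- by rewrite /double_point vx0' vy0' vz0'.
- by rewrite /at_node (flat_index_out xc').1 (flat_index_out yc').1 (flat_index_out zc').1.
- exact: (smooth_replaced R cout cc' oO oO' OE).
Qed.

Lemma flat_move_smooth ns : ~~ inside ns (val c) -> flat_move h ns ->
  @flat_move (flat_index c) (flat_index c') h ns.
Proof.
move=> cout H; case: H cout.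
- by move=> a b H cout; apply: FlatOmega1 (kink_removal_smooth cout H).
- by move=> a b H cout; apply: FlatOmega1' (kink_removal_smooth cout H).
- by move=> a b p q H cout; apply: FlatOmega2 (bigon_removal_smooth cout H).
- by move=> a b p q H cout; apply: FlatOmega2' (bigon_removal_smooth cout H).
- by move=> x y z x' y' z' H cout; apply: FlatOmega3 (triangle_move_smooth cout H).
- by move=> x y z x' y' z' H cout; apply: FlatOmega3' (triangle_move_smooth cout H).
- by move=> x y z x' y' z' H cout; apply: FlatOmega3v (triangle_move_smooth cout H).
Qed.

End FlatMoveSmooth.

Lemma generalized_move_flat (K K' : virtual_diagram) (h : dart K -> dart K') ns :
  generalized_move h ns -> flat_move h ns.
Proof.
case.
- by move=> a [[b H] _]; apply: FlatOmega1 H.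
- by move=> a [[b H] _]; apply: FlatOmega1' H.
- by move=> a b [[p [q H]] _ _]; apply: FlatOmega2 H.
- by move=> a b [[p [q H]] _]; apply: FlatOmega2' H.
- by move=> x y z x' y' z' [H _ _ _]; apply: FlatOmega3 H.
- by move=> x y z [[x' [y' [z' H]]] _]; apply: FlatOmega3' H.
- by move=> x y z x' [[y' [z' H]] _ _]; apply: FlatOmega3v H.
Qed.

Lemma virtual_equiv_flat K K' : virtual_equiv K K' -> flat_equiv (shadow K) (shadow K').
Proof.
elim=> {K K'} [K K' [h H]|K|K K' _|K K1 K' _ IH _].
- apply: rst_step; exists h; case: H => [[H _]|[ns H]]; first by left.
  by right; exists ns; apply: generalized_move_flat.
- exact: rst_refl.
- exact: rst_sym.
- exact: rst_trans.
Qed.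

Section IsotopySmooth.

Variables (K K' : virtual_diagram) (h : dart K -> dart K').
Variables (c : real_crossing K) (c' : real_crossing K').
Hypothesis cc' : at_node (h (val c)) (val c').

Let S := flat_index c.
Let S' := flat_index c'.

(** The hypothesis on [O'] stands for compatibility with edges: a subdivision does not commute with
    [edge] at [a], but orientations still change along the subdivided edge. *)
Lemma isotopy_node (x : dart K) : injective h ->
  (forall y, h (node K y) = node K' (h y)) ->
  (forall O', orientation (edge K') (node K') O' -> forall y, O' (h (edge K y)) = ~~ O' (h y)) ->
  h (node S x) = node S' (h x).
Proof.
move=> inj hn Oe'; have [P P'] := (curveP K, curveP K').
have [O' oO'] := curve_orientation (outer K') P'.
have oO : orientation (edge K) (node K) (O' \o h).
  split=> y /=; first exact: Oe'.
  have Vy : valency (node K') (h y) = valency (node K) y.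
    by apply: valency_morph => [u w _ _|u _]; [apply: inj | apply: hn].
  have [_ <-] := oO'; rewrite /across Vy.
  by case: ifP; rewrite !hn.
rewrite /= (zero_smoothing_transfer P P' oO oO' (A := predT)) //.
- rewrite (zero_smoothing_at_node (edgeK P') (edge_neq P') P' _ cc') //.
  by rewrite -(crossing_valency c') /valency (same_porbit cc').
- by move=> ? ? _ _; apply: inj.
- exact: crossing_valency.
Qed.

Lemma flat_isotopy_smooth : flat_isotopy h -> @flat_isotopy S S' h.
Proof.
have oS x : x \in porbit (face (node K') (edge K')) (outer K') ->
    x \in porbit (face (node S') (edge S')) (outer S').
  by move=> H; have := flat_index_face c' H.
case=> [[bij hn he hv ho]|[a [b [inj b2 cod hn he e1 e2 hv ho]]]].
  left; split.
  - exact: bij.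
  - move=> x; apply: isotopy_node => //; first exact: bij_inj.
    by move=> O' [Oe _] y; rewrite he.
  - exact: he.
  - by move=> x /flat_index_double; apply: hv.
  - exact: oS ho.
have hc : h (val c) \notin porbit (node K') b by rewrite -/(at_node b _) -cod codom_f.
have bc : b \notin porbit (node K') (val c') by rewrite (same_porbit cc') porbit_sym.
have [vb nb _ _] := flat_index_darts4 bc.
right; exists a, b; split.
- exact: inj.
- by rewrite /marked_point vb.
- by move=> x; rewrite cod /at_node (flat_index_out bc).1.
- move=> x; apply: isotopy_node => // O' [Oe Oa] y.
  have [|/he ->] := boolP (y \in [:: a; edge K a]); last by rewrite Oe.
  have Eb : O' (node K' b) = ~~ O' b.
    by rewrite -Oa /across [valency _ _ == 4](_ : _ = false) // (eqP b2).
  (* Two edges and one marked point lead from [h a] to [h (edge K a)]: three changes. *)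
  have E2 : O' (h (edge K a)) = ~~ O' (h a).
    by rewrite -[h (edge K a)](edgeK (curveP K')) e2 Oe Eb -e1 Oe !negbK.
  by rewrite !inE => /orP[]/eqP -> //; rewrite (edgeK (curveP K)) E2 negbK.
- exact: he.
- exact: e1.
- by rewrite nb; exact: e2.
- by move=> x /flat_index_double; apply: hv.
- exact: oS ho.
Qed.

End IsotopySmooth.

(** * Removal of kinks and bigons *)

Lemma smoothing4 (T : finType) (n : {perm T}) d x : valency n d = 4 ->
  valency (smoothing n d) x = 4 -> valency n x = 4 /\ smoothing n d x = n x.
Proof.
move=> d4; have [xd|xd] := boolP (x \in porbit n d).
  by rewrite /valency (smoothing_in d4 xd).
by rewrite /valency smoothing_out // smoothing_next.
Qed.

(** The hypotheses of [core_exists] on the kept darts, in a form decided by computation. *)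
Definition subtable_ok t (js : seq nat) :=
  [&& all (fun i => i < tcard t) js, all (fun i => nd t i \in js) js & marked_off t js].

Lemma core_table (D : flat_diagram) (x0 : dart D) L t js o :
  patch x0 (node D) (edge D) L t -> subtable_ok t js -> o \notin L ->
  o \in porbit (face (node D) (edge D)) (outer D) ->
  exists (D1 : flat_diagram) (g : dart D1 -> dart D), core (keep L js) g /\ g (outer D1) = o.
Proof.
move=> P /and3P[jt nj off] oL oo; apply: core_exists oo; first exact: keep_out.
  move=> x /(keepP x0 jt)[xL|[k kj ->]]; first exact/keep_out/(patch_stable P).
  have jk := mem_nth 0 kj.
  by rewrite (patch_node P) ?(allP jt) // (keep_nth P) ?(allP nj) // (nd_lt P) // (allP jt).
by move=> x /(marked_offP P off) v2; apply/eqP.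
Qed.

Section CoreTable.

Variables (D : flat_diagram) (x0 : dart D) (L : seq (dart D)) (t : table) (js : seq nat).
Hypothesis P : patch x0 (node D) (edge D) L t.
Hypothesis jst : all (fun i => i < tcard t) js.
Variables (D1 : flat_diagram) (g : dart D1 -> dart D).
Hypothesis G : core (keep L js) g.

Lemma core_nth i : i \in js -> exists u, g u = nth x0 L i.
Proof.
move=> ij; have /codomP[u ->] : nth x0 L i \in codom g; last by exists u.
by rewrite (core_codom G) (keep_nth P) // (allP jst).
Qed.

Lemma core_next u i : i < tcard t -> g u = nth x0 L i ->
  g (node D1 u) = nth x0 L (nd t i).
Proof. by move=> it gu; rewrite (core_node G) gu (patch_node P). Qed.

Lemma core_departure u i r : i < tcard t -> g u = nth x0 L i ->
  departure t js i = Some r -> g (edge D1 u) = spot x0 (edge D) L t r.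
Proof.
move=> it gu Er; have [a1 _] := departureP P it Er.
by apply: arrive_det (core_edge G u) _; rewrite gu.
Qed.

Lemma core_porbit u w : (w \in porbit (node D1) u) = (g w \in porbit (node D) (g u)).
Proof.
rewrite (@porbit_morph _ _ (node D) (node D1) g) => [|v _]; last exact: core_node G v.
by rewrite mem_imset //; apply: core_inj G.
Qed.

Lemma core_inside ns ids : map g ns = [seq nth x0 L i | i <- ids] ->
  all (fun i => i < tcard t) ids ->
  all (fun j => has (fun i => j \in traject (nd t) i 4) ids) js ->
  forall u, inside ns u = (g u \in L).
Proof.
move=> nsE idt jsE u.
have -> : inside ns u = has (fun i => g u \in porbit (node D) (nth x0 L i)) ids.
  rewrite -(has_map (nth x0 L) (fun x => g u \in porbit (node D) x)) -nsE has_map.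
  by apply: eq_has => a; rewrite /at_node core_porbit.
apply/hasP/idP => [[i ii]|gL]; first exact/(porbit_patch P)/(allP idt).
have : keep L js (g u) by rewrite -(core_codom G) codom_f.
rewrite /keep /= gL => /(allP jsE)/hasP[i ii].
move: gL; case/(patchP P) => j jt ->; rewrite (index_patch P) //.
case/trajectP=> k _ ->; exists i => //; have it := allP idt i ii.
have lt l : iter l (nd t) i < tcard t by elim: l => //= l; apply: nd_lt P _.
elim: k => [|k IH] /=; first exact: porbit_id.
by rewrite -(patch_node P) // porbit_stable; apply: IH.
Qed.

End CoreTable.

Lemma valency_marked (T : finType) (x0 : T) (n e : {perm T}) L t i :
  patch x0 n e L t -> i < tcard t -> nd t (nd t i) = i -> nd t i != i ->
  valency n (nth x0 L i) = 2.
Proof.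
move=> P it nn ni; apply/eqP/porbit2P; have ndt := nd_lt P it.
rewrite !(patch_node P) // nn; split=> //.
by rewrite nth_uniq ?(patch_size P) // (patch_uniq P).
Qed.

Lemma match_id (T : finType) (n n2 e : {perm T}) (v : pred T) L es :
  (forall x, x \notin L -> n2 x = n x) ->
  outside_match n e v n2 e v id L L es es.
Proof.
move=> N; split=> //.
- by move=> y; split=> [yL|[x xL <- //]]; exists y.
- by move=> x /N.
- by split=> // x0 x0' k ke; rewrite (set_nth_default x0).
Qed.

Definition quad t i := traject (nd t) i 4.

(* The loop of the crossing of [i] may contain marked points, which are deleted
   first. *)
Definition kink_ok t i (t2 := resolve t i) :=
  [&& i < tcard t, table_ok t2, nd t2 i == nd t i, nd t2 (nd t i) == i, nd t i != i,
      subtable_ok t (quad t i), subtable_ok t2 [:: i; nd t i],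
      departure t (quad t i) (nd t i) == Some (nd t (nd t i)),
      same_disc t (quad t i) [:: i; nd t (nd t (nd t i))] t2 [:: i; nd t i] [:: i; nd t i]
    & same_ends t t2 && all (fun i => exit t2 i : bool) (iota 0 (tcard t2))].

(** The loop joins [nd t i] to [nd t (nd t i)], so this smoothing makes it part of an arc with the
    same two ends. The cores of the two diagrams are the two sides of an Omega_1 or Omega_1' move.
    The outer dart is moved to [o], which both cores keep. *)
Lemma kink_equiv (D : flat_diagram) (x0 : dart D) L t i (d := nth x0 L i) o :
  patch x0 (node D) (edge D) L t -> kink_ok t i -> valency (node D) d = 4 ->
  o \notin L -> o \in porbit (face (node D) (edge D)) (outer D) ->
  exists P V, flat_equiv D (@FlatDiagram (dart D) (smoothing (node D) d) (edge D) (@virt D) o P V).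
Proof.
move=> P ok d4 oL oo; set t2 := resolve t i; set n := node D; set n2 := smoothing n d.
case/and5P: ok => it ok2 /eqP ndi /eqP ndni /and5P[ni qt st /eqP dep /andP[disc /andP[ends exits]]].
have PD := curveP D; have V := valencyE PD; have V2 := smoothing_valencies V d4.
have P2 : patch x0 n2 (edge D) L t2 by apply: resolve_patch.
have N2 x : x \notin L -> n2 x = n x by apply: (smoothing_off P it erefl).
have c1 := same_ends_component (edgeK PD) V V2 P P2 erefl N2 ends exits (one_component PD).
have C2 : plane_curve n2 (edge D) := smoothing_curve (edgeK PD) (edge_neq PD) PD d4 c1.
have W x : valency n2 x = 4 -> virt (n2 x) = virt x.
  by case/(smoothing4 d4) => x4 ->; apply: virt_node.
exists C2, W; set S := FlatDiagram _ _ _.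
have n1t := nd_lt P it; have n2t := nd_lt P n1t.
have [D1 [g [G go]]] := core_table P qt oL oo.
have [S1 [g' [G' go']]] := core_table (D := S) P2 st oL (porbit_id _ _).
have [/and3P[jt _ _] /and3P[jt' _ _]] := (qt, st).
have [a ga] := core_nth P jt G (mem_head i _).
have [b gb] := core_nth (D := S) P2 jt' G' (mem_head i _).
have ga1 := core_next P G it ga; have ga2 := core_next P G n1t ga1.
have ga3 := core_next P G n2t ga2; have gb1 := core_next (D := S) P2 G' it gb.
rewrite ndi in gb1.
have [||||||h R _] := core_replaced (D := D) (S := S) (h0 := id) P P2 (match_id _ _ _ N2) disc G G' _ _
  (ns := [:: a]) (es := [:: a; node D1 (node D1 (node D1 a))])
  (ns' := [:: b]) (es' := [:: b; node S1 b]).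
- by rewrite go.
- by rewrite go go'.
- apply: (core_inside P G (ids := [:: i])); rewrite /= ?ga ?it //.
  by rewrite /quad /= !inE !eqxx ?orbT.
- apply: (core_inside (D := S) P2 G' (ids := [:: i])); rewrite /= ?gb ?it //.
  by rewrite /= ndi ndni !inE !eqxx ?orbT.
- by rewrite /= ga ga3.
- by rewrite /= gb gb1.
have K : kink_removal (virt a) h a b.
  split=> //.
  - by rewrite /double_point -(core_valency G) ga [valency _ _]d4.
  - apply: (core_inj G); rewrite (core_departure P G n1t ga1 dep) ga2.
    by rewrite /spot n2t.
  - rewrite /marked_point -(core_valency G') gb (valency_marked P2) ?it //.
      by rewrite ndi ndni.
    by rewrite ndi.
apply: flat_equiv_trans (flat_equiv_sym (core_equivalent G)) _.
apply: flat_equiv_trans _ (core_equivalent G').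
apply: rst_step; exists h; right; exists [:: a]; move: K.
by case: (virt a) => K; [apply: FlatOmega1' K | apply: FlatOmega1 K].
Qed.

(* The smoothing of the crossings of [i] and [j] which pulls the two sides of the
   bigon apart has the same strands as the bigon, up to the deletion of marked
   points. *)
Definition bigon_ok t i j (t2 := resolve (resolve t i) (nd t j))
    (js := quad t i ++ quad t j) (i1 := nd t i) (i2 := nd t i1) (i3 := nd t i2) :=
  [&& (i < tcard t) && (j < tcard t), table_ok (resolve t i) && table_ok t2,
      subtable_ok t js && subtable_ok t2 (quad t i),
      (departure t js i == Some j) && (departure t js i3 == Some (nd t j)),
      [&& nd t2 i == i1, nd t2 i1 == i, nd t2 i2 == i3 & nd t2 i3 == i2], uniq (quad t i),
      all (fun l => has (fun k => l \in traject (nd t) k 4) [:: i; j]) js,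
      all (fun l => has (fun k => l \in traject (nd t2) k 4) [:: i2; i1]) (quad t i),
      same_disc t js [:: i1; i2; nd t (nd t j); nd t (nd t (nd t j))]
        t2 (quad t i) [:: i1; i2; i3; i]
    & same_ends t t2 && all (fun k => exit t2 k : bool) (iota 0 (tcard t2))].

(** Each of the two resulting arcs keeps its marked point at the former crossing of [d], to serve as
    [p] or [q], and loses the one at the crossing of [d']. The cores are the two sides of an Omega_2
    or Omega_2' move. *)
Lemma bigon_equiv (D : flat_diagram) (x0 : dart D) L t i j
    (d := nth x0 L i) (d' := nth x0 L j) o :
  patch x0 (node D) (edge D) L t -> bigon_ok t i j ->
  valency (node D) d = 4 -> valency (node D) d' = 4 -> d' \notin porbit (node D) d ->
  virt d = virt d' ->
  o \notin L -> o \in porbit (face (node D) (edge D)) (outer D) ->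
  exists P V, flat_equiv D (@FlatDiagram (dart D)
    (smoothing (smoothing (node D) d) (node D d')) (edge D) (@virt D) o P V).
Proof.
move=> P ok d4 d4' dd' vd oL oo; set n := node D; set n1 := smoothing n d; set n2 := smoothing _ _.
move: ok; rewrite /bigon_ok; set t1 := resolve t i; set t2 := resolve t1 _; set js := _ ++ _.
case/and5P=> /andP[it jt] /andP[ok1 ok2] /andP[st st2] /andP[/eqP dep /eqP dep'] /and5P[].
case/and4P=> /eqP q0 /eqP q1 /eqP q2 /eqP q3 uq in1 in2 /and3P[disc ends exits].
have i1t := nd_lt P it; have i2t := nd_lt P i1t; have i3t := nd_lt P i2t.
have j1t := nd_lt P jt; have j2t := nd_lt P j1t; have j3t := nd_lt P j2t.
have PD := curveP D; have V := valencyE PD; have V1 := smoothing_valencies V d4.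
have E1 : n d' = nth x0 L (nd t j) by rewrite /d' (patch_node P).
have ndd' : n d' \notin porbit n d by rewrite porbit_stable.
have d4'' : valency n1 (n d') = 4 by rewrite /valency smoothing_out // porbit_next.
have V2 := smoothing_valencies V1 d4''.
have P1 : patch x0 n1 (edge D) L t1 by apply: resolve_patch.
have P2 : patch x0 n2 (edge D) L t2 by apply: resolve_patch P1 j1t E1 ok2.
have N2 x : x \notin L -> n2 x = n x.
  by move=> xL; rewrite (smoothing_off P1 j1t E1) // (smoothing_off P it erefl).
have c1 := same_ends_component (edgeK PD) V V2 P P2 erefl N2 ends exits (one_component PD).
have C2 : plane_curve n2 (edge D) by apply: (smoothing2_curve (edgeK PD) (edge_neq PD)).
have W x : valency n2 x = 4 -> virt (n2 x) = virt x.
  case/(smoothing4 d4'') => + ->; case/(smoothing4 d4) => x4 ->; exact: virt_node.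
exists C2, W; set S := FlatDiagram _ _ _.
have [D1 [g [G go]]] := core_table P st oL oo.
have [S1 [g' [G' go']]] := core_table (D := S) P2 st2 oL (porbit_id _ _).
have [/and3P[jst _ _] /and3P[jst' _ _]] := (st, st2).
have [a ga] : exists u, g u = nth x0 L i.
  by apply: (core_nth P jst G); rewrite /js mem_cat mem_head.
have [b gb] : exists u, g u = nth x0 L j.
  by apply: (core_nth P jst G); rewrite /js mem_cat mem_head orbT.
have [q gq] : exists u, g' u = nth x0 L (nd t i).
  by apply: (core_nth (D := S) P2 jst' G'); rewrite !inE eqxx ?orbT.
have [p gp] : exists u, g' u = nth x0 L (nd t (nd t i)).
  by apply: (core_nth (D := S) P2 jst' G'); rewrite !inE eqxx ?orbT.
have ga1 := core_next P G it ga; have ga2 := core_next P G i1t ga1.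
have ga3 := core_next P G i2t ga2; have gb1 := core_next P G jt gb.
have gb2 := core_next P G j1t gb1; have gb3 := core_next P G j2t gb2.
have gp1 := core_next (D := S) P2 G' i2t gp; have gq1 := core_next (D := S) P2 G' i1t gq.
rewrite q2 in gp1; rewrite q1 in gq1.
have [||||||h R _] := core_replaced (D := D) (S := S) (h0 := id) P P2 (match_id _ _ _ N2) disc G G' _ _
  (ns := [:: a; b]) (es := [:: node D1 a; node D1 (node D1 a); node D1 (node D1 b); node D1 (node D1 (node D1 b))])
  (ns' := [:: p; q]) (es' := [:: q; p; node S1 p; node S1 q]).
- by rewrite go.
- by rewrite go go'.
- by apply: (core_inside P G (ids := [:: i; j])); rewrite /= ?ga ?gb ?it ?jt.
- by apply: (core_inside (D := S) P2 G' (ids := [:: nd t (nd t i); nd t i])); rewrite /= ?gp ?gq ?i1t ?i2t.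
- by rewrite /= ga1 ga2 gb2 gb3.
- by rewrite /= gp gq gp1 gq1.
move: uq; rewrite /= !inE !negb_or => /and4P[/and3P[i01 i02 i03] /andP[i12 i13] i23 _].
have p2 : valency n2 (nth x0 L (nd t (nd t i))) = 2.
  by rewrite (valency_marked P2) // ?q2 ?q3 // eq_sym.
have q2' : valency n2 (nth x0 L (nd t i)) = 2 by rewrite (valency_marked P2) // ?q1 ?q0.
have vab : virt b = virt a.
  rewrite -(core_virt G) ?gb; last by rewrite /double_point -(core_valency G) gb [valency _ _]d4'.
  rewrite -(core_virt G) ?ga; last by rewrite /double_point -(core_valency G) ga [valency _ _]d4.
  exact: esym.
have B : bigon_removal (virt a) h a b p q.
  split=> //; cbv zeta.
  - by rewrite /double_point -(core_valency G) ga [valency _ _]d4.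
  - by rewrite /double_point -(core_valency G) gb [valency _ _]d4'.
  - by rewrite /at_node (core_porbit G) ga gb.
  - by apply: (core_inj G); rewrite (core_departure P G it ga dep) gb /spot jt.
  - by apply: (core_inj G); rewrite (core_departure P G i3t ga3 dep') gb1 /spot j1t.
  - by rewrite /marked_point -(core_valency G') gp p2.
  - by rewrite /marked_point -(core_valency G') gq q2'.
  - rewrite /at_node (core_porbit G') gp gq; have [_ _ ->] := valency2 p2.
    have -> : n2 (nth x0 L (nd t (nd t i))) = nth x0 L (nd t (nd t (nd t i))).
      by rewrite (patch_node P2) // q2.
    have ne k l : k < tcard t -> l < tcard t -> k != l -> nth x0 L k != nth x0 L l.
      by move=> kt lt; rewrite nth_uniq ?(patch_size P) ?(patch_uniq P).
    by rewrite negb_or !ne.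
apply: flat_equiv_trans (flat_equiv_sym (core_equivalent G)) _.
apply: flat_equiv_trans _ (core_equivalent G').
apply: rst_step; exists h; right; exists [:: a; b]; move: B.
by case: (virt a) => B; [apply: FlatOmega2' B | apply: FlatOmega2 B].
Qed.

(** * Crossings involved in a move *)

Section FlatIndexTable.

Variables (K : virtual_diagram) (c : real_crossing K) (x0 : dart K) (L : seq (dart K)).
Variables (t : table) (i : nat) (O : pred (dart K)).
Hypothesis P : patch x0 (node K) (edge K) L t.
Hypothesis it : i < tcard t.
Hypothesis ic : at_node (nth x0 L i) (val c).
Hypothesis oO : orientation (edge K) (node K) O.

Lemma at_node_valency : valency (node K) (nth x0 L i) = 4.
Proof. by rewrite -(crossing_valency c) /valency (same_porbit ic). Qed.

(** The orientation selects one of two explicit tables; the moves below are settled by splitting on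
    this choice. *)
Lemma flat_index_patch j :
  j = (if O (nth x0 L (nd t i)) == O (nth x0 L i) then i else nd t i) ->
  table_ok (resolve t j) -> patch x0 (node (flat_index c)) (edge K) L (resolve t j).
Proof.
have C := curveP K; have it1 := nd_lt P it.
have -> : node (flat_index c) = zero_smoothing (node K) (edge K) (nth x0 L i).
  by apply: flat_index_node; rewrite /at_node porbit_sym.
rewrite (zero_smoothingE (edgeK C) (edge_neq C) (valencyE C) at_node_valency (one_component C) oO).
rewrite (patch_node P) //; case: ifP => _ -> ok; first exact: resolve_patch P it erefl ok.
exact: resolve_patch P it1 erefl ok.
Qed.

Lemma flat_index_off x : x \notin L -> node (flat_index c) x = node K x.
Proof.
move=> xL; apply: (flat_index_out _).2; apply: contraNN xL.
by rewrite (same_porbit ic); apply: (porbit_patch P it).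
Qed.

End FlatIndexTable.

Lemma match_off (T T' : finType) (x0 : T) (x0' : T') (n n1 e : {perm T}) (v : pred T)
    (n' n1' e' : {perm T'}) (v' : pred T') h L L' t t' es es' :
  patch x0 n e L t -> patch x0' n' e' L' t' ->
  outside_match n e v n' e' v' h L L' es es' ->
  (forall x, x \notin L -> n1 x = n x) -> (forall x, x \notin L' -> n1' x = n' x) ->
  outside_match n1 e v n1' e' v' h L L' es es'.
Proof.
move=> P P' M N N'; case: (M) => inj onto hn he ends hv; split=> //.
  by move=> x xL; rewrite N // N' ?hn //; apply/onto; exists x.
by move=> x xL; rewrite (valency_off P N xL); apply: hv.
Qed.

Lemma virt_next (D : flat_diagram) (d : dart D) v : double_point d -> virt d = v ->
  [/\ virt (node D d) = v, virt (node D (node D d)) = v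
    & virt (node D (node D (node D d))) = v].
Proof.
move=> /eqP d4 <-; have d4' : valency (node D) (node D d) = 4 by rewrite /valency porbit_next.
have d4'' : valency (node D) (node D (node D d)) = 4 by rewrite /valency porbit_next.
by rewrite !virt_node.
Qed.

Lemma index_kink (K K' : virtual_diagram) (h : dart K -> dart K') v a b
    (c : real_crossing K) :
  kink_removal v h a b -> at_node a (val c) -> flat_equiv (flat_index c) K'.
Proof.
move=> H ac; have [P P' insD insD'] := kink_patches H.
case: H => /eqP a4 _ loop _ R; cbv zeta in R.
have C := curveP K; have [O oO] := curve_orientation (outer K) C.
(* The loop leaves along one of two consecutive darts and returns along the other; this forces the
   resolution which opens it into an arc. *)
have Ona : O (node K a) = O a.
  have [Oe _] := oO; have := Oe (node K a); rewrite loop (orientation_opp a4 oO).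
  by move/negb_inj.
have PS := @flat_index_patch K c a _ _ 0 O P isT ac oO 0 _ isT.
rewrite /= Ona eqxx in PS; have {}PS := PS erefl.
have off := flat_index_off P (isT : 0 < 4) ac.
have M := match_off P P' (replaced_match R insD insD') off (fun x _ => erefl).
have [d [dout dD dD']] := rep_outer R.
(* No crossing is left in either disc, hence the empty lists of kept darts. *)
apply: (@same_core_equiv (flat_index c) K' a b h _ _ _ _ [::] [::] PS P' M isT _ d) => //.
- by rewrite -insD.
- by have := flat_index_face c dD.
Qed.

Lemma index_bigon (K K' : virtual_diagram) (h : dart K -> dart K') a b p q
    (c1 c2 : real_crossing K) :
  bigon_removal false h a b p q -> at_node a (val c1) -> at_node b (val c2) ->
  flat_equiv (flat_index c1) (flat_index c2).
Proof.
move=> H ac bc; have [P P' insD insD'] := bigon_patches H.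
case: H => a4 b4 ab av bv up lo _ _ _ R; cbv zeta in R, lo.
have C := curveP K; have [O oO] := curve_orientation (outer K) C; have [Oe Oa] := oO.
have [d [dout dD _]] := rep_outer R; rewrite insD in dout.
have [dS1 dS2] := (flat_index_face c1 dD, flat_index_face c2 dD).
have Ob : O b = ~~ O a by rewrite -up Oe.
have Onb : O (node K b) = O (node K a).
  have a4' : valency (node K) (node K a) = 4 by rewrite /valency porbit_next; apply/eqP.
  by rewrite -lo Oe (orientation_opp a4' oO) negbK.
have [va1 va2 va3] := virt_next a4 av; have [vb1 vb2 vb3] := virt_next b4 bv.
set L := _ ++ _ in P insD dout.
have off1 := flat_index_off P (isT : 0 < 8) ac; have off2 := flat_index_off P (isT : 4 < 8) bc.
have PS1 j := @flat_index_patch K c1 a L _ 0 O P isT ac oO j.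
have PS2 j := @flat_index_patch K c2 a L _ 4 O P isT bc oO j.
rewrite /= in PS1 PS2; rewrite Onb Ob in PS2.
have M0 := @match_id _ (node K) (node K) (edge K) (@virt K) L
  [seq nth a L i | i <- tends bigon_table] (fun x _ => erefl).
(* Equality means that the two strands run through the bigon in opposite directions. *)
case: (boolP (O (node K a) == O a)) PS1 PS2 => [/eqP ->|Oab] PS1 PS2.
  have {}PS1 := PS1 0 erefl isT.
  have {}PS2 : patch a (node (flat_index c2)) (edge K) L (resolve bigon_table 5).
    by apply: PS2 => //; case: (O a).
  have M := match_off P P M0 off1 off2.
  (* In the first picture the dart [b] (4) leads to NW, as [node K a] (1) does in the second; the
     other darts follow counterclockwise. *)
  apply: (@same_core_equiv (flat_index c1) (flat_index c2) a a id _ _ _ _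
    [:: 4; 5; 6; 7] [:: 1; 2; 3; 0] PS1 PS2 M isT _ d) => //.
  by do 4?[case=> [|]] => //= _; congruence.
have {}PS1 := PS1 1 erefl isT.
have {}PS2 : patch a (node (flat_index c2)) (edge K) L (resolve bigon_table 4).
  by apply: PS2 => //; move: Oab; case: (O a); case: (O (node K a)).
have bc1 : b \notin porbit (node K) (val c1) by rewrite (same_porbit ac).
have ac2 : a \notin porbit (node K) (val c2) by rewrite (same_porbit bc) porbit_sym.
have bS1 : valency (node (flat_index c1)) (node K (node K (node K b))) = 4.
  by rewrite /valency (flat_index_out _).1 ?porbit_stable // !porbit_next; apply/eqP.
have aS2 : valency (node (flat_index c2)) (node K (node K a)) = 4.
  by rewrite /valency (flat_index_out _).1 ?porbit_stable // !porbit_next; apply/eqP.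
(* For parallel strands the sides of the bigon form the loop of a kink at the other crossing: the
   loop has the darts 4 and 5 at [b], after 7, or 3 and 0 at [a], after 2. *)
have [Q1 [W1 E1]] := kink_equiv (D := flat_index c1) PS1 (isT : kink_ok (resolve bigon_table 1) 7) bS1 dout dS1.
have [Q2 [W2 E2]] := kink_equiv (D := flat_index c2) PS2 (isT : kink_ok (resolve bigon_table 4) 2) aS2 dout dS2.
apply: flat_equiv_trans E1 (flat_equiv_trans _ (flat_equiv_sym E2)).
have PT1 := resolve_patch (i := 7) PS1 isT erefl isT.
have PT2 := resolve_patch (i := 2) PS2 isT erefl isT.
have M : outside_match (smoothing (node (flat_index c1)) (nth a L 7)) (edge K) (@virt K)
  (smoothing (node (flat_index c2)) (nth a L 2)) (edge K) (@virt K) id L L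
  [seq nth a L i | i <- tends bigon_table] [seq nth a L i | i <- tends bigon_table].
  apply: (match_off P P M0) => x xL.
    by rewrite (smoothing_off (i := 7) PS1) // off1.
  by rewrite (smoothing_off (i := 2) PS2) // off2.
apply: (@same_core_equiv (FlatDiagram d Q1 W1) (FlatDiagram d Q2 W2) a a id _ _ _ _ [::] [::] PT1 PT2 M isT _ d) => //=;
  exact: porbit_id.
Qed.

(** Omega_3 and Omega_3^v share this form. The crossings [y] and [z] must be of one kind, since [z']
    may take the place of [y] and [y'] that of [z], and since an Omega_2 or Omega_2' may have to
    remove both. *)
Lemma index_triangle (K K' : virtual_diagram) (h : dart K -> dart K') vx v x y z x' y' z'
    (c : real_crossing K) (c' : real_crossing K') :
  triangle_move vx v v h x y z x' y' z' -> at_node x (val c) -> at_node x' (val c') ->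
  flat_equiv (flat_index c) (flat_index c').
Proof.
move=> H xc xc'; have [] := triangle_patches H.
set L := darts4 (node K) x ++ _; set L' := darts4 (node K') x' ++ _ => P P' insD insD'.
case: H => -[x4 y4 z4] [xy yz zx] [_ vy vz] _ [x4' y4' z4'] [xy' yz' zx'] [_ vy' vz'] _ R.
cbv zeta in R; have M0 := replaced_match R insD insD'.
have [d [dout dD dD']] := rep_outer R; rewrite insD in dout.
have dout' : h d \notin L' by apply: (match_onto M0 _).2; exists d.
have [dS dS'] := (flat_index_face c dD, flat_index_face c' dD').
have [O [O' [oO oO' _ OE]]] := same_ends_orientation P P' M0 isT.
have Ox : O x = O' x' by apply: (OE 0 0 _ isT isT erefl erefl).
have Onx : O (node K x) = O' (node K' x') by apply: (OE 1 1 _ isT isT erefl erefl).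
have off := flat_index_off P (isT : 0 < 12) xc; have off' := flat_index_off P' (isT : 0 < 12) xc'.
have PS j := @flat_index_patch K c x L _ 0 O P isT xc oO j.
have PS' j := @flat_index_patch K' c' x' L' _ 0 O' P' isT xc' oO' j.
rewrite /= in PS PS'; rewrite -Ox -Onx in PS'.
have M := match_off P P' M0 off off'.
have [vy1 vy2 vy3] := virt_next y4 vy; have [vz1 vz2 vz3] := virt_next z4 vz.
have [vy1' vy2' vy3'] := virt_next y4' vy'; have [vz1' vz2' vz3'] := virt_next z4' vz'.
case: ifP PS PS' => _ PS PS'; last first.
  have {}PS := PS 1 erefl isT; have {}PS' := PS' 1 erefl isT.
  (* [l2] crosses two disjoint arcs, at [y] and [z] before the move and at [z'] and
     [y'] after it. *)
  have kept k : k < 8 -> virt (nth x' L' (nth 0 [:: 11; 8; 9; 10; 5; 6; 7; 4] k)) =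
      virt (nth x L (nth 0 [:: 4; 5; 6; 7; 8; 9; 10; 11] k)).
    by move: k; do 8?[case=> [|]] => //= _;
      rewrite ?vy ?vy1 ?vy2 ?vy3 ?vz ?vz1 ?vz2 ?vz3 ?vy' ?vy1' ?vy2' ?vy3' ?vz' ?vz1' ?vz2' ?vz3'.
  apply: (@same_core_equiv (flat_index c) (flat_index c') x x' h _ _ _ _
    [:: 4; 5; 6; 7; 8; 9; 10; 11] [:: 11; 8; 9; 10; 5; 6; 7; 4] PS PS' M isT kept d) => //.
(* The triangle lies between the darts 0 and 1 of [x] before the move and between 2 and 3 of [x']
   after it. Both pairs are joined here, so the triangle becomes a bigon with one side on [l2]. *)
have {}PS := PS 0 erefl isT; have {}PS' := PS' 0 erefl isT.
have yc : y \notin porbit (node K) (val c) by rewrite (same_porbit xc).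
have zc : z \notin porbit (node K) (val c) by rewrite (same_porbit xc) porbit_sym.
have yc' : y' \notin porbit (node K') (val c') by rewrite (same_porbit xc').
have zc' : z' \notin porbit (node K') (val c') by rewrite (same_porbit xc') porbit_sym.
have z4S : valency (node (flat_index c)) (node K z) = 4.
  by rewrite /valency (flat_index_out _).1 ?porbit_stable // !porbit_next; apply/eqP.
have y4S : valency (node (flat_index c)) (node K (node K y)) = 4.
  by rewrite /valency (flat_index_out _).1 ?porbit_stable // !porbit_next; apply/eqP.
have zyS : node K (node K y) \notin porbit (node (flat_index c)) (node K z).
  by rewrite (flat_index_out _).1 ?porbit_stable // !porbit_next porbit_sym.
have z4S' : valency (node (flat_index c')) (node K' (node K' (node K' z'))) = 4.
  by rewrite /valency (flat_index_out _).1 ?porbit_stable // !porbit_next; apply/eqP.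
have y4S' : valency (node (flat_index c')) y' = 4.
  by rewrite /valency (flat_index_out _).1 //; apply/eqP.
have zyS' : y' \notin porbit (node (flat_index c')) (node K' (node K' (node K' z'))).
  by rewrite (flat_index_out _).1 ?porbit_stable // !porbit_next porbit_sym.
(* The side of the bigon through the former [x] runs from 9, that is [node K z], to 6, that is
   [node K (node K y)]; in the second diagram the one through [x'] runs from 11, at [z'], to 4,
   which is [y']. *)
have [Q [W E]] := bigon_equiv (D := flat_index c) PS
  (isT : bigon_ok (resolve triangle_table 0) 9 6) z4S y4S zyS (etrans vz1 (esym vy2)) dout dS.
have [Q' [W' E']] := bigon_equiv (D := flat_index c') PS'
  (isT : bigon_ok (resolve triangle_table' 0) 11 4) z4S' y4S' zyS' (etrans vz3' (esym vy')) dout' dS'.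
apply: flat_equiv_trans E (flat_equiv_trans _ (flat_equiv_sym E')).
have PT1 := resolve_patch (i := 9) PS isT erefl isT.
have PT := resolve_patch (i := 7) PT1 isT (patch_node PS (isT : 6 < 12)) isT.
have PT1' := resolve_patch (i := 11) PS' isT erefl isT.
have PT' := resolve_patch (i := 5) PT1' isT (patch_node PS' (isT : 4 < 12)) isT.
set n2 := smoothing _ _ in PT; set n2' := smoothing _ _ in PT'.
have N2 w : w \notin L -> n2 w = node K w.
  move=> wL; rewrite -off // -(smoothing_off (i := 9) PS isT erefl wL).
  exact: (smoothing_off PT1 (isT : 7 < 12) (patch_node PS (isT : 6 < 12)) wL).
have N2' w : w \notin L' -> n2' w = node K' w.
  move=> wL; rewrite -off' // -(smoothing_off (i := 11) PS' isT erefl wL).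
  exact: (smoothing_off PT1' (isT : 5 < 12) (patch_node PS' (isT : 4 < 12)) wL).
have MT := match_off P P' M0 N2 N2'.
(* Both discs now contain three disjoint arcs, from E_0 to E_1, E_2 to E_5 and E_3 to E_4. *)
apply: (@same_core_equiv (FlatDiagram d Q W) (FlatDiagram (h d) Q' W') x x' h _ _ _ _
  [::] [::] PT PT' MT isT _ d) => //=; exact: porbit_id.
Qed.

(* The symmetry of the triangle move which maps the end [E_i] to [E_(i+2)]. *)
Lemma triangle_move_rot D D' (h : dart D -> dart D') v x y z x' y' z' :
  triangle_move v v v h x y z x' y' z' ->
  triangle_move v v v h z (node D (node D x)) (node D (node D y))
    z' (node D' (node D' x')) (node D' (node D' y')).
Proof.
case=> -[x4 y4 z4] [xy yz zx] [vx vy vz] [E1 E2 E3] [x4' y4' z4'].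
case=> xy' yz' zx' [vx' vy' vz'] [E1' E2' E3'] R; cbv zeta in R, E1, E2, E3, E1', E2', E3'.
have eK := edgeK (curveP D); have eK' := edgeK (curveP D').
have [vx1 vx2 vx3] := virt_next x4 vx; have [vy1 vy2 vy3] := virt_next y4 vy.
have [vx1' vx2' vx3'] := virt_next x4' vx'; have [vy1' vy2' vy3'] := virt_next y4' vy'.
have [nx _ _] := porbit4 (eqP x4); have [ny _ _] := porbit4 (eqP y4).
have [nz _ _] := porbit4 (eqP z4); have [nx' _ _] := porbit4 (eqP x4').
have [ny' _ _] := porbit4 (eqP y4'); have [nz' _ _] := porbit4 (eqP z4').
have insD w : inside [:: z; node D (node D x); node D (node D y)] w = inside [:: x; y; z] w.
  by rewrite !inside3 !porbit_next orbC -orbA orbCA.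
have insD' w : inside [:: z'; node D' (node D' x'); node D' (node D' y')] w =
    inside [:: x'; y'; z'] w.
  by rewrite !inside3 !porbit_next orbC -orbA orbCA.
split=> //; cbv zeta; rewrite ?nx ?ny ?nz ?nx' ?ny' ?nz'.
- by rewrite /double_point /valency !porbit_next.
- by rewrite /at_node !porbit_next !porbit_stable.
- by rewrite E3 -E2 -E1 !eK.
- by rewrite /double_point /valency !porbit_next.
- by rewrite /at_node !porbit_next !porbit_stable.
- by rewrite E3' -E2' -E1' !eK'.
case: R => inj onto hn he bd sz ends hv ho; split=> //.
- have out w : w \in [predC inside [:: z; node D (node D x); node D (node D y)]] ->
      w \in [predC inside [:: x; y; z]] by move=> wo; suff : ~~ inside [:: x; y; z] w by []; rewrite -insD.
  by move=> u w /out uo /out wo; apply: inj.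
- move=> w; rewrite insD'; split=> [/onto[u uo uE]|[u uo uE]]; first by exists u; rewrite ?insD.
  by apply/onto; exists u; rewrite -?insD.
- by move=> w; rewrite insD; apply: hn.
- by move=> w; rewrite !insD; apply: he.
- by move=> w wes; rewrite insD; apply: bd; move: wes; rewrite !inE; do 6?case/orP; move=> ->; rewrite ?orbT.
(* The new list of ends is the old one shifted cyclically by two. *)
- move=> w; do 6?[case=> [|]] => //; rewrite insD => wo _.
  + exact: (ends w 2 wo isT).
  + exact: (ends w 3 wo isT).
  + exact: (ends w 4 wo isT).
  + exact: (ends w 5 wo isT).
  + exact: (ends w 0 wo isT).
  + exact: (ends w 1 wo isT).
- by move=> w; rewrite insD; apply: hv.
- by case: ho => w [wo wD wD']; exists w; rewrite insD.
Qed.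

Lemma at_node_next2 (D : flat_diagram) (a x : dart D) :
  at_node (node D (node D a)) x = at_node a x.
Proof. by rewrite /at_node !porbit_next. Qed.

Theorem theorem3p1 : chord_index flat_equiv flat_index.
Proof.
split.
- move=> K K' h [H _] c c' cc'; apply: rst_step; exists h; left.
  exact: flat_isotopy_smooth cc' H.
(* Smoothing a kink undoes it, so the fixed index is the flat knot of [K] itself. *)
- exists shadow; split; first exact: virtual_equiv_flat.
  move=> K K' h a [[b H] _] c ac; apply: flat_equiv_trans (index_kink H ac) _.
  apply/flat_equiv_sym/rst_step; exists h; right; exists [:: a]; exact: FlatOmega1 H.
- by move=> K K' h a b [[p [q H]] _ _] c1 c2; apply: index_bigon H.
- move=> K K' h x y z x' y' z' [H _ _ _] c c'; case=> -[].
  + exact: index_triangle H.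
  (* Two rotations bring the crossing of [y] to the first place, named there by the opposite dart;
     one rotation does it for [z]. *)
  + have H2 := triangle_move_rot (triangle_move_rot H).
    by rewrite -(at_node_next2 y) -(at_node_next2 y'); apply: index_triangle H2.
  + exact: index_triangle (triangle_move_rot H).
- by move=> K K' h x y z x' [[y' [z' H]] _ _] c c'; apply: index_triangle H.
- move=> K K' h ns H c c' cout cc'; apply: rst_step; exists h; right; exists ns.
  exact: flat_move_smooth cc' _ cout (generalized_move_flat H).
Qed.
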